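(* Let $M^n$ ($n\geq 2$) be an oriented, $n$-dimensional complete Riemannian manifold with nonpositive Ricci curvature, and let $\xi$ be a closed conformal vector field on $M$ with conformal factor $\psi_\xi$. If $$\int_M|\psi_\xi\,\xi|\,dM<+\infty,$$ then $\xi$ is parallel and the Ricci curvature of $M$ in the direction of $\xi$ vanishes identically, i.e. $\mathrm{Ric}_M(\xi,\xi)=0$ on $M$.
   Context: A smooth vector field $\xi$ on a Riemannian manifold $M$ with Levi-Civita connection $\nabla$ is called closed conformal, with conformal factor the smooth function $\psi_\xi:M\to\mathbb R$, if $\nabla_X\xi=\psi_\xi X$ for all smooth vector fields $X$ on $M$. A closed conformal vector field is called parallel if $\psi_\xi$ vanishes identically. $dM$ denotes the Riemannian volume element, and manifolds are connected. *)

(* Defs.v *)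
From HB Require Import structures.
From mathcomp Require Import all_boot all_order all_algebra.
From mathcomp Require Import all_classical all_reals all_analysis.
From mathcomp Require Import ring.
Set Implicit Arguments.
Unset Strict Implicit.
Unset Printing Implicit Defensive.
Import Order.TTheory GRing.Theory Num.Theory numFieldNormedType.Exports.
Local Open Scope classical_set_scope.
Local Open Scope ring_scope.

(* Vectors are row vectors, as in the library's Jacobian matrix ['J f x], for
   which [v *m 'J f x] is the derivative of f at x in the direction v. *)

Section Euclidean.
Context {R : realType}.

Definition partial {n} (i : 'I_n) (f : 'rV[R]_n -> R) : 'rV[R]_n -> R :=
  fun x => 'D_(delta_mx 0 i) f x.

(* C^oo on the open set U: every iterated partial derivative (i ranges over
   multi-indices, the empty one giving f itself) exists and is continuous. *)
Definition smooth_on {n} (U : set 'rV[R]_n) (f : 'rV[R]_n -> R) : Prop :=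
  forall (s : seq 'I_n) (x : 'rV[R]_n), U x ->
    {for x, continuous (foldr partial f s)} /\
    (forall i : 'I_n, derivable (foldr partial f s) x (delta_mx 0 i)).

Definition smooth_rV_on {n m} (U : set 'rV[R]_n) (f : 'rV[R]_n -> 'rV[R]_m) :=
  forall j : 'I_m, smooth_on U (fun x => f x 0 j).

(* Lebesgue integral on R^n of a nonnegative Borel function, as an iterated
   one-dimensional integral (Tonelli). *)
Fixpoint integral_rV {n} : ('rV[R]_n -> \bar R) -> \bar R :=
  match n with
  | 0 => fun f => f 0
  | n'.+1 => fun f =>
      (\int[lebesgue_measure]_(t in [set: R])
         integral_rV (fun v : 'rV[R]_n' => f (row_mx (t%:M : 'rV[R]_1) v)))%E
  end.

End Euclidean.

(* Riemannian geometry in a single coordinate system: G is the matrix of the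
   metric, and vector fields are given by their components. *)
Section Coordinates.
Context {R : realType} {n : nat}.
Implicit Types (G : 'rV[R]_n -> 'M[R]_n) (X Y Z : 'rV[R]_n -> 'rV[R]_n).

Definition bilin (B : 'M[R]_n) (u v : 'rV[R]_n) : R := (u *m B *m v^T) 0 0.

(* The Christoffel symbol \Gamma^k_{ij} of the Levi-Civita connection. *)
Definition christoffel G (k i j : 'I_n) : 'rV[R]_n -> R := fun x =>
  2^-1 * \sum_(l < n) invmx (G x) k l *
    (partial i (fun y => G y j l) x + partial j (fun y => G y i l) x
     - partial l (fun y => G y i j) x).

(* The Christoffel symbols characterize the Levi-Civita connection: it is
   torsion-free and compatible with the metric. *)
Lemma partial_symE G (i j l : 'I_n) x :
  (\forall y \near x, (G y)^T = G y) ->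
  partial l (fun y => G y i j) x = partial l (fun y => G y j i) x.
Proof.
move=> Gsym; rewrite /partial; apply: near_eq_derive; apply: filterS Gsym => y Gy.
by rewrite -[in LHS]Gy mxE.
Qed.

Lemma christoffel_torsion_free G (k i j : 'I_n) x :
  (\forall y \near x, (G y)^T = G y) ->
  christoffel G k i j x = christoffel G k j i x.
Proof.
move=> Gsym; rewrite /christoffel; congr (_ * _); apply: eq_bigr => l _.
by rewrite (partial_symE i j l Gsym) [X in X - _]addrC.
Qed.

Lemma christoffel_metric G (k i j : 'I_n) x :
  (\forall y \near x, (G y)^T = G y) -> G x \in unitmx ->
  partial k (fun y => G y i j) x =
  \sum_(l < n) (christoffel G l k i x * G x l j
                + christoffel G l k j x * G x i l).
Proof.
move=> Gsym Gunit; have GxT : (G x)^T = G x by exact: nbhs_singleton Gsym.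
have lower a b : \sum_(l < n) G x b l * christoffel G l k a x =
    2^-1 * (partial k (fun y => G y a b) x + partial a (fun y => G y k b) x
            - partial b (fun y => G y k a) x).
  rewrite /christoffel; under eq_bigr => l _ do rewrite mulrCA mulr_sumr.
  rewrite -mulr_sumr; congr (_ * _); rewrite exchange_big /=.
  transitivity (\sum_(m < n) (G x *m invmx (G x)) b m *
    (partial k (fun y => G y a m) x + partial a (fun y => G y k m) x
     - partial m (fun y => G y k a) x)).
    apply: eq_bigr => m _; rewrite mxE mulr_suml.
    by apply: eq_bigr => l _; rewrite mulrA.
  rewrite mulmxV// (bigD1 b)//= big1 => [|m mb].
    by rewrite addr0 mxE eqxx mul1r.
  by rewrite mxE eq_sym (negPf mb) mul0r.
rewrite big_split /=.
under eq_bigr => l _ do rewrite mulrC -[in G x l j]GxT mxE.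
under [X in _ + X]eq_bigr => l _ do rewrite mulrC.
rewrite !lower (partial_symE j i k Gsym).
set a := partial k _ x; set b := partial i _ x; set c := partial j _ x.
by field.
Qed.

Definition nabla G X Y : 'rV[R]_n -> 'rV[R]_n := fun x =>
  \row_k (\sum_(i < n) X x 0 i * partial i (fun y => Y y 0 k) x
          + \sum_(i < n) \sum_(j < n) christoffel G k i j x * X x 0 i * Y x 0 j).

Definition lie_bracket X Y : 'rV[R]_n -> 'rV[R]_n := fun x =>
  \row_k \sum_(i < n) (X x 0 i * partial i (fun y => Y y 0 k) x
                       - Y x 0 i * partial i (fun y => X y 0 k) x).

Definition curvature G X Y Z : 'rV[R]_n -> 'rV[R]_n := fun x =>
  nabla G X (nabla G Y Z) x - nabla G Y (nabla G X Z) x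
  - nabla G (lie_bracket X Y) Z x.

(* Ric(Y, Z) = tr (X |-> R(X, Y) Z), so that round spheres have Ric > 0. *)
Definition ricci G (x : 'rV[R]_n) : 'M[R]_n :=
  let e i := cst (delta_mx 0 i : 'rV[R]_n) in
  \matrix_(j, k) \sum_(i < n) curvature G (e i) (e j) (e k) x 0 i.

End Coordinates.

(* M is pointed (hence nonempty) only because the library's measurable types
   are. The values of [chart_map] outside [chart_dom] and of [chart_inv] outside
   [chart_img] are irrelevant. *)
Record chart (R : realType) (n : nat) (M : ptopologicalType) := Chart {
  chart_dom : set M;
  chart_img : set 'rV[R]_n;
  chart_map :> M -> 'rV[R]_n;
  chart_inv : 'rV[R]_n -> M;
  chart_dom_open : open chart_dom;
  chart_img_open : open chart_img;
  chart_map_img : forall p, chart_dom p -> chart_img (chart_map p);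
  chart_inv_dom : forall x, chart_img x -> chart_dom (chart_inv x);
  chart_mapK : forall p, chart_dom p -> chart_inv (chart_map p) = p;
  chart_invK : forall x, chart_img x -> chart_map (chart_inv x) = x;
  chart_map_continuous : {in chart_dom, continuous chart_map};
  chart_inv_continuous : {in chart_img, continuous chart_inv}
}.

Section Charts.
Context {R : realType} {n : nat} {M : ptopologicalType}.
Implicit Types c d : chart R n M.

Definition transition c d : 'rV[R]_n -> 'rV[R]_n := d \o chart_inv c.

Definition overlap c d : set 'rV[R]_n :=
  chart_img c `&` (chart_inv c @^-1` chart_dom d).

Definition compatible c d : Prop :=
  smooth_rV_on (overlap c d) (transition c d) /\
  smooth_rV_on (overlap d c) (transition d c).

End Charts.

(* An n-dimensional smooth manifold structure on M: a maximal smooth atlas,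
   with a chosen chart around each point. *)
Record smooth_structure (R : realType) (n : nat) (M : ptopologicalType) :=
SmoothStructure {
  atlas : set (chart R n M);
  chart_at : M -> chart R n M;
  chart_at_atlas : forall p, atlas (chart_at p);
  chart_at_dom : forall p, chart_dom (chart_at p) p;
  atlas_compatible : forall c d, atlas c -> atlas d -> compatible c d;
  atlas_maximal :
    forall c, (forall d, atlas d -> compatible c d) -> atlas c;
  manifold_hausdorff : hausdorff_space M;
  manifold_second_countable : @second_countable M
}.

Record orientation (R : realType) (n : nat) (M : ptopologicalType)
    (S : smooth_structure R n M) := Orientation {
  oriented_atlas : set (chart R n M);
  oriented_sub : oriented_atlas `<=` atlas S;
  oriented_cover : forall p, exists2 c, oriented_atlas c & chart_dom c p;
  oriented_det : forall c d, oriented_atlas c -> oriented_atlas d ->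
    forall x, overlap c d x -> 0 < \det ('J (transition c d) x)
}.

(* Tensor fields are given by their components in every chart of the atlas,
   as functions of the coordinates, subject to the transformation laws. *)
Record vector_field (R : realType) (n : nat) (M : ptopologicalType)
    (S : smooth_structure R n M) := VectorField {
  vf_coord :> chart R n M -> 'rV[R]_n -> 'rV[R]_n;
  vf_smooth : forall c, atlas S c -> smooth_rV_on (chart_img c) (vf_coord c);
  vf_change : forall c d, atlas S c -> atlas S d -> forall x, overlap c d x ->
    vf_coord d (transition c d x) = vf_coord c x *m 'J (transition c d) x
}.

Record riemannian_metric (R : realType) (n : nat) (M : ptopologicalType)
    (S : smooth_structure R n M) := RiemannianMetric {
  metric_coord :> chart R n M -> 'rV[R]_n -> 'M[R]_n;
  metric_smooth : forall c, atlas S c -> forall i j : 'I_n,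
    smooth_on (chart_img c) (fun x => metric_coord c x i j);
  metric_sym : forall c, atlas S c -> forall x, chart_img c x ->
    (metric_coord c x)^T = metric_coord c x;
  metric_pos : forall c, atlas S c -> forall x, chart_img c x ->
    forall v : 'rV[R]_n, v != 0 -> 0 < bilin (metric_coord c x) v v;
  metric_change : forall c d, atlas S c -> atlas S d -> forall x, overlap c d x ->
    metric_coord c x =
      'J (transition c d) x *m metric_coord d (transition c d x)
        *m ('J (transition c d) x)^T
}.

Section Riemannian.
Context {R : realType} {n : nat} {M : ptopologicalType}.
Context {S : smooth_structure R n M}.
Implicit Types (g : riemannian_metric S) (X xi : vector_field S).

Definition smooth_function (f : M -> R) : Prop :=
  forall c, atlas S c -> smooth_on (chart_img c) (f \o chart_inv c).

Definition scale_field (f : M -> R) (X : chart R n M -> 'rV[R]_n -> 'rV[R]_n)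
    : chart R n M -> 'rV[R]_n -> 'rV[R]_n :=
  fun c x => f (chart_inv c x) *: X c x.

(* By the transformation laws, any chart around p gives the same value. *)
Definition field_norm g (X : chart R n M -> 'rV[R]_n -> 'rV[R]_n) (p : M) : R :=
  let c := chart_at S p in
  Num.sqrt (bilin (g c (c p)) (X c (c p)) (X c (c p))).

Definition closed_conformal g xi (psi : M -> R) : Prop :=
  smooth_function psi /\
  forall X c, atlas S c -> forall x, chart_img c x ->
    nabla (g c) (X c) (xi c) x = scale_field psi X c x.

Definition parallel g xi (psi : M -> R) : Prop :=
  closed_conformal g xi psi /\ forall p, psi p = 0.

Definition nonpositive_ricci g : Prop :=
  forall c, atlas S c -> forall x, chart_img c x ->
    forall v : 'rV[R]_n, bilin (ricci (g c) x) v v <= 0.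

Definition ricci_vanishes_along g xi : Prop :=
  forall c, atlas S c -> forall x, chart_img c x ->
    bilin (ricci (g c) x) (xi c x) (xi c x) = 0.

(* [curve_length g p q l]: some piecewise C^1 curve from p to q has length l.
   Such a curve is a finite concatenation of C^1 curves, each of them contained
   in the domain of a chart and parametrized by [0, 1]; a C^1 map on [0, 1]
   extends to a C^1 map on the line, so gamma is taken C^1 on all of R. *)
Inductive curve_length g : M -> M -> R -> Prop :=
| curve_length_nil p : curve_length g p p 0
| curve_length_cons c (gamma : R -> 'rV[R]_n) q l :
    atlas S c ->
    (forall t, derivable gamma t 1) -> continuous (derive1 gamma) ->
    (forall t, t \in `[0, 1] -> chart_img c (gamma t)) ->
    curve_length g (chart_inv c (gamma 1)) q l ->
    curve_length g (chart_inv c (gamma 0)) q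
      ((\int[lebesgue_measure]_(t in `[0%R, 1%R])
          Num.sqrt (bilin (g c (gamma t)) (derive1 gamma t) (derive1 gamma t)))%R + l).

Definition riemannian_dist g (p q : M) : \bar R :=
  ereal_inf [set l%:E | l in curve_length g p q].

Definition complete_metric g : Prop :=
  forall u : nat -> M,
    (forall e : R, 0 < e -> exists N, forall i j, (N <= i)%N -> (N <= j)%N ->
       (riemannian_dist g (u i) (u j) < e%:E)%E) ->
    exists p, forall e : R, 0 < e -> exists N, forall i, (N <= i)%N ->
       (riemannian_dist g (u i) p < e%:E)%E.

(* dM is the Borel measure with density sqrt (det g_ij) in every chart. *)
Definition is_volume g
    (mu : {measure set (g_sigma_algebraType (@open M)) -> \bar R}) : Prop :=
  forall c, atlas S c -> forall A : set (g_sigma_algebraType (@open M)),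
    measurable A -> A `<=` chart_dom c ->
    mu A = integral_rV (fun x : 'rV[R]_n =>
      (\1_(chart_map c @` A) x * Num.sqrt (\det (g c x)))%:E).

End Riemannian.

(* Main.v *)
(* Along xi the factor psi is nondecreasing: differentiating nabla xi = psi id gives
   Ric(xi, xi) = - (n - 1) xi(psi), so xi(psi) >= 0. The field V = xi / (1 + |xi|^2) has speed
   at most 1, hence a global flow phi_t since M is complete. Suppose psi(p) > 0 and xi(p) <> 0.
   Forward in time psi stays bounded below near p, |xi|^2 grows at a definite linear rate, and
   div V = psi (n - 2 |xi|^2 / (1 + |xi|^2)) / (1 + |xi|^2) >= 0 because n >= 2, so phi_t does
   not decrease volume. For a small open set A around p and a large T the sets phi_(kT) A are
   therefore disjoint, of volume at least that of A, and |psi xi| is bounded below on all of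
   them: the integral diverges. Replacing xi by - xi excludes psi(p) < 0 likewise, and the zeros
   of xi have empty interior where psi <> 0. Hence psi = 0, and Ric(xi, xi) = 0.

   Volumes are compared without changing variables: c o phi_(-t) is again a chart of the maximal
   atlas, so only the determinant of g in these charts has to be followed. *)
Require Import Defs.
From HB Require Import structures.
From mathcomp Require Import all_boot all_order all_algebra.
From mathcomp Require Import fingroup perm.
From mathcomp Require Import all_classical all_reals all_analysis.
From mathcomp Require Import ring lra.
Set Implicit Arguments.
Unset Strict Implicit.
Unset Printing Implicit Defensive.
Import Order.TTheory GRing.Theory Num.Theory numFieldNormedType.Exports.
Local Open Scope classical_set_scope.
Local Open Scope ring_scope.

(** * Directional derivatives on R^n *)

Section Norms.
Context {R : realType}.

(** The flow enters as a family of smooth charts, so it must be C^k for every k. The derivative of a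
    local flow is half of the flow of the prolonged field on R^(2n), whence regularity by induction
    on k over all dimensions. The existence time so obtained depends on k, hence a given time is
    reached, for each k, by composing short flows along an orbit. Completeness concerns Cauchy
    sequences of the distance defined by lengths of curves, whereas extending an integral curve
    needs a limit in the topology of M. The bridge is a smooth cut-off supported in a chart: it is
    Lipschitz along curves, so a point at small distance from its centre lies in its support. The
    factor 1 / (1 + |xi|^2), unlike 1 / |xi|, is smooth at the zeros of xi. It still lets |xi|^2
    grow: the derivative along V is 2 psi |xi|^2 / (1 + |xi|^2), which stays away from 0 where psi
    and |xi| do. On A the values of |xi|^2 lie between h / 2 and 2 h, where h is the value at p, and
    T is the time in which the growth is at least 2 h. *)

Lemma coord_le_norm {m n} (v : 'M[R]_(m, n)) i j : `|v i j| <= `|v|.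
Proof.
rewrite [leRHS]/Num.Def.normr/= mx_normrE.
exact: (le_bigmax _ (fun ij => `|v ij.1 ij.2|) (i, j)).
Qed.

Lemma norm_le_coord {m n} (v : 'M[R]_(m, n)) e : 0 <= e ->
  (forall i j, `|v i j| <= e) -> `|v| <= e.
Proof.
move=> e0 ve; rewrite [leLHS]/Num.Def.normr/= mx_normrE.
by rewrite (bigmax_le _ e0)// => -[i j] _; exact: ve.
Qed.

Lemma norm_lt_coord {m n} (v : 'M[R]_(m, n)) e : 0 < e ->
  (forall i j, `|v i j| < e) -> `|v| < e.
Proof.
move=> e0 ve; rewrite [ltLHS]/Num.Def.normr/= mx_normrE.
by apply/bigmax_ltP; split=> // -[i j] _; exact: ve.
Qed.

Lemma norm_delta_mx_le {n} (i : 'I_n) : `|'e_i : 'rV[R]_n| <= 1.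
Proof.
by apply: norm_le_coord => // a b; rewrite mxE; case: (_ && _); rewrite ?normr1 ?normr0.
Qed.

Lemma row_cvgP {T : Type} {n} (F : set_system T) {FF : Filter F} (f : T -> 'rV[R]_n) (y : 'rV[R]_n) :
  (forall j, (fun t => f t 0 j) @ F --> y 0 j) -> f @ F --> y.
Proof.
move=> fy; apply/cvgrPdist_lt => e e0; near=> t.
apply: norm_lt_coord => // i j; rewrite ord1 !mxE.
move: j; near: t; apply: filter_forall => j.
by move/cvgrPdist_lt : (fy j) => /(_ e e0).
Unshelve. all: by end_near. Qed.

Lemma cvg_row {T : Type} {n} (F : set_system T) {FF : Filter F} (f : T -> 'rV[R]_n) (y : 'rV[R]_n) j :
  f @ F --> y -> (fun t => f t 0 j) @ F --> y 0 j.
Proof.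
move=> fy.
exact: (@continuous_cvg _ _ _ F FF f (fun M : 'rV[R]_n => M 0 j) y (@coord_continuous _ _ _ _ _ _) fy).
Qed.

Lemma continuous_sum {T : topologicalType} (I : Type) (r : seq I) (P : pred I)
    (f : I -> T -> R) (x : T) : (forall i, P i -> {for x, continuous (f i)}) ->
  {for x, continuous (fun y => \sum_(i <- r | P i) f i y)}.
Proof.
move=> cf; apply: (@cvg_big _ _ _ _ _ _ _ (nbhs x)) => //.
exact: add_continuous.
Qed.

Lemma continuous_prod {T : topologicalType} (I : Type) (r : seq I) (P : pred I)
    (f : I -> T -> R) (x : T) : (forall i, P i -> {for x, continuous (f i)}) ->
  {for x, continuous (fun y => \prod_(i <- r | P i) f i y)}.
Proof.
move=> cf; apply: (@cvg_big _ _ _ _ _ _ _ (nbhs x)) => //.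
exact: mul_continuous.
Qed.

End Norms.

Section Lines.
Context {R : realType} {V W : normedModType R}.

(** With the converse [is_derive_lineV], this moves every directional derivative to a function of
    one real variable, where the chain rule and the mean value theorem apply. *)
Lemma is_derive_line (f : V -> W) (x v : V) (t : R) d :
  is_derive (x + t *: v) v f d -> is_derive t 1 (fun s : R => f (x + s *: v)) d.
Proof.
have E : (fun h : R => h^-1 *: ((f \o shift (x + t *: v)) (h *: v) - f (x + t *: v))) =
         (fun h : R => h^-1 *: (((fun s => f (x + s *: v)) \o shift t) (h *: 1)
             - f (x + t *: v))).
  apply/funext => h /=; congr (_ *: (f _ - _)).
  by rewrite scalerDl addrC -addrA [_ *: v + _]addrC [h *: 1]mulr1.
move=> [dfx <-]; split; first by rewrite /derivable -E.
by rewrite /derive -E.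
Qed.

Lemma is_derive_lineV (f : V -> W) (x v : V) d :
  is_derive (0 : R) 1 (fun s : R => f (x + s *: v)) d -> is_derive x v f d.
Proof.
have E : (fun h : R => h^-1 *: ((f \o shift x) (h *: v) - f x)) =
         (fun h : R => h^-1 *: (((fun s => f (x + s *: v)) \o shift (0 : R)) (h *: 1)
             - f (x + 0 *: v))).
  apply/funext => h /=; congr (_ *: (f _ - f _)); last by rewrite scale0r addr0.
  by rewrite addr0 addrC [h *: 1]mulr1.
move=> [dfx <-]; split; first by rewrite /derivable E.
by rewrite /derive E.
Qed.

Lemma is_derive_comp_diff (f : V -> W) (u : R -> V) (t : R) du :
  differentiable f (u t) -> is_derive t 1 u du ->
  is_derive t 1 (fun s => f (u s)) ('D_du f (u t)).
Proof.
move=> df [uD uE].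
have du' : differentiable u t by exact/derivable1_diffP.
have dc : differentiable (f \o u) t by exact: differentiable_comp.
split; first exact: (diff_derivable (f := f \o u)).
have -> : 'D_1 (fun s => f (u s)) t = 'd (f \o u) t 1 by rewrite -deriveE.
have E1 : 'd u t 1 = du by rewrite -deriveE.
by rewrite diff_comp//= E1 deriveE.
Qed.

End Lines.

Lemma derivable_continuous {R : realType} {V : normedModType R} (u : R -> V) (t : R) :
  derivable u t 1 -> {for t, continuous u}.
Proof. by move/derivable1_diffP; exact: differentiable_continuous. Qed.

Section Lines2.
Context {R : realType} {V W : normedModType R}.

Lemma is_derive_comp1 (g : R -> W) (u : R -> R) (t : R) du d :
  is_derive (u t) 1 g d -> is_derive t 1 u du ->
  is_derive t 1 (fun s => g (u s)) (du *: d).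
Proof.
move=> [gD gE] ud.
have dg : differentiable g (u t) by exact/derivable1_diffP.
have := is_derive_comp_diff dg ud.
by rewrite deriveE// -[X in 'd _ _ X]mulr1 [du * 1](_ : _ = du *: 1)// linearZ/= -deriveE// gE.
Qed.

(** Homogeneity in the direction holds without differentiability of [f]: it is the chain rule for a
    rescaled parameter on one line. *)
Lemma is_derive_scale (f : V -> W) (x v : V) (k : R) d :
  is_derive x v f d -> is_derive x (k *: v) f (k *: d).
Proof.
move=> dfx; apply: is_derive_lineV.
rewrite (_ : (fun s => _) = (fun s => (fun r => f (x + r *: v)) (k * s))); last first.
  by apply/funext => s /=; rewrite scalerA mulrC.
apply: (@is_derive_comp1 (fun r => f (x + r *: v)) ( *%R k)).
  by apply: is_derive_line; rewrite mulr0 scale0r addr0.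
by apply: is_derive_eq; rewrite ?scaler0 ?addr0 ?scaler1 ?[_%:A]mulr1.
Qed.

End Lines2.

Lemma mvt_line {R : realType} {V : normedModType R} (f : V -> R) (x v : V) :
  (forall t : R, 0 <= t <= 1 -> derivable f (x + t *: v) v) ->
  exists2 t : R, 0 <= t <= 1 & f (x + v) - f x = 'D_v f (x + t *: v).
Proof.
move=> df.
have dg (t : R) : 0 <= t <= 1 ->
    is_derive t 1 (fun s : R => f (x + s *: v)) ('D_v f (x + t *: v)).
  by move=> t01; apply: is_derive_line; apply: derivableP; exact: df.
have [||t t01 E] := @MVT_segment R (fun s : R => f (x + s *: v))
   (fun t => 'D_v f (x + t *: v)) 0 1 ler01.
- move=> t; rewrite in_itv/= => /andP[t0 t1].
  by apply: dg; rewrite !ltW.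
- apply: derivable_within_continuous => t; rewrite in_itv/= => t01.
  by have [] := dg t t01.
exists t; first by move: t01; rewrite in_itv.
by move: E; rewrite scale1r scale0r addr0 subr0 mulr1.
Qed.

Section C1.
Context {R : realType} {n : nat}.
Implicit Types (f : 'rV[R]_n -> R) (x : 'rV[R]_n).

Let trunc (h : 'rV[R]_n) k : 'rV[R]_n := \row_i (if (i < k)%N then h 0 i else 0).

(** The increment is split along the axis-parallel staircase through the points [x + trunc h k]; on
    each edge the mean value theorem yields a partial derivative at a point near [x]. *)
Lemma C1_frechet f x (e : R) :
  (forall i, \forall y \near x, derivable f y ('e_i)) ->
  (forall i, {for x, continuous (partial i f)}) -> 0 < e ->
  \forall h \near (0 : 'rV[R]_n), `|f (x + h) - f x - \sum_i h 0 i * partial i f x| <= e * `|h|.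
Proof.
move=> dfx cfx e0.
(* Dividing by [n.+1] rather than [n] keeps the tolerance positive in dimension 0. *)
have e'0 : 0 < e / n.+1%:R by rewrite divr_gt0.
have : \forall y \near x, forall i, derivable f y ('e_i) /\
    `|partial i f x - partial i f y| < e / n.+1%:R.
  have H i : \forall y \near x, derivable f y ('e_i) /\
      `|partial i f x - partial i f y| < e / n.+1%:R.
    apply: filterI; first exact: dfx.
    by move/cvgrPdist_lt : (cfx i); exact.
  exact: (filter_forall _ H).
move=> /nbhs_ballP[d /= d0 xd].
have {}xd y : `|y - x| < d -> forall i, derivable f y ('e_i) /\
    `|partial i f x - partial i f y| < e / n.+1%:R.
  by move=> yd; apply: xd; rewrite -ball_normE/= distrC.
near=> h.
have hd : `|h| < d.
  near: h; apply/nbhs_ballP; exists d => // y.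
  by rewrite -ball_normE/= sub0r normrN.
have hk0 : trunc h 0 = 0 by apply/rowP => i; rewrite !mxE.
have hkn : trunc h n = h by apply/rowP => i; rewrite !mxE ltn_ord.
have step (k : 'I_n) : `|f (x + trunc h k.+1) - f (x + trunc h k) - h 0 k * partial k f x|
    <= e / n.+1%:R * `|h|.
  have inb (t : R) : 0 <= t <= 1 ->
      `|(x + trunc h k + t *: (h 0 k *: 'e_k)) - x| < d.
    move=> /andP[t0 t1].
    rewrite -[x + _ + _]addrA [x + _]addrC addrK; apply: le_lt_trans hd; apply: norm_le_coord => // a i.
    rewrite ord1 !mxE eqxx/=; have [ik|ki] := eqVneq i k.
      rewrite ik ltnn add0r mulr1 normrM ger0_norm//.
      by apply: le_trans (coord_le_norm h 0 k); rewrite ler_piMl.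
    rewrite !mulr0 addr0; case: ifP => _; first exact: coord_le_norm.
    by rewrite normr0.
  have hkS : trunc h k.+1 = trunc h k + h 0 k *: 'e_k.
    apply/rowP => i; rewrite !mxE eqxx/= ltnS leq_eqVlt.
    have [->|ik] := eqVneq i k; first by rewrite eqxx ltnn add0r mulr1.
    by rewrite -val_eqE/= in ik *; rewrite (negPf ik)/= mulr0 addr0.
  have [|t t01] := @mvt_line R _ f (x + trunc h k) (h 0 k *: 'e_k).
    move=> t t01; have [D _] := xd _ (inb t t01) k.
    by have [] := is_derive_scale (h 0 k) (derivableP D).
  have [D N] := xd _ (inb t t01) k.
  have [_ ->] := is_derive_scale (h 0 k) (derivableP D).
  rewrite -addrA -hkS => ->.
  rewrite -/(partial k f _) -mulrBr normrM mulrC.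
  by rewrite ler_pM// ?coord_le_norm// distrC ltW.
rewrite (_ : f (x + h) - f x - _ = \sum_(k < n)
    (f (x + trunc h k.+1) - f (x + trunc h k) - h 0 k * partial k f x)); last first.
  rewrite sumrB; congr (_ - _).
  rewrite -(big_mkord xpredT (fun k => f (x + trunc h k.+1) - f (x + trunc h k))).
  by rewrite telescope_sumr// hkn hk0 addr0.
apply: (le_trans (ler_norm_sum _ _ _)).
apply: (@le_trans _ _ (\sum_(k < n) e / n.+1%:R * `|h|)); first exact: ler_sum.
rewrite sumr_const card_ord -[_ *+ n]mulr_natl mulrA ler_wpM2r//.
rewrite mulrCA ger_pMr// ler_pdivrMr// mul1r ler_nat//.
Unshelve. all: by end_near. Qed.

Lemma C1_differentiable f x :
  (forall i, \forall y \near x, derivable f y ('e_i)) ->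
  (forall i, {for x, continuous (partial i f)}) -> differentiable f x.
Proof.
move=> dfx cfx.
pose D (h : 'rV[R]_n) : R := \sum_i h 0 i * partial i f x.
have D_lin : linear D.
  move=> a u v; rewrite /D scaler_sumr -big_split/=; apply: eq_bigr => i _.
  by rewrite !mxE mulrDl -mulrA.
pose DM := GRing.isLinear.Build _ _ _ _ D D_lin.
pose DL : {linear 'rV[R]_n -> R} := HB.pack D DM.
have Dc : continuous D.
  move=> u; apply: continuous_sum => i _; apply: continuousM; last exact: cst_continuous.
  exact: coord_continuous.
have E : f \o shift x = cst (f x) + DL +o_ (0 : 'rV[R]_n) id.
  apply/eqaddoP => e e0 /=.
  have := C1_frechet dfx cfx e0; apply: filterS => h.
  rewrite /= -[X in _ -> `|X| <= _]/(f (h + x) - (f x + D h)) opprD addrA.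
  by rewrite [h + x]addrC.
have dE : 'd f x = DL :> (_ -> _) by apply: diff_unique E.
by apply/diff_locallyP; rewrite dE.
Qed.

Lemma derive_partial f x v : differentiable f x ->
  'D_v f x = \sum_i v 0 i * partial i f x.
Proof.
move=> df; rewrite deriveE// [in LHS](row_sum_delta v) linear_sum; apply: eq_bigr => i _.
by rewrite linearZ/= -deriveE.
Qed.

Lemma is_derive_comp_partial f (u : R -> 'rV[R]_n) (t : R) (du : 'rV[R]_n) :
  differentiable f (u t) -> is_derive t 1 u du ->
  is_derive t 1 (fun s => f (u s)) (\sum_i du 0 i * partial i f (u t)).
Proof. by move=> df ud; rewrite -derive_partial//; exact: is_derive_comp_diff. Qed.

Lemma is_derive_row (u : R -> 'rV[R]_n) (t : R) (du : 'rV[R]_n) :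
  (forall j, is_derive t 1 (fun s => u s 0 j) (du 0 j)) <-> is_derive t 1 u du.
Proof.
split=> [ud|[ud <-] j].
  have D : derivable u t 1 by apply/derivable_mxP => i j; rewrite ord1; have [] := ud j.
  split=> //; rewrite derive_mx//; apply/rowP => j; rewrite mxE.
  by have [_ ->] := ud j.
split; first by move/derivable_mxP : ud; exact.
by rewrite derive_mx// mxE.
Qed.

End C1.

(** * C^k functions on open sets *)

Section CkDef.
Context {R : realType} {n : nat}.
Implicit Types (U : set 'rV[R]_n) (f g : 'rV[R]_n -> R).

(** A version of [smooth_on] of finite order, recursive so that closure properties go by induction
    on [k]; [smooth_CkP] returns to smoothness. *)
Fixpoint Ck k U f : Prop :=
  (forall x, U x -> {for x, continuous f}) /\
  match k with
  | 0 => True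
  | k'.+1 => (forall i x, U x -> derivable f x ('e_i)) /\
             (forall i, Ck k' U (partial i f))
  end.

Lemma Ck_cont k U f x : Ck k U f -> U x -> {for x, continuous f}.
Proof. by case: k => [|k] [+ _]; exact. Qed.

Lemma Ck_derivable k U f i x : Ck k.+1 U f -> U x -> derivable f x ('e_i).
Proof. by case=> _ [+ _]; exact. Qed.

Lemma Ck_partial k U f i : Ck k.+1 U f -> Ck k U (partial i f).
Proof. by case=> _ [_]; exact. Qed.

Lemma CkS k U f : Ck k.+1 U f -> Ck k U f.
Proof.
elim: k f => [|k IH] f [cf [df pf]]; first by split.
by split=> //; split=> // i; exact/IH/pf.
Qed.

Lemma Ck_le k l U f : (k <= l)%N -> Ck l U f -> Ck k U f.
Proof.
move=> kl; rewrite -(subnK kl); elim: (l - k)%N => // m IH.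
by rewrite addSn => /CkS.
Qed.

Lemma Ck_sub k U W f : U `<=` W -> Ck k W f -> Ck k U f.
Proof.
move=> UW; elim: k f => [|k IH] f [cf H]; split=> //; try by move=> x /UW; exact: cf.
by case: H => df pf; split=> [i x Ux|i]; [exact: df (UW _ Ux)|apply: IH; exact: pf].
Qed.

Lemma Ck_local k U f : (forall x, U x -> exists2 W, W x & Ck k W f) -> Ck k U f.
Proof.
elim: k f => [|k IH] f H.
  by split=> // x /H[W Wx [cf _]]; exact: cf.
split; first by move=> x /H[W Wx [cf _]]; exact: cf.
split=> [i x /H[W Wx [_ [df _]]]|i]; first exact: df.
by apply: IH => x /H[W Wx CW]; exists W => //; exact: Ck_partial CW.
Qed.

(** On an open set the partial derivatives depend only on the values there, so arbitrary values
    outside [U] do no harm. *)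
Lemma Ck_eq k U f g : open U -> (forall x, U x -> f x = g x) -> Ck k U f -> Ck k U g.
Proof.
move=> oU; elim: k f g => [|k IH] f g fg H.
  split=> // x Ux; have nfg : \near x, f x = g x.
    by apply: filterS (open_nbhs_nbhs (conj oU Ux)) => y; exact: fg.
  have cf := Ck_cont H Ux.
  rewrite /prop_for /continuous_at -(fg x Ux).
  by move=> P Pf; have := cf P Pf; apply: filterS2 (nfg) => y /= <-.
have nfg x : U x -> \near x, f x = g x.
  move=> Ux; apply: filterS (open_nbhs_nbhs (conj oU Ux)) => y; exact: fg.
split.
  move=> x Ux; have cf := Ck_cont H Ux.
  rewrite /prop_for /continuous_at -(fg x Ux).
  by move=> P Pf; have := cf P Pf; apply: filterS2 (nfg x Ux) => y /= <-.
case: H => _ [df pf]; split=> [i x Ux|i].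
  by apply: near_eq_derivable (df i x Ux); exact: nfg.
by apply: IH (pf i) => x Ux; apply: near_eq_derive; exact: nfg.
Qed.

Lemma smooth_CkP U f : smooth_on U f <-> forall k, Ck k U f.
Proof.
split=> [sf k|Cf s x Ux].
  elim: k f sf => [|k IH] f sf; first by split=> // x /(sf [::])[].
  split; first by move=> x /(sf [::])[].
  split=> [i x /(sf [::])[_]|i]; first exact.
  (* [foldr] applies the last index of the list first, so the derivative already taken is appended
     at the end. *)
  by apply: IH => s x Ux; have := sf (rcons s i) x Ux; rewrite -cats1 foldr_cat.
elim/last_ind: s f Cf => [|s i IH] f Cf.
  split; first exact: (Ck_cont (Cf 0%N)).
  by move=> i; exact: (@Ck_derivable 0 _ _ _ _ (Cf 1%N)).
by rewrite -cats1 foldr_cat/=; apply: IH => k; exact: (Ck_partial _ (Cf k.+1)).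
Qed.

Lemma Ck_differentiable k U f x : open U -> Ck k.+1 U f -> U x -> differentiable f x.
Proof.
move=> oU Cf Ux; apply: C1_differentiable => i.
  by apply: filterS (open_nbhs_nbhs (conj oU Ux)) => y Uy; exact: Ck_derivable Cf Uy.
by have /Ck_partial /Ck_cont := Cf; exact.
Qed.

Lemma Ck_cst k U (a : R) : Ck k U (cst a).
Proof.
elim: k a => [|k IH] a; first by split=> // x _; exact: cst_continuous.
split; first by move=> x _; exact: cst_continuous.
split=> [i x _|i]; first exact: derivable_cst.
rewrite (_ : partial i _ = cst 0); first exact: IH.
by apply/funext => x; rewrite /partial derive_cst.
Qed.

Lemma is_derive_coord i j (x : 'rV[R]_n) :
  is_derive x ('e_i) (fun y : 'rV[R]_n => y 0 j) ((i == j)%:R : R).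
Proof.
have D := @differentiable_coord R 1 n x 0 j.
split; first exact: diff_derivable.
have Did : derivable (id : 'rV[R]_n -> 'rV[R]_n) x ('e_i) by exact: derivable_id.
have := derive_mx Did.
rewrite derive_id => /rowP/(_ j); rewrite [RHS]mxE => <-.
by rewrite mxE eqxx eq_sym.
Qed.

Lemma Ck_coord k U j : Ck k U (fun y : 'rV[R]_n => y 0 j).
Proof.
case: k => [|k]; first by split=> // x _; exact: coord_continuous.
split; first by move=> x _; exact: coord_continuous.
split=> [i x _|i]; first by have [] := is_derive_coord i j x.
rewrite (_ : partial i _ = cst ((i == j)%:R)); first exact: Ck_cst.
by apply/funext => x; rewrite /partial; have [_ ->] := is_derive_coord i j x.
Qed.

Lemma CkD k U f g : open U -> Ck k U f -> Ck k U g -> Ck k U (fun x => f x + g x).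
Proof.
move=> oU; elim: k f g => [|k IH] f g Cf Cg.
  by split=> // x Ux; exact: (cvgD (Ck_cont Cf Ux) (Ck_cont Cg Ux)).
split.
  by move=> x Ux; exact: (cvgD (Ck_cont Cf Ux) (Ck_cont Cg Ux)).
split=> [i x Ux|i].
  apply: derivableD; [exact: Ck_derivable Cf Ux|exact: Ck_derivable Cg Ux].
apply: (@Ck_eq _ _ (fun x => partial i f x + partial i g x)) => //.
  move=> x Ux; rewrite /partial.
  by rewrite -deriveD//; [exact: Ck_derivable Cf Ux|exact: Ck_derivable Cg Ux].
by apply: IH; exact: Ck_partial.
Qed.

Lemma CkM k U f g : open U -> Ck k U f -> Ck k U g -> Ck k U (fun x => f x * g x).
Proof.
move=> oU; elim: k f g => [|k IH] f g Cf Cg.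
  by split=> // x Ux; exact: (cvgM (Ck_cont Cf Ux) (Ck_cont Cg Ux)).
split.
  by move=> x Ux; exact: (cvgM (Ck_cont Cf Ux) (Ck_cont Cg Ux)).
split=> [i x Ux|i].
  apply: derivableM; [exact: Ck_derivable Cf Ux|exact: Ck_derivable Cg Ux].
apply: (@Ck_eq _ _ (fun x => f x * partial i g x + g x * partial i f x)) => //.
  move=> x Ux; rewrite /partial.
  by rewrite -deriveM//; [exact: Ck_derivable Cf Ux|exact: Ck_derivable Cg Ux].
apply: CkD => //; apply: IH; by [exact: CkS|exact: Ck_partial].
Qed.

Lemma CkN k U f : open U -> Ck k U f -> Ck k U (fun x => - f x).
Proof.
move=> oU Cf; apply: (@Ck_eq _ _ (fun x => cst (-1) x * f x)) => //.
  by move=> x _; rewrite /= mulN1r.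
by apply: CkM => //; exact: Ck_cst.
Qed.

Lemma CkB k U f g : open U -> Ck k U f -> Ck k U g -> Ck k U (fun x => f x - g x).
Proof. by move=> oU Cf Cg; apply: CkD => //; exact: CkN. Qed.

Lemma Ck_sum k U (I : Type) (r : seq I) (P : pred I) (F : I -> 'rV[R]_n -> R) : open U ->
  (forall i, P i -> Ck k U (F i)) -> Ck k U (fun x => \sum_(i <- r | P i) F i x).
Proof.
move=> oU CF; elim: r => [|i r IH].
  by apply: (Ck_eq oU _ (Ck_cst k U 0)) => x _; rewrite big_nil.
have [Pi|Pi] := boolP (P i).
  apply: (Ck_eq oU _ (CkD oU (CF i Pi) IH)) => x _.
  by rewrite big_cons Pi.
by apply: (Ck_eq oU _ IH) => x _; rewrite big_cons (negPf Pi).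
Qed.

Lemma Ck_prod k U (I : Type) (r : seq I) (P : pred I) (F : I -> 'rV[R]_n -> R) : open U ->
  (forall i, P i -> Ck k U (F i)) -> Ck k U (fun x => \prod_(i <- r | P i) F i x).
Proof.
move=> oU CF; elim: r => [|i r IH].
  by apply: (Ck_eq oU _ (Ck_cst k U 1)) => x _; rewrite big_nil.
have [Pi|Pi] := boolP (P i).
  apply: (Ck_eq oU _ (CkM oU (CF i Pi) IH)) => x _.
  by rewrite big_cons Pi.
by apply: (Ck_eq oU _ IH) => x _; rewrite big_cons (negPf Pi).
Qed.

Lemma CkV k U f : open U -> (forall x, U x -> f x != 0) -> Ck k U f ->
  Ck k U (fun x => (f x)^-1).
Proof.
move=> oU f0; elim: k => [|k IH] Cf.
  by split=> // x Ux; exact: (cvgV (f0 _ Ux) (Ck_cont Cf Ux)).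
split.
  by move=> x Ux; exact: (cvgV (f0 _ Ux) (Ck_cont Cf Ux)).
split=> [i x Ux|i].
  by apply: derivableV; [exact: f0|exact: Ck_derivable Cf Ux].
have Cv := IH (CkS Cf).
apply: (Ck_eq oU _ (CkM oU (CkN oU (CkM oU Cv Cv)) (Ck_partial i Cf))) => x Ux.
rewrite /partial deriveV; [|exact: f0|exact: Ck_derivable Cf Ux].
by rewrite -invfM -expr2 -exprVn.
Qed.

End CkDef.

Section CkComp.
Context {R : realType}.

(** On the line in direction [e_i] the map [G] becomes a curve, so derivability of its components in
    this one direction suffices. *)
Lemma partial_comp {n m} (f : 'rV[R]_m -> R) (G : 'rV[R]_n -> 'rV[R]_m) x i :
  differentiable f (G x) -> (forall j, derivable (fun y => G y 0 j) x ('e_i)) ->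
  is_derive x ('e_i) (fun y => f (G y))
     (\sum_j partial i (fun y => G y 0 j) x * partial j f (G x)).
Proof.
move=> df dG; apply: is_derive_lineV.
pose u (s : R) := G (x + s *: 'e_i).
pose du : 'rV[R]_m := \row_j partial i (fun y => G y 0 j) x.
have ud : is_derive (0 : R) 1 u du.
  apply/is_derive_row => j; rewrite mxE.
  apply: (@is_derive_line R _ _ (fun y => G y 0 j) x ('e_i) 0).
  by rewrite scale0r addr0; exact/derivableP.
have E : u 0 = G x by rewrite /u scale0r addr0.
have df' : differentiable f (u 0) by rewrite E.
have := is_derive_comp_partial df' ud; rewrite E.
by under eq_bigr do rewrite mxE.
Qed.

Lemma Ck_comp {n m} k (U : set 'rV[R]_n) (W : set 'rV[R]_m) f (G : 'rV[R]_n -> 'rV[R]_m) :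
  open U -> open W -> (forall x, U x -> W (G x)) ->
  (forall j, Ck k U (fun x => G x 0 j)) -> Ck k W f -> Ck k U (fun x => f (G x)).
Proof.
move=> oU oW UW; elim: k f => [|k IH] f CG Cf.
  split=> // x Ux; apply: (@continuous_cvg _ _ _ (nbhs x) _ G f).
    exact: Ck_cont Cf (UW _ Ux).
  by apply: row_cvgP => j; exact: Ck_cont (CG j) Ux.
split.
  move=> x Ux; apply: (@continuous_cvg _ _ _ (nbhs x) _ G f).
    exact: Ck_cont Cf (UW _ Ux).
  by apply: row_cvgP => j; exact: Ck_cont (CG j) Ux.
have D i x : U x -> is_derive x ('e_i) (fun y => f (G y))
     (\sum_j partial i (fun y => G y 0 j) x * partial j f (G x)).
  move=> Ux; apply: partial_comp; first exact: Ck_differentiable Cf (UW _ Ux).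
  by move=> j; exact: Ck_derivable (CG j) Ux.
split=> [i x Ux|i]; first by have [] := D i x Ux.
have C : Ck k U (fun x => \sum_j partial i (fun y => G y 0 j) x * partial j f (G x)).
  apply: Ck_sum => // j _; apply: CkM => //; first exact: Ck_partial.
  apply: (IH (partial j f)); last exact: Ck_partial.
  by move=> l; exact: CkS.
by apply: (Ck_eq oU _ C) => x Ux; rewrite /partial; have [_ ->] := D i x Ux.
Qed.

End CkComp.

(** * Picard iteration *)

Section ClosedBalls.
Context {R : realType} {n : nat}.
Implicit Types (x y a b v : 'rV[R]_n) (f : 'rV[R]_n -> R).

Definition cball x (r : R) : set 'rV[R]_n := [set y | `|y - x| <= r].

Lemma cball_center x r : 0 <= r -> cball x r x.
Proof. by rewrite /cball/= subrr normr0. Qed.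

(** The norm is the maximum norm, so the ball is a product of segments. *)
Lemma cball_compact x r : 0 <= r -> compact (cball x r).
Proof.
move=> r0; rewrite (_ : cball x r =
    [set v : 'rV[R]_n | forall i, `[x 0 i - r, x 0 i + r]%classic (v ord0 i)]).
  by apply: (@rV_compact _ _ (fun i => `[x 0 i - r, x 0 i + r]%classic)) => i; exact: segment_compact.
apply/seteqP; split=> y /=.
  move=> yx i; rewrite in_itv/=.
  have := le_trans (coord_le_norm (y - x) 0 i) yx.
  by rewrite !mxE ler_norml => /andP[h1 h2]; apply/andP; split; lra.
move=> yx; apply: norm_le_coord => // i j; rewrite ord1 !mxE.
have := yx j; rewrite in_itv/= ler_norml => /andP[h1 h2].
by apply/andP; split; lra.
Qed.

Lemma cball_segment x r a b (t : R) : 0 <= t <= 1 -> cball x r a -> cball x r b ->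
  cball x r (a + t *: (b - a)).
Proof.
move=> /andP[t0 t1] ar br; rewrite /cball/=.
rewrite (_ : _ - x = (1 - t) *: (a - x) + t *: (b - x)); last first.
  by apply/rowP => i; rewrite !mxE; ring.
apply: (le_trans (ler_normD _ _)); rewrite !normrZ ger0_norm ?subr_ge0// ger0_norm//.
have -> : r = (1 - t) * r + t * r by ring.
by apply: lerD; apply: ler_wpM2l => //; rewrite subr_ge0.
Qed.

Lemma cball_bounded f x r : 0 <= r -> (forall y, cball x r y -> {for y, continuous f}) ->
  exists2 K, 0 <= K & forall y, cball x r y -> `|f y| <= K.
Proof.
move=> r0 cf.
have [||c cb cm] := @EVT_max_rV R n (fun y => `|f y|) _ _ (@cball_compact x r r0).
- by exists x; exact: cball_center.
- apply: continuous_in_subspaceT => y; rewrite inE => yb.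
  exact: (cvg_norm (cf y yb)).
by exists `|f c| => // y yb; apply: cm; rewrite inE.
Qed.

Lemma norm_sum_le v (c : 'I_n -> R) K : (forall i, `|c i| <= K) ->
  `|\sum_i v 0 i * c i| <= n%:R * K * `|v|.
Proof.
move=> cK; apply: (le_trans (ler_norm_sum _ _ _)).
apply: (@le_trans _ _ (\sum_(i < n) K * `|v|)).
  apply: ler_sum => i _; rewrite normrM mulrC.
  by apply: ler_pM => //; exact: coord_le_norm.
by rewrite sumr_const card_ord -[_ *+ n]mulr_natl mulrA.
Qed.

Lemma mvt_partial f a b :
  (forall t : R, 0 <= t <= 1 -> differentiable f (a + t *: (b - a))) ->
  exists2 t : R, 0 <= t <= 1 &
    f b - f a = \sum_i (b - a) 0 i * partial i f (a + t *: (b - a)).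
Proof.
move=> df; have [t t01|t t01] := @mvt_line R _ f a (b - a).
  exact/diff_derivable/df.
rewrite [a + _]addrC subrK => ->; exists t => //.
by rewrite derive_partial//; exact: df.
Qed.

Lemma C1_lipschitz U f x r : open U -> Ck 1 U f -> 0 <= r -> cball x r `<=` U ->
  exists2 L, 0 <= L & forall a b, cball x r a -> cball x r b ->
    `|f b - f a| <= L * `|b - a|.
Proof.
move=> oU Cf r0 rU.
have H i : exists K, 0 <= K /\ forall y, cball x r y -> `|partial i f y| <= K.
  have [y yr|K K0 HK] := @cball_bounded (partial i f) x r r0.
    by have /(Ck_partial i)/Ck_cont := Cf; apply; exact: rU.
  by exists K.
have [K HK] := choice H.
exists (n%:R * \sum_i K i).
  by rewrite mulr_ge0// sumr_ge0// => i _; case: (HK i).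
move=> a b ar br.
have [t t01|t t01 ->] := @mvt_partial f a b.
  by apply: (Ck_differentiable oU Cf); apply: rU; exact: cball_segment.
apply: norm_sum_le => i; rewrite (bigD1 i)//=.
apply: ler_wpDr; first by rewrite sumr_ge0// => j _; case: (HK j).
by case: (HK i) => _; apply; exact: cball_segment.
Qed.

Lemma C2_taylor U f x r : open U -> Ck 2 U f -> 0 <= r -> cball x r `<=` U ->
  exists2 C, 0 <= C & forall a b, cball x r a -> cball x r b ->
    `|f b - f a - \sum_i (b - a) 0 i * partial i f a| <= C * `|b - a| ^+ 2.
Proof.
move=> oU Cf r0 rU.
have H i : exists L, 0 <= L /\ forall a b, cball x r a -> cball x r b ->
    `|partial i f b - partial i f a| <= L * `|b - a|.
  have [L L0 HL] := C1_lipschitz oU (Ck_partial i Cf) r0 rU.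
  by exists L.
have [L HL] := choice H.
have L0 i : 0 <= L i by case: (HL i).
exists (n%:R * \sum_i L i); first by rewrite mulr_ge0// sumr_ge0.
move=> a b ar br.
have [t t01|t t01 ->] := @mvt_partial f a b.
  by apply: (Ck_differentiable oU Cf); apply: rU; exact: cball_segment.
rewrite -sumrB; under eq_bigr do rewrite -mulrBr.
rewrite expr2 mulrA -(mulrA n%:R); apply: norm_sum_le => i.
have Hi : L i <= \sum_j L j by rewrite (bigD1 i)//= ler_wpDr// sumr_ge0.
case: (HL i) => _ /(_ a (a + t *: (b - a)) ar (cball_segment t01 ar br)) /le_trans; apply.
rewrite [a + _]addrC addrK normrZ.
apply: ler_pM => //.
by case/andP: t01 => t0 t1; rewrite ger0_norm// ler_piMl.
Qed.

End ClosedBalls.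

(** * Mean value and Gronwall inequalities for curves *)

Section Stability.
Context {R : realType} {n : nat}.

(** The mean value theorem is applied to each coordinate; the maximum norm then costs no
    constant. *)
Lemma mean_value_ineq (w dw : R -> 'rV[R]_n) (t K : R) :
  (forall s : R, `|s| <= `|t| -> is_derive s 1 w (dw s) /\ `|dw s| <= K) ->
  `|w t - w 0| <= K * `|t|.
Proof.
move=> H.
have K0 : 0 <= K by have [|_] := H t _; [|exact: le_trans].
have t0 : 0 <= `|t| by [].
apply: norm_le_coord => [|i j]; first by rewrite mulr_ge0.
rewrite ord1 !mxE.
have D (s : R) : `|s| <= `|t| -> is_derive s 1 (fun s => w s 0 j) (dw s 0 j).
  by move=> st; have [/is_derive_row/(_ j)] := H s st.
have [s s01|s s01] := @mvt_line R _ (fun s => w s 0 j) 0 t.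
  have st : `|0 + s *: t| <= `|t|.
    by rewrite add0r normrZ; case/andP: s01 => s0 s1; rewrite ger0_norm// ler_piMl.
  have /(@is_derive_scale _ _ _ _ _ _ t) := D _ st.
  by rewrite scaler1 => -[].
rewrite add0r => ->.
have st : `|0 + s *: t| <= `|t|.
  by rewrite add0r normrZ; case/andP: s01 => s0 s1; rewrite ger0_norm// ler_piMl.
have /(@is_derive_scale _ _ _ _ _ _ t) := D _ st; rewrite scaler1 => -[_ ->].
rewrite normrZ mulrC ler_wpM2r//.
by apply: le_trans (coord_le_norm _ _ _) _; have [] := H _ st.
Qed.

(* Gronwall's inequality on a time interval so short that no exponential is needed. *)
Lemma gronwall_small (w dw : R -> 'rV[R]_n) (e L eta : R) :
  0 <= L -> 0 <= eta -> e * L <= 2^-1 ->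
  (forall t : R, `|t| < e -> is_derive t 1 w (dw t) /\ `|dw t| <= L * `|w t| + eta) ->
  forall t : R, `|t| < e -> `|w t| <= 2 * (`|w 0| + e * eta).
Proof.
move=> L0 eta0 eL H t te.
have e0 : 0 < e by apply: le_lt_trans te.
(* At a maximum point [c] of [|w|] the estimate closes on itself: since [e * L <= 2^-1], the term in
   [L] is absorbed by half of [|w c|]. *)
have [||c] := @EVT_max R (fun s => `|w s|) (- `|t|) `|t|.
- by rewrite (@le_trans _ _ 0)// oppr_le0.
- apply: continuous_in_subspaceT => s; rewrite inE/= in_itv/= -ler_norml => st.
  have [[/derivable1_diffP/differentiable_continuous D _] _] := H s (le_lt_trans st te).
  by apply: cvg_norm; exact: D.
rewrite in_itv/= -ler_norml => ct cm.
have M : `|w c - w 0| <= (L * `|w c| + eta) * `|c|.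
  apply: (@mean_value_ineq _ dw) => s sc.
  have st := le_trans sc ct.
  have [D B] := H s (le_lt_trans st te); split=> //.
  apply: (le_trans B); rewrite lerD2r ler_wpM2l//; apply: cm.
  by rewrite in_itv/= -ler_norml.
have wt : `|w t| <= `|w c|.
  by apply: cm; rewrite in_itv/= -ler_norml.
have tri : `|w c| <= `|w c - w 0| + `|w 0|.
  by rewrite -{1}(subrK (w 0) (w c)); exact: ler_normD.
have ce : `|c| <= e by rewrite ltW// (le_lt_trans ct).
have : (L * `|w c| + eta) * `|c| <= (L * `|w c| + eta) * e.
  by rewrite ler_wpM2l// addr_ge0// mulr_ge0.
have : e * L * `|w c| <= 2^-1 * `|w c| by rewrite ler_wpM2r.
move: M tri wt; move: (`|w c - w 0|) (`|w c|) (`|w 0|) (`|w t|) => A B C0 D.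
by nra.
Qed.

End Stability.

Section Picard.
Context {R : realType} {n : nat}.

Lemma primitive_exists (g : R -> 'rV[R]_n) (a : R) : 0 < a -> continuous g ->
  exists2 G : R -> 'rV[R]_n, G 0 = 0 & forall t : R, `|t| < a -> is_derive t 1 G (g t).
Proof.
move=> a0 cg.
have H (j : 'I_n) : exists G : R -> R, G 0 = 0 /\
    forall t : R, `|t| < a -> is_derive t 1 G (g t 0 j).
  pose f t := g t 0 j.
  have cf : continuous f by move=> t; apply: (@cvg_row _ _ _ _ _ g); exact: cg.
  (* Integrating from [- a] keeps 0 in the interior of the interval; subtracting [G0 0] normalizes
     the primitive there. *)
  pose G0 x := (\int[lebesgue_measure]_(t in `[- a, x]) f t)%R.
  exists (fun x => G0 x - G0 0); split=> [|t]; first by rewrite subrr.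
  rewrite ltr_norml => /andP[at_ ta].
  have int : lebesgue_measure.-integrable `[- a, a] (EFin \o f).
    apply: continuous_compact_integrable; first exact: segment_compact.
    exact: continuous_subspaceT.
  have [D E] := @continuous_FTC1_closed R f (- a) t a ta int at_ (cf t).
  have DG : is_derive t 1 G0 (f t) by apply: DeriveDef; [exact: D|rewrite -derive1E; exact: E].
  have := is_deriveB DG (is_derive_cst (G0 0) t 1); rewrite subr0; exact.
have [G HG] := choice H.
exists (fun t => \row_j G j t); first by apply/rowP => j; rewrite !mxE; case: (HG j).
move=> t ta; apply/is_derive_row => j.
rewrite (_ : (fun s => _) = G j); last by apply/funext => s; rewrite mxE.
by case: (HG j) => _; exact.
Qed.

(** The rate depends on [C] only, so that pointwise limits of Picard iterates are approached
    uniformly in time. *)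
Lemma geometric_cauchy1 (u : nat -> R) (C : R) :
  (forall k, `|u k.+1 - u k| <= C * 2^-1 ^+ k) ->
  exists l : R, forall k, `|u k - l| <= 2 * C * 2^-1 ^+ k.
Proof.
move=> H.
have C0 : 0 <= C by have := H 0%N; rewrite expr0 mulr1; exact: le_trans.
have cs : cvgn (series (telescope u)).
  apply: normed_cvg; apply: (@series_le_cvg R _ (geometric C 2^-1)).
  - by move=> k; exact: normr_ge0.
  - by move=> k; rewrite /= mulr_ge0// exprn_ge0.
  - by move=> k; exact: H.
  by apply: is_cvg_geometric_series; rewrite ger0_norm// invf_lt1// ltr1n.
(* The subtracted tail of the geometric series makes the induction on [m] close exactly. *)
have D m k : `|u (k + m)%N - u k| <= 2 * C * 2^-1 ^+ k - 2 * C * 2^-1 ^+ (k + m).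
  elim: m => [|m IH]; first by rewrite addn0 !subrr normr0.
  rewrite addnS -(subrK (u (k + m)%N) (u (k + m).+1)) -addrA.
  apply: (le_trans (ler_normD _ _)).
  have := lerD (H (k + m)%N) IH; move/le_trans; apply.
  by rewrite exprS; lra.
have [l ul] : exists l : R, u @ \oo --> l.
  exists (limn (series (telescope u)) + u 0%N).
  have E : u = (fun k => series (telescope u) k + u 0%N).
    by apply/funext => k; rewrite telescopeK/= subrK.
  by rewrite {1}E; apply: cvgD; [exact: cs|exact: cvg_cst].
exists l => k; rewrite distrC.
have c : (fun m => `|u (m + k)%N - u k|) @ \oo --> `|l - u k|.
  apply: cvg_norm; apply: cvgB; last exact: cvg_cst.
  by rewrite cvg_shiftn.
have := closed_cvg (fun x => x <= 2 * C * 2^-1 ^+ k) (@closed_le _ _) _ _ c.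
apply; apply: nearW => m; rewrite addnC; apply: (le_trans (D m k)).
by rewrite gerBl mulr_ge0// ?mulr_ge0// exprn_ge0.
Qed.

Lemma geometric_cauchy (u : nat -> 'rV[R]_n) (C : R) :
  (forall k, `|u k.+1 - u k| <= C * 2^-1 ^+ k) ->
  exists l : 'rV[R]_n, forall k, `|u k - l| <= 2 * C * 2^-1 ^+ k.
Proof.
move=> H.
have C0 : 0 <= C by have := H 0%N; rewrite expr0 mulr1; exact: le_trans.
have H1 j : exists l : R, forall k, `|u k 0 j - l| <= 2 * C * 2^-1 ^+ k.
  apply: geometric_cauchy1 => k; apply: le_trans (H k).
  by have := coord_le_norm (u k.+1 - u k) 0 j; rewrite !mxE.
have [l Hl] := choice H1; exists (\row_j l j) => k.
apply: norm_le_coord => [|i j]; first by rewrite !mulr_ge0// exprn_ge0.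
by rewrite ord1 !mxE.
Qed.

(** Freezing a curve outside [[- e, e]] lets the iteration work with continuous curves on the whole
    line. *)
Let clamp (e t : R) := Num.max (- e) (Num.min t e).

Lemma clamp_id e t : `|t| <= e -> clamp e t = t.
Proof.
by rewrite ler_norml => /andP[h1 h2]; rewrite /clamp min_l// max_r.
Qed.

Lemma clamp_le e t : 0 <= e -> `|clamp e t| <= e.
Proof.
move=> e0; rewrite ler_norml /clamp le_max lexx/= ge_max ge_min lexx orbT andbT.
by rewrite (le_trans _ e0)// oppr_le0.
Qed.

Lemma clamp_dist e t s : 0 <= e -> `|clamp e t - clamp e s| <= `|t - s|.
Proof.
move=> e0; rewrite /clamp.
have M (a b c : R) : `|Num.min a c - Num.min b c| <= `|a - b|.
  have [?|?] := leP a c; have [?|?] := leP b c; rewrite ?subrr ?normr0//.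
    by rewrite ler0_norm ?ler0_norm; lra.
  by rewrite ger0_norm ?ger0_norm; lra.
have M' (a b c : R) : `|Num.max c a - Num.max c b| <= `|a - b|.
  have [?|?] := leP c a; have [?|?] := leP c b; rewrite ?subrr ?normr0//.
    by rewrite ger0_norm ?ger0_norm; lra.
  by rewrite ler0_norm ?ler0_norm; lra.
exact: le_trans (M' _ _ _) (M _ _ _).
Qed.

Lemma lipschitz_continuous (y : R -> 'rV[R]_n) K :
  (forall t s : R, `|y t - y s| <= K * `|t - s|) -> continuous y.
Proof.
move=> H t; apply/cvgrPdist_lt => e e0.
have K1 : 0 < `|K| + 1 by rewrite ltr_wpDl.
apply/nbhs_ballP; exists (e / (`|K| + 1)); first by rewrite /= divr_gt0.
move=> s /= ts.
apply: (le_lt_trans (H t s)).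
have : K * `|t - s| <= (`|K| + 1) * `|t - s|.
  by rewrite ler_wpM2r// (le_trans (ler_norm _))// lerDl.
by move/le_lt_trans; apply; rewrite mulrC -ltr_pdivlMr.
Qed.

(** The condition on [e * K] keeps the iterates in the ball, and the one on [e * L] makes the
    integral operator halve uniform distances. *)
Lemma picard (F : 'rV[R]_n -> 'rV[R]_n) x0 r K L e :
  0 < e -> 0 <= K -> 0 <= L -> e * K <= r / 2 -> e * L <= 2^-1 ->
  (forall y, cball x0 r y -> {for y, continuous F}) ->
  (forall y, cball x0 r y -> `|F y| <= K) ->
  (forall a b, cball x0 r a -> cball x0 r b -> `|F b - F a| <= L * `|b - a|) ->
  forall x, cball x0 (r / 2) x -> exists2 y : R -> 'rV[R]_n, y 0 = x &
    forall t : R, `|t| < e -> cball x0 r (y t) /\ is_derive t 1 y (F (y t)).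
Proof.
move=> e0 K0 L0 eK eL cF FK FL x xr.
(* The margin makes the primitives differentiable also at the endpoints [e] and [- e], which [clamp]
   reaches. *)
have e'0 : 0 < e + 1 by rewrite addr_gt0.
(* A choice of primitives; its value is arbitrary on integrands that are not continuous. *)
have [P HP] : exists P : (R -> 'rV[R]_n) -> R -> 'rV[R]_n, forall g, continuous g ->
    P g 0 = 0 /\ forall t : R, `|t| < e + 1 -> is_derive t 1 (P g) (g t).
  suff /choice[P HP] : forall g : R -> 'rV[R]_n, exists G, continuous g ->
    G 0 = 0 /\ forall t : R, `|t| < e + 1 -> is_derive t 1 G (g t) by exists P.
  move=> g; have [cg|ncg] := pselect (continuous g); last by exists g.
  by have [G G0 HG] := primitive_exists e'0 cg; exists G.
pose good (z : R -> 'rV[R]_n) := (forall t, cball x0 r (z t)) /\ continuous z.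
have goodF z : good z -> continuous (F \o z).
  move=> [zb cz] t; apply: (@continuous_cvg _ _ _ (nbhs t) _ z F); last exact: cz.
  exact: cF.
pose T z t := x + P (F \o z) (clamp e t).
have r20 : 0 <= r / 2 by apply: le_trans xr.
have Tder z (t : R) : good z -> `|t| < e + 1 -> is_derive t 1 (fun s => x + P (F \o z) s) (F (z t)).
  move=> gz te; have [_ /(_ t te) D] := HP _ (goodF z gz).
  by rewrite -[F (z t)]add0r; apply: is_deriveD.
have ebd t : `|t| <= e -> `|t| < e + 1 by move=> te; rewrite (le_lt_trans te)// ltrDl.
have Tlip z (t s : R) : good z -> `|T z t - T z s| <= K * `|t - s|.
  move=> gz; have [zb cz] := gz.
  apply: (@le_trans _ _ (K * `|clamp e t - clamp e s|)); last first.
    by rewrite ler_wpM2l// clamp_dist// ltW.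
  rewrite /T; move: (clamp_le t (ltW e0)) (clamp_le s (ltW e0)).
  move: (clamp e t) (clamp e s) => {}t {}s te se.
  apply: norm_le_coord => [|i j]; first by rewrite mulr_ge0.
  rewrite ord1 !mxE.
  have D (u : R) : 0 <= u <= 1 -> is_derive (s + u *: (t - s)) 1 (fun v => P (F \o z) v 0 j)
      (F (z (s + u *: (t - s))) 0 j).
    move=> /andP[u0 u1].
    have ue : `|s + u *: (t - s)| < e + 1.
      apply: ebd; rewrite (_ : s + _ = (1 - u) * s + u * t); last by rewrite /GRing.scale/=; ring.
      apply: (le_trans (ler_normD _ _)); rewrite !normrM (ger0_norm u0) (@ger0_norm _ (1 - u)) ?subr_ge0//.
      have -> : e = (1 - u) * e + u * e by ring.
      by apply: lerD; apply: ler_wpM2l => //; rewrite subr_ge0.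
    have [_ /(_ _ ue)] := HP _ (goodF z gz).
    by move/is_derive_row/(_ j).
  have [u u01|u u01] := @mvt_line R _ (fun v => P (F \o z) v 0 j) s (t - s).
    by have /(@is_derive_scale _ _ _ _ _ _ (t - s)) := D u u01; rewrite scaler1 => -[].
  rewrite [s + _]addrC subrK.
  have /(@is_derive_scale _ _ _ _ _ _ (t - s)) := D u u01; rewrite scaler1 => -[_ ->] E.
  rewrite opprD addrACA subrr add0r E normrZ mulrC ler_wpM2r//.
  by apply: le_trans (coord_le_norm _ _ _) _; exact: FK.
have T0 z : good z -> T z 0 = x.
  move=> gz; rewrite /T clamp_id ?normr0 ?(ltW e0)//.
  by have [-> _] := HP _ (goodF z gz); rewrite addr0.
have Tgood z : good z -> good (T z).
  move=> gz; split; last by apply: (@lipschitz_continuous _ K) => t s; exact: Tlip.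
  move=> t; rewrite /cball/=.
  have Tc : T z t = T z (clamp e t).
    by rewrite /T [in RHS]clamp_id// clamp_le// ltW.
  rewrite Tc -(subrK x (T z _)) -addrA.
  apply: (le_trans (ler_normD _ _)).
  have -> : r = r / 2 + r / 2 by rewrite -splitr.
  apply: lerD => //.
  rewrite -[X in _ - X](T0 z gz); apply: (le_trans (Tlip _ _ _ gz)).
  rewrite subr0; apply: le_trans eK; rewrite mulrC ler_wpM2r// clamp_le// ltW//.
have Tcontr z z' M : good z -> good z' -> (forall t, `|z t - z' t| <= M) ->
    forall t, `|T z t - T z' t| <= M / 2.
  move=> gz gz' HM t.
  have M0 : 0 <= M by apply: le_trans (HM 0).
  rewrite /T opprD addrACA subrr add0r.
  move: (clamp_le t (ltW e0)); move: (clamp e t) => {}t te.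
  have := @mean_value_ineq R n (fun s => P (F \o z) s - P (F \o z') s)
    (fun s => F (z s) - F (z' s)) t (L * M).
  have [[-> _] [-> _]] := (HP _ (goodF z gz), HP _ (goodF z' gz')).
  rewrite !subr0 => H; apply: (le_trans (H _)).
    move=> s st; have se : `|s| < e + 1 by apply: ebd; exact: le_trans te.
    split.
      have [[_ /(_ s se) ?] [_ /(_ s se) ?]] := (HP _ (goodF z gz), HP _ (goodF z' gz')).
      exact: is_deriveB.
    have [zb _] := gz; have [zb' _] := gz'.
    by apply: (le_trans (FL _ _ (zb' s) (zb s))); rewrite ler_wpM2l.
  apply: (@le_trans _ _ (L * M * e)); first by rewrite ler_wpM2l// mulr_ge0.
  by rewrite mulrAC [L * e]mulrC [M / 2]mulrC ler_wpM2r.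
pose Y k := iter k T (cst x).
have r0 : 0 <= r by rewrite -(@pmulr_lge0 _ 2^-1).
have rr : r / 2 <= r by rewrite ler_pdivrMr// ler_peMr// ler1n.
have Ygood k : good (Y k).
  elim: k => [|k IH]; last exact: Tgood.
  split; last exact: cst_continuous.
  by move=> t; apply: le_trans rr.
have Ystep k t : `|Y k.+1 t - Y k t| <= (2 * r) * 2^-1 ^+ k.
  elim: k t => [|k IH] t; last first.
    rewrite exprSr mulrA; exact: (Tcontr _ _ _ (Ygood k.+1) (Ygood k) IH).
  rewrite expr0 mulr1 -(subrK x0 (Y 1%N t)) -addrA.
  apply: (le_trans (ler_normD _ _)); rewrite mulr2n mulrDl mul1r.
  by apply: lerD; [case: (Ygood 1%N) => + _; exact|rewrite distrC; case: (Ygood 0%N) => + _; apply].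
have Ylip k t s : `|Y k t - Y k s| <= K * `|t - s|.
  by case: k => [|k]; [rewrite subrr normr0 mulr_ge0|exact: Tlip].
have [z Hz] := choice (fun t => geometric_cauchy (fun k => Ystep k t)).
have geo0 (C : R) : (fun k => C * 2^-1 ^+ k) @ \oo --> (0 : R).
  have := @cvg_geometric R C 2^-1; apply.
  by rewrite ger0_norm// invf_lt1// ltr1n.
(* Inequalities pass to the limit in this form: a geometrically decaying error may be dropped. *)
have small (A B C : R) : 0 <= C -> (forall k, A <= B + C * 2^-1 ^+ k) -> A <= B.
  move=> C0 H; rewrite leNgt; apply/negP => BA.
  have /cvgrPdist_lt/(_ (A - B)) := geo0 C.
  rewrite subr_gt0 => /(_ BA)[N _ /(_ N (leqnn N))]/=.
  rewrite sub0r normrN ger0_norm ?mulr_ge0 ?exprn_ge0//.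
  by have := H N; lra.
have gz : good z.
  split=> [t|].
    apply: (small _ _ (2 * (2 * r))); first by rewrite !mulr_ge0.
    move=> k; apply: (le_trans (ler_distD (Y k t) _ _)); rewrite addrC distrC.
    by apply: lerD => //; rewrite distrC; case: (Ygood k) => + _; exact.
  apply: (@lipschitz_continuous _ K) => t s.
  apply: (small _ _ (2 * (2 * (2 * r)))) => [|k]; first by rewrite !mulr_ge0.
  have h1 := Hz t k; have h2 := Hz s k; have h3 := Ylip k t s.
  have h4 := ler_distD (Y k t) (z t) (z s); have h5 := ler_distD (Y k s) (Y k t) (z s).
  by rewrite distrC in h1; lra.
have zT t : z t = T z t.
  apply/eqP; rewrite -subr_eq0 -normr_le0; apply: (small _ _ (2 * (2 * r))); first by rewrite !mulr_ge0.
  move=> k; rewrite add0r.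
  have h1 := Hz t k.+1.
  have h2 : `|Y k.+1 t - T z t| <= 2 * (2 * r) * 2^-1 ^+ k / 2.
    by apply: (Tcontr _ _ _ (Ygood k) gz) => s; exact: Hz.
  apply: (le_trans (ler_distD (Y k.+1 t) _ _)); rewrite [X in X + _]distrC.
  by move: h1; rewrite exprSr; lra.
(* The solution is the integral without [clamp]: it agrees with the fixed point [z] up to time [e],
   and its derivative is that of a primitive. *)
exists (fun t => x + P (F \o z) t).
  by have [-> _] := HP _ (goodF z gz); rewrite addr0.
move=> t te.
have E : x + P (F \o z) t = z t by rewrite [RHS]zT /T clamp_id// ltW.
rewrite E; split; first by case: gz.
by apply: Tder => //; apply: ebd; exact: ltW.
Qed.

End Picard.

(** * Local flows *)

Section FlowData.
Context {R : realType}.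

Definition dfield {n} (F : 'rV[R]_n -> 'rV[R]_n) (a v : 'rV[R]_n) : 'rV[R]_n :=
  \row_j \sum_l v 0 l * partial l (fun y => F y 0 j) a.

(* First variation: the flow of the prolonged field is (phi, D phi v). *)
Definition prolong {n} (F : 'rV[R]_n -> 'rV[R]_n) (z : 'rV[R]_(n + n)) : 'rV[R]_(n + n) :=
  row_mx (F (lsubmx z)) (dfield F (lsubmx z) (rsubmx z)).

Lemma smooth_rV_Ck {n m} k (U : set 'rV[R]_n) (F : 'rV[R]_n -> 'rV[R]_m) j :
  smooth_rV_on U F -> Ck k U (fun y => F y 0 j).
Proof. by move=> sF; have /smooth_CkP := sF j; exact. Qed.

Lemma pos_lower_bound {n} (e : 'I_n -> R) : (forall i, 0 < e i) ->
  exists2 e', 0 < e' & forall i, e' <= e i.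
Proof.
move=> e0; have s0 : 0 <= \sum_i (e i)^-1 by rewrite sumr_ge0// => i _; rewrite invr_ge0 ltW.
exists (1 + \sum_i (e i)^-1)^-1; first by rewrite invr_gt0 ltr_wpDr.
move=> i; rewrite -[leRHS]invrK lef_pV2 ?posrE ?invr_gt0 ?ltr_wpDr//.
rewrite (bigD1 i)//= addrCA lerDl addr_ge0// sumr_ge0// => j _.
by rewrite invr_ge0 ltW.
Qed.

(** Both the Gronwall estimate for the linearized flow and the flatness of [ebump] at 0 arrive as a
    quadratic error bound. *)
Lemma is_derive_quadratic {V : normedModType R} (f : V -> R) (x v : V) (d C : R) :
  (\forall h \near (0 : R), `|f (x + h *: v) - f x - h * d| <= C * h ^+ 2) ->
  is_derive x v f d.
Proof.
move=> H.
have L : (fun h : R => h^-1 *: ((f \o shift x) (h *: v) - f x)) @ 0^' --> d.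
  apply/cvgrPdist_lt => e e0.
  have C1 : 0 < `|C| + 1 by rewrite ltr_wpDl.
  near=> h.
  have h0 : h != 0 by near: h; exact: nbhs_dnbhs_neq.
  rewrite /= [h *: v + x]addrC.
  have -> : d - h^-1 *: (f (x + h *: v) - f x) =
      - (h^-1 * (f (x + h *: v) - f x - h * d)).
    by rewrite mulrBr mulKf// opprB.
  rewrite normrN normrM.
  have Hh : `|f (x + h *: v) - f x - h * d| <= C * h ^+ 2.
    by near: h; apply: nbhs_dnbhs.
  apply: (@le_lt_trans _ _ (`|h^-1| * ((`|C| + 1) * h ^+ 2))).
    rewrite ler_wpM2l//; apply: (le_trans Hh); rewrite ler_wpM2r// ?sqr_ge0//.
    by rewrite (le_trans (ler_norm _))// lerDl.
  rewrite -real_normK ?num_real// normfV mulrCA expr2 mulKf ?normr_eq0//.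
  rewrite mulrC -ltr_pdivlMr//; near: h; apply: dnbhs0_lt.
  by rewrite divr_gt0.
have D : derivable f x v by apply/cvg_ex; exists d.
by split=> //; apply: cvg_lim.
Unshelve. all: by end_near. Qed.

(** One ball and one set of constants for all estimates on integral curves: speed, Lipschitz
    constant, size of the differential, and second-order remainder. Sums over the coordinates serve
    as common bounds. *)
Lemma flow_bounds {n} (U : set 'rV[R]_n) F x0 : open U -> smooth_rV_on U F -> U x0 ->
  exists r K L C : R, [/\ 0 < r, 0 <= K, 0 <= L, 0 <= C & cball x0 r `<=` U] /\
   [/\ forall y, cball x0 r y -> `|F y| <= K,
       forall a b, cball x0 r a -> cball x0 r b -> `|F b - F a| <= L * `|b - a|,
       forall a v, cball x0 r a -> `|dfield F a v| <= L * `|v| &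
       forall a b, cball x0 r a -> cball x0 r b ->
         `|F b - F a - dfield F a (b - a)| <= C * `|b - a| ^+ 2].
Proof.
move=> oU sF Ux0.
have CF k j : Ck k U (fun y => F y 0 j) by exact: smooth_rV_Ck.
have [r r0 rU] : exists2 r : R, 0 < r & cball x0 r `<=` U.
  have /nbhs_ballP[e /= e0 eU] := open_nbhs_nbhs (conj oU Ux0).
  exists (e / 2); first by rewrite divr_gt0.
  move=> y yx; apply: eU; rewrite -ball_normE/= distrC (le_lt_trans yx)//.
  by rewrite ltr_pdivrMr// ltr_pMr// ltr1n.
have r0' := ltW r0.
have H j : exists KLC : R * R * R, [/\ 0 <= KLC.1.1, 0 <= KLC.1.2 & 0 <= KLC.2] /\
   [/\ forall y, cball x0 r y -> `|F y 0 j| <= KLC.1.1,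
       forall a b, cball x0 r a -> cball x0 r b -> `|F b 0 j - F a 0 j| <= KLC.1.2 * `|b - a|,
       forall a (v : 'rV[R]_n), cball x0 r a -> `|\sum_l v 0 l * partial l (fun y => F y 0 j) a| <= KLC.1.2 * `|v| &
       forall a b, cball x0 r a -> cball x0 r b ->
         `|F b 0 j - F a 0 j - \sum_i (b - a) 0 i * partial i (fun y => F y 0 j) a|
            <= KLC.2 * `|b - a| ^+ 2].
  have [y yr|K K0 HK] := @cball_bounded _ _ (fun y => F y 0 j) x0 r r0'.
    by apply: (Ck_cont (CF 0%N j)); exact: rU.
  have [L L0 HL] := C1_lipschitz oU (CF 1%N j) r0' rU.
  have [C C0 HC] := C2_taylor oU (CF 2%N j) r0' rU.
  have HD l : exists D, 0 <= D /\ forall y, cball x0 r y -> `|partial l (fun y => F y 0 j) y| <= D.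
    have [y yr|D D0 HD] := @cball_bounded _ _ (partial l (fun y => F y 0 j)) x0 r r0'.
      by have /(Ck_partial l)/Ck_cont := CF 1%N j; apply; exact: rU.
    by exists D.
  have [D HD'] := choice HD.
  have D0 : 0 <= n%:R * \sum_l D l by rewrite mulr_ge0// sumr_ge0// => l _; case: (HD' l).
  exists (K, L + n%:R * \sum_l D l, C); split; split=> //=; first by rewrite addr_ge0.
    move=> a b ar br; apply: (le_trans (HL a b ar br)).
    by rewrite ler_wpM2r// lerDl.
  move=> a v ar; apply: (@le_trans _ _ (n%:R * (\sum_l D l) * `|v|)).
    apply: norm_sum_le => l; rewrite (bigD1 l)//=.
    apply: ler_wpDr; first by rewrite sumr_ge0// => m _; case: (HD' m).
    by case: (HD' l) => _; exact.
  by rewrite ler_wpM2r// lerDr.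
have [B HB] := choice H.
have K0 j : 0 <= (B j).1.1 by case: (HB j) => -[].
have L0 j : 0 <= (B j).1.2 by case: (HB j) => -[].
have C0 j : 0 <= (B j).2 by case: (HB j) => -[].
have sle (c : 'I_n -> R) j : (forall j, 0 <= c j) -> c j <= \sum_j c j.
  by move=> c0; rewrite (bigD1 j)//= ler_wpDr// sumr_ge0.
exists r, (\sum_j (B j).1.1), (\sum_j (B j).1.2), (\sum_j (B j).2).
split; split=> //; rewrite ?sumr_ge0//.
- move=> y yr; apply: norm_le_coord => [|i j]; first by rewrite sumr_ge0.
  rewrite ord1; apply: le_trans (sle (fun j => (B j).1.1) j K0).
  by case: (HB j) => _ []; auto.
- move=> a b ar br; apply: norm_le_coord => [|i j]; first by rewrite mulr_ge0// sumr_ge0.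
  rewrite ord1 !mxE; apply: le_trans (ler_wpM2r _ (sle (fun j => (B j).1.2) j L0)) => //.
  by case: (HB j) => _ []; auto.
- move=> a v ar; apply: norm_le_coord => [|i j]; first by rewrite mulr_ge0// sumr_ge0.
  rewrite ord1 !mxE; apply: le_trans (ler_wpM2r _ (sle (fun j => (B j).1.2) j L0)) => //.
  by case: (HB j) => _ []; auto.
- move=> a b ar br; apply: norm_le_coord => [|i j]; first by rewrite mulr_ge0 ?sumr_ge0// sqr_ge0.
  rewrite ord1 !mxE; apply: le_trans (ler_wpM2r _ (sle (fun j => (B j).2) j C0)); last exact: sqr_ge0.
  by case: (HB j) => _ []; auto.
Qed.

Lemma prolong_smooth {n} (U : set 'rV[R]_n) F : open U -> smooth_rV_on U F ->
  open (lsubmx @^-1` U : set 'rV[R]_(n + n)) /\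
  smooth_rV_on (lsubmx @^-1` U : set 'rV[R]_(n + n)) (prolong F).
Proof.
move=> oU sF.
have CF k j : Ck k U (fun y => F y 0 j) by exact: smooth_rV_Ck.
have oU1 : open (lsubmx @^-1` U : set 'rV[R]_(n + n)).
  apply: open_comp => // z _; apply/differentiable_continuous; exact: differentiable_lsubmx.
split=> // j; apply/smooth_CkP => k.
have Cl k' l : Ck k' (lsubmx @^-1` U : set 'rV[R]_(n + n)) (fun z => lsubmx z 0 l).
  by apply: (Ck_eq oU1 _ (Ck_coord k' _ (lshift n l))) => z _; rewrite mxE.
have Cr k' l : Ck k' (lsubmx @^-1` U : set 'rV[R]_(n + n)) (fun z => rsubmx z 0 l).
  by apply: (Ck_eq oU1 _ (Ck_coord k' _ (rshift n l))) => z _; rewrite mxE.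
have Cc (f : 'rV[R]_n -> R) : Ck k U f -> Ck k (lsubmx @^-1` U : set 'rV[R]_(n + n)) (fun z => f (lsubmx z)).
  by move=> Cf; apply: (Ck_comp oU1 oU _ _ Cf).
case: (splitP j) => i ji.
  have -> : j = lshift n i by apply/val_inj.
  by apply: (Ck_eq oU1 _ (Cc _ (CF k i))) => z _; rewrite /prolong row_mxEl.
have -> : j = rshift n i by apply/val_inj.
apply: (@Ck_eq _ _ k _ (fun z : 'rV_(n + n) =>
   \sum_l rsubmx z 0 l * partial l (fun y => F y 0 i) (lsubmx z))) => //.
  by move=> z _; rewrite /prolong row_mxEr mxE.
apply: Ck_sum => // l _; apply: CkM => //; apply: (Cc (partial l _)).
exact/Ck_partial/CF.
Qed.

(** Gronwall with [eta = 0]. Equal initial values give uniqueness, and the factor 2 gives continuity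
    in the initial point. *)
Lemma integral_curves_dist {n} (F : 'rV[R]_n -> 'rV[R]_n) x0 r L e (y1 y2 : R -> 'rV[R]_n) :
  0 <= L -> e * L <= 2^-1 ->
  (forall a b, cball x0 r a -> cball x0 r b -> `|F b - F a| <= L * `|b - a|) ->
  (forall t : R, `|t| < e -> cball x0 r (y1 t) /\ is_derive t 1 y1 (F (y1 t))) ->
  (forall t : R, `|t| < e -> cball x0 r (y2 t) /\ is_derive t 1 y2 (F (y2 t))) ->
  forall t, `|t| < e -> `|y2 t - y1 t| <= 2 * `|y2 0 - y1 0|.
Proof.
move=> L0 eL FL H1 H2 t te.
have := @gronwall_small R n (fun t => y2 t - y1 t) (fun t => F (y2 t) - F (y1 t)) e L 0
  L0 (lexx 0) eL _ t te.
rewrite mulr0 addr0; apply=> s se.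
have [[b1 d1] [b2 d2]] := (H1 s se, H2 s se).
by split; [exact: is_deriveB|rewrite addr0; exact: FL].
Qed.

Lemma continuous_of_dist {n m} (W : set 'rV[R]_n) (f : 'rV[R]_n -> 'rV[R]_m) x j :
  open W -> W x -> (forall y, W y -> `|f x - f y| <= 2 * `|x - y|) ->
  {for x, continuous (fun y => f y 0 j)}.
Proof.
move=> oW Wx H; apply: (@cvg_row _ _ _ (nbhs x) _ f); apply/cvgrPdist_lt => eta eta0.
have b : nbhs x (ball x (eta / 2)).
  by apply: nbhsx_ballx; rewrite divr_gt0.
have : nbhs x (W `&` ball x (eta / 2)) by apply: filterI => //; exact: open_nbhs_nbhs.
apply: filterS => y [Wy]; rewrite -ball_normE/= => xy.
by apply: (le_lt_trans (H y Wy)); rewrite mulrC -ltr_pdivlMr.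
Qed.

Lemma flow_time (K L r : R) : 0 <= K -> 0 <= L -> 0 < r ->
  exists2 e, 0 < e & e * K <= r / 2 /\ e * L <= 2^-1.
Proof.
move=> K0 L0 r0.
have a0 : 0 < r / 2 / (K + 1) by rewrite !divr_gt0// ltr_wpDl.
have b0 : 0 < 2^-1 / (L + 1) by rewrite !divr_gt0// ltr_wpDl.
exists (Num.min (r / 2 / (K + 1)) (2^-1 / (L + 1))); first by rewrite lt_min a0 b0.
split.
  apply: (@le_trans _ _ (r / 2 / (K + 1) * K)); first by rewrite ler_wpM2r// ge_min lexx.
  rewrite mulrAC ler_pdivrMr ?ltr_wpDl// ler_wpM2l ?lerDl//.
  by rewrite divr_ge0// ltW.
apply: (@le_trans _ _ (2^-1 / (L + 1) * L)); first by rewrite ler_wpM2r// ge_min lexx orbT.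
by rewrite mulrAC ler_pdivrMr ?ltr_wpDl// ler_wpM2l ?lerDl//.
Qed.

Lemma flow_family {n} (U : set 'rV[R]_n) F x0 r K L e : open U -> smooth_rV_on U F ->
  0 < r -> cball x0 r `<=` U -> 0 < e -> 0 <= K -> 0 <= L -> e * K <= r / 2 -> e * L <= 2^-1 ->
  (forall y, cball x0 r y -> `|F y| <= K) ->
  (forall a b, cball x0 r a -> cball x0 r b -> `|F b - F a| <= L * `|b - a|) ->
  exists phi : R -> 'rV[R]_n -> 'rV[R]_n, forall x, cball x0 (r / 2) x ->
    phi 0 x = x /\
    forall t, `|t| < e -> cball x0 r (phi t x) /\ is_derive t (1 : R) (phi^~ x) (F (phi t x)).
Proof.
move=> oU sF r0 rU e0 K0 L0 eK eL FK FL.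
have cF y : cball x0 r y -> {for y, continuous F}.
  move=> yr; apply: (@row_cvgP _ _ _ (nbhs y) _ F) => j.
  by apply: (Ck_cont (smooth_rV_Ck 0 j sF)); exact: rU.
suff /choice[phi Hphi] : forall x, exists y : R -> 'rV[R]_n, cball x0 (r / 2) x -> y 0 = x /\
    forall t, `|t| < e -> cball x0 r (y t) /\ is_derive t (1 : R) y (F (y t)).
  by exists (fun t x => phi x t) => x xr; exact: Hphi.
move=> x; have [xr|nxr] := pselect (cball x0 (r / 2) x); last by exists (cst 0).
by have [y y0 Hy] := picard e0 K0 L0 eK eL cF FK FL xr; exists y.
Qed.

(** The speed bound [C] confines the prolonged curves in the induction on [k]. The last clause is
    the variational equation at time 0; it produces the Lie derivative of the metric. *)
Definition local_flow {n} (U : set 'rV[R]_n) F x0 (k : nat) (e d C : R)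
    (phi : R -> 'rV[R]_n -> 'rV[R]_n) : Prop :=
  [/\ 0 < e, 0 < d,
    forall x t, ball x0 d x -> `|t| < e ->
      [/\ phi 0 x = x, U (phi t x), is_derive t (1 : R) (phi^~ x) (F (phi t x)) &
          `|phi t x - x| <= C * `|t|],
    forall t j, `|t| < e -> Ck k (ball x0 d) (fun x => phi t x 0 j) &
    (0 < k)%N -> forall x i j, ball x0 d x ->
      is_derive (0 : R) (1 : R) (fun s => partial i (fun y => phi s y 0 j) x)
        (partial i (fun y => F y 0 j) x)].

(** All dimensions are treated at once because the induction hypothesis is used for [prolong F] in
    dimension [n + n]: the derivative of the flow along [e_i] is the second half of the prolonged
    flow started at [(x, e_i)], which is C^k by induction. *)
Lemma local_flow_exists k : forall n (U : set 'rV[R]_n) F x0,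
  open U -> smooth_rV_on U F -> U x0 ->
  exists e d C phi, local_flow U F x0 k e d C phi.
Proof.
elim: k => [|k IH] n U F x0 oU sF Ux0.
  have [r [K [L [C [[r0 K0 L0 C0 rU] [FK FL DL FC]]]]]] := flow_bounds oU sF Ux0.
  have [e e0 [eK eL]] := @flow_time K L r K0 L0 r0.
  have r20 : 0 < r / 2 by rewrite divr_gt0.
  have [phi Hphi] := flow_family oU sF r0 rU e0 K0 L0 eK eL FK FL.
  have inb x : ball x0 (r / 2) x -> cball x0 (r / 2) x.
    by rewrite -ball_normE/= /cball/= distrC; exact: ltW.
  have inb2 y : cball x0 r y -> U y by exact: rU.
  exists e, (r / 2), K, phi; split=> //.
    move=> x t /inb xb te; have [p0 H] := Hphi x xb.
    have [tb td] := H t te; split=> //; first exact: rU.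
    have := @mean_value_ineq R n (phi^~ x) (fun s => F (phi s x)) t K; rewrite /= p0; apply => s st.
    have [sb sd] := H s (le_lt_trans st te); split=> //; exact: FK.
  move=> t j te; split=> // x xb.
  have od : open (ball x0 (r / 2)) by exact: ball_open.
  have CC := @continuous_of_dist n n (ball x0 (r / 2)) (phi t) x j od xb.
  apply: CC => y yb.
  have [p0 H] := Hphi x (inb _ xb); have [q0 H'] := Hphi y (inb _ yb).
  by have := integral_curves_dist L0 eL FL H' H te; rewrite p0 q0.
have [r [K [L [C [[r0 K0 L0 C0 rU] [FK FL DL FC]]]]]] := flow_bounds oU sF Ux0.
have [e e0 [eK eL]] := @flow_time K L r K0 L0 r0.
have r20 : 0 < r / 2 by rewrite divr_gt0.
have [phi Hphi] := flow_family oU sF r0 rU e0 K0 L0 eK eL FK FL.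
have [oU1 sF1] := prolong_smooth oU sF.
(* One prolonged flow for each basis vector, around the point [(x0, e_i)]. *)
have H1 (i : 'I_n) : exists edC : R * R * R, exists Phi,
    local_flow (lsubmx @^-1` U : set 'rV[R]_(n + n)) (prolong F)
      (row_mx x0 ('e_i)) k edC.1.1 edC.1.2 edC.2 Phi.
  have [|e1 [d1 [C1 [Phi HPhi]]]] := IH _ _ (prolong F) (row_mx x0 ('e_i)) oU1 sF1.
    by rewrite /= row_mxKl.
  by exists (e1, d1, C1), Phi.
have [B HB] := choice H1.
have [Phi HPhi] := choice HB.
(* The second bound on the time limits the displacement of a prolonged curve to [r / 2], so that its
   first half stays in the ball where [F] is controlled. *)
pose ee i := Num.min (B i).1.1 (r / 2 / (`|(B i).2| + 1)).
have ee0 i : 0 < ee i.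
  by rewrite lt_min; case: (HPhi i) => -> *; rewrite divr_gt0// ltr_wpDl.
have dd0 i : 0 < (B i).1.2 by case: (HPhi i).
have [e1 e10 He1] := pos_lower_bound ee0.
have [d1 d10 Hd1] := pos_lower_bound dd0.
pose e' := Num.min e e1; pose d := Num.min (r / 2) d1.
have e'0 : 0 < e' by rewrite lt_min e0 e10.
have d0 : 0 < d by rewrite lt_min r20 d10.
have e'e (t : R) : `|t| < e' -> `|t| < e by move=> /lt_le_trans; apply; rewrite ge_min lexx.
have eL' : e' * L <= 2^-1 by apply: le_trans eL; rewrite ler_wpM2r// ge_min lexx.
have inb x : ball x0 d x -> cball x0 (r / 2) x.
  rewrite -ball_normE/= /cball/= distrC => /ltW/le_trans; apply.
  by rewrite ge_min lexx.
have inb1 x i : ball x0 d x -> ball (row_mx x0 ('e_i)) (B i).1.2 (row_mx x ('e_i)).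
  rewrite -!ball_normE/= => xd; rewrite opp_row_mx add_row_mx subrr.
  apply: norm_lt_coord => // a j; rewrite ord1; case: (splitP j) => l jl.
    have -> : j = lshift n l by apply/val_inj.
    rewrite row_mxEl; apply: (le_lt_trans (coord_le_norm _ _ _)).
    by apply: (lt_le_trans xd); rewrite ge_min Hd1 orbT.
  have -> : j = rshift n l by apply/val_inj.
  by rewrite row_mxEr mxE normr0.
pose z i x t := Phi i t (row_mx x ('e_i)).
have w_curve x i : ball x0 d x -> z i x 0 = row_mx x ('e_i) /\
    forall t, `|t| < e' ->
      is_derive t (1 : R) (fun t => rsubmx (z i x t)) (dfield F (phi t x) (rsubmx (z i x t))).
  move=> xd; have [E0 _ H2 _ _] := HPhi i.
  have zE : z i x 0 = row_mx x ('e_i).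
    by have [] := H2 _ 0 (inb1 _ i xd) _ => //; rewrite normr0.
  split=> // t te.
  have te1 (s : R) : `|s| < e' -> `|s| < (B i).1.1.
    move=> /lt_le_trans; apply; rewrite ge_min; apply/orP; right.
    by apply: (le_trans (He1 i)); rewrite ge_min lexx.
  have zd s : `|s| < e' -> is_derive s (1 : R) (z i x) (prolong F (z i x s)).
    by move=> /te1 se; have [] := H2 _ s (inb1 _ i xd) se.
  have ld s : `|s| < e' -> is_derive s (1 : R) (fun t => lsubmx (z i x t)) (F (lsubmx (z i x s))).
    move=> /zd/is_derive_row zs; apply/is_derive_row => j.
    have := zs (lshift n j); rewrite /prolong row_mxEl.
    by rewrite (_ : (fun t => _) = (fun t => lsubmx (z i x t) 0 j))//; apply/funext => u; rewrite mxE.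
  have rd s : `|s| < e' -> is_derive s (1 : R) (fun t => rsubmx (z i x t)) (dfield F (lsubmx (z i x s)) (rsubmx (z i x s))).
    move=> /zd/is_derive_row zs; apply/is_derive_row => j.
    have := zs (rshift n j); rewrite /prolong row_mxEr.
    by rewrite (_ : (fun t => _) = (fun t => rsubmx (z i x t) 0 j))//; apply/funext => u; rewrite mxE.
  have lb s : `|s| < e' -> cball x0 r (lsubmx (z i x s)).
    move=> se; have [_ _ _ zs] := H2 _ s (inb1 _ i xd) (te1 s se).
    have : `|lsubmx (z i x s) - x| <= (B i).2 * `|s|.
      apply: norm_le_coord => [|a j]; first by apply: le_trans zs.
      rewrite ord1; apply: le_trans zs; apply: le_trans (coord_le_norm _ 0 (lshift n j)).
      suff -> : (lsubmx (z i x s) - x) 0 j = (z i x s - row_mx x ('e_i)) 0 (lshift n j) by [].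
      by rewrite [RHS]mxE [(- row_mx _ _) _ _]mxE row_mxEl !mxE.
    move=> zx; rewrite /cball/= -(subrK x (lsubmx _)) -addrA.
    apply: (le_trans (ler_normD _ _)).
    have -> : r = r / 2 + r / 2 by rewrite -splitr.
    apply: lerD; last exact: (inb _ xd).
    apply: (le_trans zx).
    apply: (@le_trans _ _ ((`|(B i).2| + 1) * `|s|)).
      by rewrite ler_wpM2r// (le_trans (ler_norm _))// lerDl.
    rewrite mulrC -ler_pdivlMr ?ltr_wpDl//; apply: (le_trans (ltW se)).
    rewrite ge_min; apply/orP; right; apply: (le_trans (He1 i)).
    by rewrite ge_min lexx orbT.
  (* By uniqueness the first half of the prolonged curve is the flow line of [x] itself. *)
  suff <- : lsubmx (z i x t) = phi t x by exact: rd.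
  have [p0 H] := Hphi x (inb _ xd).
  have := integral_curves_dist L0 eL' FL (fun s se => H s (e'e s se))
    (fun s se => conj (lb s se) (ld s se)) te.
  rewrite zE row_mxKl p0 subrr normr0 mulr0 normr_le0 subr_eq0 => /eqP.
  exact.
(* Existence of the partial derivative of the flow: the linearization error is shown to be of order
   [h ^+ 2], uniformly in time. *)
have key x i t j : ball x0 d x -> `|t| < e' ->
    is_derive x ('e_i) (fun y => phi t y 0 j)
      (Phi i t (row_mx x ('e_i)) 0 (rshift n j)).
  move=> xd te; have [z0 zd] := w_curve x i xd.
  apply: (@is_derive_quadratic _ _ _ _ _ (2 * (e' * (C * 4)))).
  near=> h.
  have xhd : ball x0 d (x + h *: 'e_i).
    near: h; have c : {for (0 : R), continuous (fun h : R => x + h *: ('e_i : 'rV[R]_n))}.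
      by apply: continuousD; [exact: cst_continuous|exact: scalel_continuous].
    apply: c; rewrite scale0r addr0.
    have od : open (ball x0 d) by exact: ball_open.
    by apply: open_nbhs_nbhs; split.
  have [p0 Hp] := Hphi x (inb _ xd); have [q0 Hq] := Hphi _ (inb _ xhd).
  pose b s := phi s (x + h *: 'e_i).
  have {}q0 : b 0 = x + h *: 'e_i := q0.
  have {}Hq : forall s : R, `|s| < e -> cball x0 r (b s) /\ is_derive s (1 : R) b (F (b s)) := Hq.
  have eta0 : 0 <= C * 4 * h ^+ 2 by apply: mulr_ge0; [rewrite mulr_ge0|exact: sqr_ge0].
  (* The error [rho] starts at 0 and satisfies Gronwall's hypothesis with [eta] of order [h ^+ 2];
     the 4 is the square of the factor in [integral_curves_dist]. *)
  pose rho s := b s - phi s x - h *: rsubmx (z i x s).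
  have rho0 : rho 0 = 0 by rewrite /rho z0 row_mxKr p0 q0 [x + _]addrC addrK subrr.
  have rhod (s : R) : `|s| < e' ->
      is_derive s (1 : R) rho (F (b s) - F (phi s x) - h *: dfield F (phi s x) (rsubmx (z i x s))) /\
      `|F (b s) - F (phi s x) - h *: dfield F (phi s x) (rsubmx (z i x s))| <=
        L * `|rho s| + C * 4 * h ^+ 2.
    move=> se.
    have [bb bd] := Hq s (e'e s se); have [pb pd] := Hp s (e'e s se).
    split.
      apply: is_deriveB; [exact: is_deriveB|exact: (is_deriveZ _ (zd s se))].
    have -> : F (b s) - F (phi s x) - h *: dfield F (phi s x) (rsubmx (z i x s)) =
       dfield F (phi s x) (b s - phi s x - h *: rsubmx (z i x s)) +
       (F (b s) - F (phi s x) - dfield F (phi s x) (b s - phi s x)).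
      apply/rowP => l; rewrite !mxE.
      have -> : \sum_m (b s - phi s x - h *: rsubmx (z i x s)) 0 m * partial m (fun y => F y 0 l) (phi s x)
        = \sum_m (b s - phi s x) 0 m * partial m (fun y => F y 0 l) (phi s x) -
          h * \sum_m rsubmx (z i x s) 0 m * partial m (fun y => F y 0 l) (phi s x).
        rewrite mulr_sumr -sumrB; apply: eq_bigr => m _.
        by rewrite !mxE; ring.
      by ring.
    apply: (le_trans (ler_normD _ _)); apply: lerD; first exact: DL.
    apply: (le_trans (FC _ _ pb bb)).
    rewrite -mulrA ler_wpM2l//.
    have := integral_curves_dist L0 eL FL Hp Hq (e'e s se).
    rewrite -/(b s) -/(b 0) q0 p0 [x + _]addrC addrK normrZ => bs.
    have : `|b s - phi s x| <= 2 * `|h|.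
      apply: (le_trans bs); rewrite ler_wpM2l//.
      by rewrite -[leRHS]mulr1 ler_wpM2l// norm_delta_mx_le.
    move=> hs; apply: (@le_trans _ _ ((2 * `|h|) ^+ 2)).
      by rewrite ler_pXn2r ?nnegrE// mulr_ge0.
    by rewrite exprMn real_normK ?num_real// -natrX.
  have := gronwall_small L0 eta0 eL' rhod te.
  rewrite rho0 normr0 add0r !mulrA; apply: le_trans.
  by apply: le_trans (coord_le_norm (rho t) 0 j); rewrite /rho !mxE.
have pE x i t j : ball x0 d x -> `|t| < e' ->
    partial i (fun y => phi t y 0 j) x = Phi i t (row_mx x ('e_i)) 0 (rshift n j).
  by move=> xd te; have [_] := key x i t j xd te.
exists e', d, K, phi; split=> //.
- move=> x t /inb xb /e'e te; have [p0 H] := Hphi x xb.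
  have [tb td] := H t te; split=> //; first exact: rU.
  have := @mean_value_ineq R n (phi^~ x) (fun s => F (phi s x)) t K; rewrite /= p0; apply => s st.
  have [sb sd] := H s (le_lt_trans st te); split=> //; exact: FK.
- move=> t j te.
  have od : open (ball x0 d) by exact: ball_open.
  split.
    move=> x xb; apply: (@continuous_of_dist _ _ _ (phi t) x j od xb) => y yb.
    have [p0 H] := Hphi x (inb _ xb); have [q0 H'] := Hphi y (inb _ yb).
    by have := integral_curves_dist L0 eL FL H' H (e'e t te); rewrite p0 q0.
  split=> [i x xd|i]; first by have [] := key x i t j xd te.
  have te1 : `|t| < (B i).1.1.
    move: te => /lt_le_trans; apply; rewrite ge_min; apply/orP; right.
    by apply: (le_trans (He1 i)); rewrite ge_min lexx.
  have [_ _ _ CPhi _] := HPhi i.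
  have C1 := CPhi t (rshift n j) te1.
  apply: (@Ck_eq _ _ k _ (fun x => Phi i t (row_mx x ('e_i)) 0 (rshift n j))) => //.
    by move=> x xd; rewrite pE.
  apply: (@Ck_comp _ _ _ _ (ball x0 d) _ (fun z => Phi i t z 0 (rshift n j))
     (fun x => row_mx x ('e_i)) od _ _ _ C1).
  + exact: ball_open.
  + by move=> x xd; exact: inb1.
  + move=> l; case: (splitP l) => m lm.
      have -> : l = lshift n m by apply/val_inj.
      by apply: (Ck_eq od _ (Ck_coord k _ m)) => x _; rewrite row_mxEl.
    have -> : l = rshift n m by apply/val_inj.
    by apply: (Ck_eq od _ (Ck_cst k _ (('e_i : 'rV[R]_n) 0 m))) => x _; rewrite row_mxEr.
(* The linear equation of the second half, read at time 0 with initial vector [e_i]. *)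
- move=> _ x i j xd.
  have [z0 zd] := w_curve x i xd.
  have z00 : `|(0 : R)| < e' by rewrite normr0.
  have [p0 _] := Hphi x (inb _ xd).
  have /is_derive_row/(_ j) := zd 0 z00.
  rewrite z0 row_mxKr p0 mxE (bigD1 i)//= mxE !eqxx mul1r big1 ?addr0; last first.
    by move=> l li; rewrite mxE (negPf li) andbF mul0r.
  apply: near_eq_is_derive; near=> s.
  have se : `|s| < e'.
    by near: s; apply/nbhs_ballP; exists e' => // s'; rewrite -ball_normE/= sub0r normrN.
  by rewrite pE// !mxE.
Unshelve. all: by end_near. Qed.

End FlowData.

(** * Determinants, second derivatives and bump functions *)

Section VectorCalculus.
Context {R : realType}.

Lemma differentiable_row {n m} (f : 'rV[R]_n -> 'rV[R]_m) x :
  (forall j, differentiable (fun y => f y 0 j) x) -> differentiable f x.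
Proof.
move=> df; rewrite (_ : f = \sum_j (fun y => f y 0 j *: ('e_j : 'rV[R]_m))).
  by apply: differentiable_sum => j; exact: differentiableZl.
by apply/funext => y; rewrite fct_sumE [LHS]row_sum_delta.
Qed.

Lemma jacobianE {n m} (f : 'rV[R]_n -> 'rV[R]_m) x i j : differentiable f x ->
  'J f x i j = partial i (fun y => f y 0 j) x.
Proof.
move=> df; have D : derivable f x ('e_i) by exact: diff_derivable.
have := derive_mx D; rewrite deriveEjacobian// => /rowP/(_ j).
by rewrite -rowE !mxE.
Qed.

Lemma is_derive_jacobian {n m} (f : 'rV[R]_n -> 'rV[R]_m) (u : R -> 'rV[R]_n) (t : R) du :
  differentiable f (u t) -> is_derive t 1 u du ->
  is_derive t 1 (fun s => f (u s)) (du *m 'J f (u t)).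
Proof.
move=> df ud; have := is_derive_comp_diff df ud.
by rewrite [X in is_derive _ _ _ X -> _]deriveE// /jacobian mul_rV_lin1.
Qed.

Lemma jacobian_comp {n m p} (f : 'rV[R]_n -> 'rV[R]_m) (g : 'rV[R]_m -> 'rV[R]_p) h x :
  differentiable f x -> differentiable g (f x) -> (\forall y \near x, h y = g (f y)) ->
  differentiable h x -> 'J h x = 'J f x *m 'J g (f x).
Proof.
move=> Df Dg nE Dh.
apply/row_matrixP => i; rewrite [in LHS]rowE [in RHS]rowE mulmxA /jacobian !mul_rV_lin1/=.
set v := 'e_i.
transitivity ('d (g \o f) x v); last by rewrite diff_comp.
transitivity ('D_v h x); first by rewrite deriveE.
rewrite (near_eq_derive v (g := g \o f))//.
by rewrite deriveE//; exact: differentiable_comp.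
Qed.

Lemma derive_comp_jacobian {n m} (f : 'rV[R]_n -> 'rV[R]_m) (h : 'rV[R]_m -> R) k x v :
  differentiable f x -> differentiable h (f x) -> (\forall y \near x, k y = h (f y)) ->
  'D_v k x = 'D_(v *m 'J f x) h (f x).
Proof.
move=> Df Dh nE; rewrite (near_eq_derive v (g := h \o f))// deriveE; last exact: differentiable_comp.
by rewrite diff_comp//= deriveE// /jacobian mul_rV_lin1.
Qed.

Lemma is_derive_bigsum {V : normedModType R} (I : Type) (r : seq I) (f : I -> V -> R) (df : I -> R) x v :
  (forall i, is_derive x v (f i) (df i)) ->
  is_derive x v (fun y => \sum_(i <- r) f i y) (\sum_(i <- r) df i).
Proof.
move=> H; elim: r => [|i r IH].
  rewrite big_nil (_ : (fun y => _) = cst 0); first exact: is_derive_cst.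
  by apply/funext => y; rewrite big_nil.
rewrite big_cons (_ : (fun y => _) = f i + (fun y => \sum_(j <- r) f j y)).
  exact: is_deriveD.
by apply/funext => y; rewrite big_cons.
Qed.

Lemma is_derive_bigprod {V : normedModType R} (I : eqType) (r : seq I) (f : I -> V -> R)
    (df : I -> R) x v : uniq r ->
  (forall i, is_derive x v (f i) (df i)) ->
  is_derive x v (fun y => \prod_(i <- r) f i y)
    (\sum_(k <- r) df k * \prod_(i <- r | i != k) f i x).
Proof.
move=> + H; elim: r => [|i r IH] /=.
  rewrite big_nil (_ : (fun y => _) = cst 1); first by move=> _; exact: is_derive_cst.
  by apply/funext => y; rewrite big_nil.
move=> /andP[ir ur]; rewrite (_ : (fun y => _) = f i * (fun y => \prod_(j <- r) f j y)); last first.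
  by apply/funext => y; rewrite big_cons.
have D := IH ur; apply: is_derive_eq.
rewrite big_cons [in RHS]big_cons eqxx/= addrC; congr (_ + _).
  rewrite [LHS]/GRing.scale/= mulrC; congr (_ * _).
  rewrite [RHS]big_seq_cond [LHS]big_seq; apply: eq_big => [j|//].
  by case: (boolP (j \in r)) => //= jr; symmetry; apply: contraNneq ir => <-.
transitivity (\sum_(k <- r) f i x * (df k * \prod_(j <- r | j != k) f j x)).
  exact: mulr_sumr.
apply: eq_big_seq => k kr.
rewrite big_cons (_ : (i != k) = true); first by rewrite mulrCA.
by apply: contraNneq ir => ->.
Qed.

(** In the Leibniz expansion only the identity permutation contributes: any other one moves at least
    two indices, so a vanishing factor survives the differentiation of one factor. *)
Lemma is_derive_det1 {V : normedModType R} {n} (N : V -> 'M[R]_n) (dN : 'M[R]_n) x v :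
  (forall i j, is_derive x v (fun y => N y i j) (dN i j)) -> N x = 1%:M ->
  is_derive x v (fun y => \det (N y)) (\tr dN).
Proof.
move=> H N1.
have D (s : {perm 'I_n}) : is_derive x v (fun y => (-1) ^+ s * \prod_(i <- index_enum 'I_n) N y i (s i))
   ((-1) ^+ s * \sum_(k <- index_enum 'I_n) dN k (s k) * \prod_(i <- index_enum 'I_n | i != k) N x i (s i)).
  apply: is_deriveZ; apply: (is_derive_bigprod (index_enum_uniq _)) => i; exact: H.
have := is_derive_bigsum (index_enum {perm 'I_n}) D.
rewrite (_ : \sum_(i <- _) _ = \tr dN)//.
rewrite (bigD1 1%g)//= [X in _ + X]big1 ?addr0.
  rewrite odd_perm1 expr0 mul1r /mxtrace; apply: eq_bigr => k _.
  by rewrite perm1 big1 ?mulr1// => i _; rewrite perm1 N1 mxE eqxx.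
move=> s s1; rewrite big1 ?mulr0// => k _.
suff [i ik si] : exists2 i, i != k & s i != i.
  rewrite (bigD1 i)//= N1 mxE eq_sym (negPf si) mul0r mulr0//.
apply: contrapT => nex; move: s1 => /negP; apply; apply/eqP/permP => i; rewrite perm1.
have fx j : j != k -> s j = j.
  by move=> jk; apply/eqP/negPn/negP => sj; apply: nex; exists j.
have [->|/fx//] := eqVneq i k.
apply/eqP/negPn/negP => sk; have := fx _ sk => /perm_inj E.
by rewrite E eqxx in sk.
Qed.

(** Jacobi's formula, reduced to the identity matrix by factoring out [N x]. *)
Lemma is_derive_det {V : normedModType R} {n} (N : V -> 'M[R]_n) (dN : 'M[R]_n) x v :
  (forall i j, is_derive x v (fun y => N y i j) (dN i j)) -> N x \in unitmx ->
  is_derive x v (fun y => \det (N y)) (\det (N x) * \tr (invmx (N x) *m dN)).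
Proof.
move=> H Nu.
have D : is_derive x v (fun y => \det (invmx (N x) *m N y)) (\tr (invmx (N x) *m dN)).
  apply: is_derive_det1; last by rewrite mulVmx.
  move=> i j; rewrite [X in is_derive _ _ _ X]mxE (_ : (fun y => _) = (fun y => \sum_(k <- index_enum 'I_n) invmx (N x) i k * N y k j)).
    by apply: is_derive_bigsum => k; exact: is_deriveZ.
  by apply/funext => y; rewrite mxE.
rewrite (_ : (fun y => \det (N y)) = (fun y => \det (N x) * \det (invmx (N x) *m N y))).
  exact: is_deriveZ.
by apply/funext => y; rewrite det_mulmx mulrA -det_mulmx mulmxV// det1 mul1r.
Qed.

Lemma is_derive_translate {V W : normedModType R} (f : V -> W) (x v w : V) d :
  is_derive (x + w) v f d -> is_derive x v (fun y => f (y + w)) d.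
Proof.
move=> D; apply: is_derive_lineV.
rewrite (_ : (fun s => _) = (fun s : R => f ((x + w) + s *: v))); last first.
  by apply/funext => s; rewrite addrAC.
by apply: is_derive_line; rewrite scale0r addr0.
Qed.

(** The left side is symmetric in [i] and [j], whereas the mean value theorem, used along [e_i] and
    then along [e_j], gives one order of differentiation. *)
Lemma second_difference {n} (U : set 'rV[R]_n) f (x : 'rV[R]_n) i j (r h : R) :
  open U -> Ck 2 U f -> cball x r `<=` U -> 0 < h -> 2 * h <= r ->
  exists2 y, `|y - x| <= 2 * h &
    f (x + h *: 'e_i + h *: 'e_j) - f (x + h *: 'e_i)
      - f (x + h *: 'e_j) + f x = h * (h * partial j (partial i f) y).
Proof.
move=> oU Cf rU h0 hr.
have inU (s t : R) : 0 <= s <= 1 -> 0 <= t <= 1 ->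
    `|(x + s *: (h *: 'e_i : 'rV[R]_n)) + t *: (h *: 'e_j) - x| <= 2 * h.
  move=> s01 t01; rewrite -[x + _ + _]addrA [x + _]addrC addrK mulr2n mulrDl mul1r.
  have B (u : R) k : 0 <= u <= 1 -> `|u *: (h *: 'e_k : 'rV[R]_n)| <= h.
    move=> /andP[u0 u1]; rewrite !normrZ (ger0_norm u0) (gtr0_norm h0) mulrA.
    apply: (@le_trans _ _ (u * h)); last by rewrite ler_piMl// ltW.
    by rewrite ler_piMr ?norm_delta_mx_le// mulr_ge0// ltW.
  by apply: (le_trans (ler_normD _ _)); apply: lerD; exact: B.
have inU' y : `|y - x| <= 2 * h -> U y by move=> yx; apply: rU; exact: le_trans hr.
have z01 : 0 <= (0 : R) <= 1 by rewrite lexx ler01.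
have o01 : 0 <= (1 : R) <= 1 by rewrite lexx ler01.
pose g y := f (y + h *: 'e_j) - f y.
have gd (s : R) : 0 <= s <= 1 ->
    is_derive (x + s *: (h *: 'e_i : 'rV[R]_n)) (h *: 'e_i : 'rV[R]_n) g
     (h *: partial i f (x + s *: (h *: 'e_i) + h *: 'e_j)
       - h *: partial i f (x + s *: (h *: 'e_i))).
  move=> s01; apply: is_deriveB.
    apply: is_derive_translate; apply: is_derive_scale; apply: derivableP.
    have HU : U (x + s *: (h *: 'e_i) + h *: 'e_j).
      by apply: inU'; have := inU s 1 s01 o01; rewrite scale1r.
    exact: Ck_derivable Cf HU.
  apply: is_derive_scale; apply: derivableP.
  have HU : U (x + s *: (h *: 'e_i)).
    by apply: inU'; have := inU s 0 s01 z01; rewrite scale0r addr0.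
  exact: Ck_derivable Cf HU.
have [s s01|s s01 E] := @mvt_line R _ g x (h *: 'e_i).
  by have [] := gd s s01.
have [_ E'] := gd s s01; rewrite E' in E.
have pd (t : R) : 0 <= t <= 1 ->
    is_derive (x + s *: (h *: 'e_i : 'rV[R]_n) + t *: (h *: 'e_j)) (h *: 'e_j : 'rV[R]_n)
      (partial i f) (h *: partial j (partial i f) (x + s *: (h *: 'e_i) + t *: (h *: 'e_j))).
  move=> t01; apply: is_derive_scale; apply: derivableP.
  exact: Ck_derivable (Ck_partial i Cf) (inU' _ (inU s t s01 t01)).
have [t t01|t t01 Et] := @mvt_line R _ (partial i f) (x + s *: (h *: 'e_i)) (h *: 'e_j).
  by have [] := pd t t01.
exists (x + s *: (h *: 'e_i) + t *: (h *: 'e_j)); first exact: inU.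
have [_ Et'] := pd t t01; rewrite Et' in Et.
transitivity (g (x + h *: 'e_i) - g x); first by rewrite /g; ring.
by rewrite E -scalerBr Et.
Qed.

Lemma eq_at_of_nearby_eq {n} (a b : 'rV[R]_n -> R) (x : 'rV[R]_n) :
  {for x, continuous a} -> {for x, continuous b} ->
  (forall r, 0 < r -> exists y z, [/\ `|y - x| < r, `|z - x| < r & a y = b z]) ->
  a x = b x.
Proof.
move=> ca cb H; apply/eqP/negPn/negP => neq.
have e0 : 0 < `|a x - b x| / 2 by rewrite divr_gt0// normr_gt0 subr_eq0.
move/cvgrPdist_lt : ca => /(_ _ e0) HA; move/cvgrPdist_lt : cb => /(_ _ e0) HB.
have [r /= r0 Hr] := iffLR (nbhs_ballP _ _) (filterI HA HB).
have [y [z [yr zr E]]] := H r r0.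
have [|Ha _] := Hr y; first by rewrite -ball_normE/= distrC.
have [|_ Hb] := Hr z; first by rewrite -ball_normE/= distrC.
have : `|a x - b x| < `|a x - b x|.
  rewrite [ltRHS]splitr.
  rewrite {1}(_ : a x - b x = (a x - a y) - (b x - b z)); last by rewrite E; ring.
  by apply: (le_lt_trans (ler_normB _ _)); exact: ltrD.
by rewrite ltxx.
Qed.

(** Both orders of differentiation produce the same second difference, so they take equal values at
    points arbitrarily close to [x]; continuity concludes. *)
Lemma partialC {n} (U : set 'rV[R]_n) f (x : 'rV[R]_n) i j : open U -> Ck 2 U f -> U x ->
  partial i (partial j f) x = partial j (partial i f) x.
Proof.
move=> oU Cf Ux.
apply: (@eq_at_of_nearby_eq _ (partial i (partial j f)) (partial j (partial i f))).
- exact: (Ck_cont (Ck_partial i (Ck_partial j Cf))).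
- exact: (Ck_cont (Ck_partial j (Ck_partial i Cf))).
move=> r0 r00.
have HU : nbhs x U by apply: open_nbhs_nbhs; split.
have [r1 /= r10 Hr1] := iffLR (nbhs_ballP _ _) HU.
pose r := Num.min r0 r1.
have r_gt0 : 0 < r by rewrite lt_min r00.
have r30 : 0 < r / 3 by rewrite divr_gt0.
have r3r : 2 * (r / 3) < r by lra.
have rU : cball x (2 * (r / 3)) `<=` U.
  move=> y yx; apply: Hr1; rewrite -ball_normE/= distrC (le_lt_trans yx)//.
  by rewrite (lt_le_trans r3r)// ge_min lexx orbT.
have rr0 : 2 * (r / 3) < r0 by rewrite (lt_le_trans r3r)// ge_min lexx.
have [y yx Ey] := second_difference i j oU Cf rU r30 (lexx _).
have [z zx Ez] := second_difference j i oU Cf rU r30 (lexx _).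
exists z, y; split; [exact: le_lt_trans rr0|exact: le_lt_trans rr0|].
have r3n : r / 3 != 0 by rewrite gt_eqF.
have cancel (a b : R) : r / 3 * (r / 3 * a) = b -> a = (r / 3)^-1 * ((r / 3)^-1 * b).
  by move=> <-; rewrite !mulKf.
apply: (etrans (cancel _ _ (esym Ez))); symmetry; apply: (etrans (cancel _ _ (esym Ey))).
congr (_ * (_ * _)).
by rewrite [x + _ + _]addrAC; ring.
Qed.

End VectorCalculus.

(** * Smooth bump functions built from exp(-1/t) *)

Section Bump.
Context {R : realType}.

(** With the negative powers of [t] the family is stable under differentiation up to linear
    combinations, so all its members are shown smooth by one induction. *)
Definition ebump (m : nat) (t : R) : R := if 0 < t then t^-1 ^+ m * expR (- t^-1) else 0.

(** For [k = m + 2], raising [expR (y / k) >= y / k] to the power [k] beats [y ^+ m] by two powers.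
    This gives derivative 0 at the origin. *)
Lemma ebump_bound m (h : R) : `|ebump m h| <= m.+2%:R ^+ m.+2 * h ^+ 2.
Proof.
rewrite /ebump; case: ifPn => h0; last first.
  by rewrite normr0; apply: mulr_ge0; [exact: exprn_ge0|exact: sqr_ge0].
have y0 : 0 < h^-1 by rewrite invr_gt0.
rewrite ger0_norm ?mulr_ge0 ?exprn_ge0 ?expR_ge0 ?(ltW y0)//.
set k := m.+2.
have k0 : 0 < k%:R :> R by rewrite ltr0n.
have E : expR (h^-1) >= (h^-1 / k%:R) ^+ k.
  have -> : h^-1 = k%:R * (h^-1 / k%:R) by rewrite mulrCA divff ?mulr1// gt_eqF.
  rewrite expRM_natl mulrAC divff ?mul1r ?gt_eqF//.
  rewrite ler_pXn2r ?nnegrE ?expR_ge0 ?divr_ge0 ?(ltW y0)//.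
  by apply: le_trans (expR_ge1Dx _); rewrite lerDr.
rewrite expRN -ler_pdivlMr ?invr_gt0 ?expR_gt0// invrK.
apply: (@le_trans _ _ (k%:R ^+ k * h ^+ 2 * (h^-1 / k%:R) ^+ k)); last first.
  by rewrite ler_wpM2l//; apply: mulr_ge0; [exact: exprn_ge0|exact: sqr_ge0].
rewrite exprMn [(k%:R^-1) ^+ _]exprVn.
have K0 : k%:R ^+ k != 0 :> R by rewrite expf_neq0// gt_eqF.
have -> : h^-1 ^+ k = h^-1 ^+ m * h^-1 ^+ 2 by rewrite -exprD addn2.
have hh : h^-1 ^+ 2 * h ^+ 2 = 1 by rewrite -exprMn mulVf ?gt_eqF// expr1n.
move: (k%:R ^+ k) K0 (h^-1 ^+ m) => A A0 B.
rewrite (_ : A * h ^+ 2 * (B * h^-1 ^+ 2 / A) = B * (h^-1 ^+ 2 * h ^+ 2) * (A / A)).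
  by rewrite hh divff// !mulr1.
by move: (A^-1) (h^-1 ^+ 2) => A' B'; ring.
Qed.

Lemma is_derive_ebump m (t : R) :
  is_derive t 1 (ebump m) (ebump m.+2 t - m%:R * ebump m.+1 t).
Proof.
have [t0|t0|t0] := ltgtP 0 t; last first.
- rewrite -t0 /ebump ltxx mulr0 subr0 -/(ebump _).
  apply: (@is_derive_quadratic _ _ _ _ _ _ (m.+2%:R ^+ m.+2)); near=> h.
  rewrite mulr0 subr0 add0r [h *: 1]mulr1 [ebump m 0](_ : _ = 0) ?subr0; last by rewrite /ebump ltxx.
  exact: ebump_bound.
- rewrite /ebump !(ltNge 0 t) (ltW t0)/= mulr0 subr0 -/(ebump _).
  apply: (@near_eq_is_derive _ _ _ (cst 0)).
  near=> s; rewrite /ebump /= ifN// -leNgt ltW//; near: s; exact: lt_nbhsl.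
- have tn : t != 0 by rewrite gt_eqF.
  apply: (@near_eq_is_derive _ _ _ (fun s : R => (fun y => y ^+ m * expR (- y)) s^-1)).
    near=> s; rewrite /ebump ifT//; near: s; exact: lt_nbhsr.
  have D1 : is_derive t (1 : R) (fun s : R => s^-1) (- (t^-1) ^+ 2).
    have Did : derivable (id : R -> R) t 1 by exact: derivable_id.
    split; first exact: (derivableV tn Did).
    by rewrite (deriveV tn Did) derive_id [LHS]mulr1 exprVn.
  have D2 : is_derive (t^-1) (1 : R) (fun y : R => y ^+ m * expR (- y))
     (m%:R * t^-1 ^+ m.-1 * expR (- t^-1) - t^-1 ^+ m * expR (- t^-1)).
    have Dn : is_derive (t^-1) (1 : R) (fun y : R => expR (- y)) (- expR (- t^-1)).
      rewrite -mulN1r; apply: (@is_derive_comp1 _ _ expR -%R).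
    have Dx : is_derive (t^-1) (1 : R) (fun y : R => y ^+ m) (m%:R * t^-1 ^+ m.-1).
      by split; [exact: exprn_derivable|rewrite exp_derive [LHS]mulr1].
    have := is_deriveM Dx Dn; rewrite (_ : _ *: _ + _ *: _ = m%:R * t^-1 ^+ m.-1 * expR (- t^-1) - t^-1 ^+ m * expR (- t^-1))//.
    by rewrite /GRing.scale/=; ring.
  have := is_derive_comp1 D2 D1.
  rewrite (_ : _ *: _ = ebump m.+2 t - m%:R * ebump m.+1 t)//.
  rewrite /ebump t0 /GRing.scale/=; case: m {D2} => [|m]; first by rewrite expr0 !mul0r; ring.
  by rewrite /= !exprS; ring.
Unshelve. all: by end_near. Qed.

Lemma Ck_ebump {n} k m (U : set 'rV[R]_n) q : open U -> (forall l, Ck l U q) ->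
  Ck k U (fun x => ebump m (q x)).
Proof.
move=> oU Cq.
have ce m' : continuous (ebump m').
  move=> t; have [/derivable1_diffP/differentiable_continuous] := is_derive_ebump m' t.
  exact.
elim: k m => [|k IH] m.
  split=> // x Ux; apply: (@continuous_comp _ _ _ q (ebump m)); last exact: ce.
  exact: (Ck_cont (Cq 0%N)).
have D i x : U x -> is_derive x ('e_i) (fun x => ebump m (q x))
    (partial i q x * (ebump m.+2 (q x) - m%:R * ebump m.+1 (q x))).
  move=> Ux; apply: is_derive_lineV.
  apply: (@is_derive_comp1 _ _ (ebump m) (fun s => q (x + s *: 'e_i))).
    by rewrite scale0r addr0; exact: is_derive_ebump.
  apply: is_derive_line; rewrite scale0r addr0; apply: derivableP.
  exact: (@Ck_derivable _ _ 0 U q i x (Cq 1%N) Ux).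
split; last split.
- move=> x Ux; apply: (@continuous_comp _ _ _ q (ebump m)); last exact: ce.
  exact: (Ck_cont (Cq 0%N)).
- by move=> i x Ux; have [] := D i x Ux.
- move=> i.
  apply: (@Ck_eq _ _ _ _ (fun x => partial i q x * (ebump m.+2 (q x) - m%:R * ebump m.+1 (q x)))) => //.
    by move=> x Ux; rewrite /partial; have [_ ->] := D i x Ux.
  apply: CkM => //; first exact: (Ck_partial i (Cq k.+1)).
  apply: CkB => //; apply: CkM => //; exact: Ck_cst.
Qed.

(** The Euclidean square distance, which is smooth while the maximum norm is not. *)
Definition sqdist {n} (a x : 'rV[R]_n) : R := \sum_i (x 0 i - a 0 i) ^+ 2.

Definition bump {n} (a : 'rV[R]_n) (r : R) (x : 'rV[R]_n) : R := ebump 0 (r ^+ 2 - sqdist a x).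

Lemma Ck_bump {n} k (a : 'rV[R]_n) r : Ck k setT (bump a r).
Proof.
apply: Ck_ebump => [|l]; first exact: openT.
apply: CkB; [exact: openT|exact: Ck_cst|].
apply: Ck_sum => [|i _]; first exact: openT.
by apply: CkM; try exact: openT; apply: CkB; try exact: openT; try exact: Ck_cst; exact: Ck_coord.
Qed.

Lemma bump_center {n} (a : 'rV[R]_n) r : 0 < r -> 0 < bump a r a.
Proof.
move=> r0; rewrite /bump /sqdist big1 => [|i _]; last by rewrite subrr expr0n.
by rewrite subr0 /ebump exprn_gt0// expr0 mul1r expR_gt0.
Qed.

Lemma bump_support {n} (a : 'rV[R]_n) r x : 0 < r -> bump a r x != 0 -> `|x - a| < r.
Proof.
move=> r0; rewrite /bump /ebump; case: ifP => [|_]; last by rewrite eqxx.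
rewrite subr_gt0 => sr _; apply: norm_lt_coord => // i j; rewrite ord1 !mxE.
rewrite -(@ltr_pXn2r _ 2%N)// ?nnegrE// ?(ltW r0)//.
rewrite real_normK ?num_real//; apply: le_lt_trans sr.
by rewrite /sqdist (bigD1 j)//= lerDl sumr_ge0// => l _; exact: sqr_ge0.
Qed.

End Bump.

(** * Integral curves on a manifold *)

(** The supremum of the points reached from [a] can be crossed by the local hypothesis around it, so
    it is [b]. This real induction carries all passages from short to long times along curves. *)
Lemma interval_chain {R : realType} (P : R -> R -> Prop) (a b : R) : a <= b ->
  (forall x, a <= x <= b -> exists2 d, 0 < d &
     forall s t, a <= s -> s <= t -> t <= b -> `|s - x| < d -> `|t - x| < d -> P s t) ->
  (forall s t u, a <= s -> s <= t -> t <= u -> u <= b -> P s t -> P t u -> P s u) -> P a b.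
Proof.
move=> ab loc tr.
pose A := [set t | a <= t <= b /\ P a t].
have Aa : A a.
  split; first by rewrite lexx.
  by have [|d d0] := loc a; [rewrite lexx|apply; rewrite ?subrr ?normr0].
have hsA : has_sup A.
  by split; [exists a|exists b => t [/andP[]]].
set c := sup A.
have ac : a <= c by exact: (ub_le_sup hsA.2).
have cb : c <= b.
  by apply: (ge_sup _) => [|t [/andP[]]//]; exists a.
have [|d d0 Hd] := loc c; first by rewrite ac cb.
have [t [/andP[at_ tb] Pt] ct] := sup_adherent d0 hsA.
have tc : t <= c by apply: (ub_le_sup hsA.2); split=> //; rewrite at_ tb.
have tcd : `|t - c| < d by rewrite ler0_norm ?subr_le0// opprB ltrBlDl addrC -ltrBlDl.
pose u := Num.min b (c + d / 2).
have cu : c <= u by rewrite le_min cb lerDl divr_ge0// ltW.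
have ub : u <= b by rewrite ge_min lexx.
have ucd : `|u - c| < d.
  rewrite ger0_norm ?subr_ge0// ltrBlDl (@le_lt_trans _ _ (c + d / 2))//.
    by rewrite ge_min lexx orbT.
  by rewrite ltrD2l ltr_pdivrMr// ltr_pMr// ltr1n.
have tu := le_trans tc cu.
have Pu : P a u by apply: (tr a t u) => //; apply: Hd.
have uc : u <= c.
  by apply: (ub_le_sup hsA.2); split=> //; rewrite ub (le_trans at_ tu).
have : u = b.
  have [bc|cb'] := leP b (c + d / 2); first by rewrite /u min_l.
  by move: uc; rewrite /u min_r ?(ltW cb')//; move: d0; lra.
by move=> <-.
Qed.

(** * Transition maps and their Jacobians *)

Section Transitions.
Context {R : realType} {n : nat} {M : ptopologicalType} (S : smooth_structure R n M).
Implicit Types (c d e : chart R n M) (p : M) (x : 'rV[R]_n).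

Lemma nbhs_chart_img c x : chart_img c x -> nbhs x (chart_img c).
Proof. by move=> xc; apply: open_nbhs_nbhs; split => //; exact: chart_img_open. Qed.

Lemma nbhs_chart_dom c p : chart_dom c p -> nbhs p (chart_dom c).
Proof. by move=> pc; apply: open_nbhs_nbhs; split => //; exact: chart_dom_open. Qed.

Lemma chart_map_cvg c p : chart_dom c p -> {for p, continuous c}.
Proof. by move=> pc; apply: chart_map_continuous; rewrite inE. Qed.

Lemma chart_inv_cvg c x : chart_img c x -> {for x, continuous (chart_inv c)}.
Proof. by move=> xc; apply: chart_inv_continuous; rewrite inE. Qed.

Lemma nbhs_chart_inv c x (A : set M) : chart_img c x -> nbhs (chart_inv c x) A ->
  nbhs x (chart_inv c @^-1` A).
Proof. by move=> xc; exact: chart_inv_cvg. Qed.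

Lemma overlap_open c d : open (overlap c d).
Proof.
rewrite openE => x [xc xd]; apply: filterI; first exact: nbhs_chart_img.
by apply: nbhs_chart_inv => //; exact: nbhs_chart_dom.
Qed.

Lemma overlap_chart c d p : chart_dom c p -> chart_dom d p ->
  overlap c d (c p) /\ transition c d (c p) = d p.
Proof.
move=> pc pd; rewrite /overlap /transition/= chart_mapK//; split=> //; split=> //=.
  exact: chart_map_img.
Qed.

Lemma transitionK c d x : overlap c d x ->
  overlap d c (transition c d x) /\ transition d c (transition c d x) = x.
Proof.
move=> [xc xd]; have xc' := chart_inv_dom xc.
have [] := overlap_chart xd xc'.
by rewrite [c _]chart_invK// /transition/=.
Qed.

Lemma transition_smooth c d : atlas S c -> atlas S d ->
  smooth_rV_on (overlap c d) (transition c d).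
Proof. by move=> Sc Sd; have [] := atlas_compatible Sc Sd. Qed.

Lemma transition_diff c d x : atlas S c -> atlas S d -> overlap c d x ->
  differentiable (transition c d) x.
Proof.
move=> Sc Sd xo; apply: differentiable_row => j.
apply: (@Ck_differentiable _ _ 0 (overlap c d)) => //; first exact: overlap_open.
exact: smooth_rV_Ck (transition_smooth Sc Sd).
Qed.

Lemma near_overlap c d x : overlap c d x -> \forall y \near x, overlap c d y.
Proof. by move=> xo; apply: open_nbhs_nbhs; split => //; exact: overlap_open. Qed.

Lemma jacobian_self c x : chart_img c x -> 'J (transition c c) x = 1%:M.
Proof.
move=> xc; have nE : \near x, transition c c x = id x.
  by apply: filterS (nbhs_chart_img xc) => y yc; rewrite /transition/= chart_invK.
have D : differentiable (transition c c) x.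
  apply: differentiable_row => j.
  apply/(@Ck_differentiable _ _ 0 (chart_img c)) => //; first exact: chart_img_open.
  apply: (@Ck_eq _ _ _ _ (fun y : 'rV_n => y 0 j)); [exact: chart_img_open| |exact: Ck_coord].
  by move=> y yc; rewrite /transition/= chart_invK.
apply/row_matrixP => i; rewrite [in LHS]rowE row1 -deriveEjacobian//.
by rewrite (near_eq_derive _ nE) derive_id.
Qed.

Lemma jacobian_transition c d e x : atlas S c -> atlas S d -> atlas S e ->
  overlap c d x -> overlap c e x ->
  'J (transition c e) x = 'J (transition c d) x *m 'J (transition d e) (transition c d x).
Proof.
move=> Sc Sd Se xd xe.
have yde : overlap d e (transition c d x).
  case: xd xe => xc xd [_ xe]; have [] := overlap_chart xd xe.
  by [].
apply: jacobian_comp; try exact: transition_diff.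
apply: filterS (filterI (near_overlap xd) (near_overlap xe)) => y [[yc yd] [_ ye]].
by rewrite /transition/= chart_mapK.
Qed.

End Transitions.

Section IntegralCurves.
Context {R : realType} {n : nat} {M : ptopologicalType} {S : smooth_structure R n M}.
Variable X : vector_field S.
Implicit Types (c d e : chart R n M) (p : M) (x : 'rV[R]_n) (gamma : R -> M).

(** Stated at a single time. Continuity is a separate clause because a chart has arbitrary values
    outside its domain, so a derivative in coordinates does not by itself keep the curve inside. *)
Definition icurve_at gamma (t : R) : Prop :=
  {for t, continuous gamma} /\
  forall c, atlas S c -> chart_dom c (gamma t) ->
    is_derive t (1 : R) (fun s => c (gamma s)) (X c (c (gamma t))).

(** One chart suffices, by the transformation law of the field; continuity makes the identity
    between the two coordinate curves hold near [t]. *)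
Lemma icurve_at_chart gamma t c : {for t, continuous gamma} -> atlas S c ->
  chart_dom c (gamma t) -> is_derive t (1 : R) (fun s => c (gamma s)) (X c (c (gamma t))) ->
  icurve_at gamma t.
Proof.
move=> cg Sc gc dg; split=> // d Sd gd.
have [xo tE] := overlap_chart gc gd.
have := is_derive_jacobian (transition_diff Sc Sd xo) dg.
rewrite -(vf_change X Sc Sd xo) tE; apply: near_eq_is_derive.
have N : nbhs t (gamma @^-1` (chart_dom c `&` chart_dom d)).
  exact: (cg _ (filterI (nbhs_chart_dom gc) (nbhs_chart_dom gd))).
apply: filterS N => s [sc sd].
by have [] := overlap_chart sc sd.
Qed.

Lemma icurve_at_inv c (u : R -> 'rV[R]_n) t : atlas S c -> chart_img c (u t) ->
  is_derive t (1 : R) u (X c (u t)) -> icurve_at (fun s => chart_inv c (u s)) t.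
Proof.
move=> Sc uc du.
have cu : {for t, continuous u}.
  by apply/differentiable_continuous/derivable1_diffP; case: du.
apply: (icurve_at_chart _ Sc); first last.
- rewrite chart_invK//; apply: near_eq_is_derive du.
  have N : nbhs t (u @^-1` chart_img c) by exact: (cu _ (nbhs_chart_img uc)).
  apply: filterS N => s sc.
  by rewrite chart_invK.
- exact: chart_inv_dom.
- by apply: (@continuous_comp _ _ _ u (chart_inv c)) => //; exact: chart_inv_cvg.
Qed.

Lemma icurve_at_eq gamma gamma' t : (\near t, gamma t = gamma' t) ->
  icurve_at gamma t -> icurve_at gamma' t.
Proof.
move=> E [cg H]; have Et := nbhs_singleton E; split.
  rewrite /prop_for /continuous_at -Et => A /cg; apply: filterS2 E => s /= -> //.
move=> c Sc; rewrite -Et => gc; apply: near_eq_is_derive (H c Sc gc).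
by apply: filterS E => s ->.
Qed.

Lemma icurve_at_shift gamma t s : icurve_at gamma (t + s) ->
  icurve_at (fun r => gamma (r + s)) t.
Proof.
move=> [cg H]; split.
  apply: (@continuous_comp _ _ _ (fun r => r + s) gamma) => //.
  by apply: continuousD; [exact: cvg_id|exact: cst_continuous].
by move=> c Sc gc; apply: (@is_derive_translate _ _ _ (fun r => c (gamma r))); exact: H.
Qed.

Lemma icurve_local_unique gamma1 gamma2 t :
  (\forall s \near t, icurve_at gamma1 s) -> (\forall s \near t, icurve_at gamma2 s) ->
  gamma1 t = gamma2 t -> \forall s \near t, gamma1 s = gamma2 s.
Proof.
move=> H1 H2 E.
pose c := chart_at S (gamma1 t).
have Sc : atlas S c := chart_at_atlas S _.
have gc : chart_dom c (gamma1 t) := chart_at_dom S _.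
have x0c : chart_img c (c (gamma1 t)) := chart_map_img gc.
have [r [K [L [C [[r0 K0 L0 C0 rU] [FK FL _ _]]]]]] :=
  flow_bounds (@chart_img_open _ _ _ c) (vf_smooth X Sc) x0c.
have [e e0 [_ eL]] := flow_time K0 L0 r0.
have near_in gamma : icurve_at gamma t -> gamma t = gamma1 t ->
    \forall s \near t, chart_dom c (gamma s) /\ cball (c (gamma1 t)) r (c (gamma s)).
  move=> [cg _] Eg; rewrite /prop_for /continuous_at Eg in cg.
  have cc := chart_map_cvg gc.
  have B : nbhs (c (gamma1 t)) (cball (c (gamma1 t)) r).
    apply/nbhs_ballP; exists r => //= y; rewrite -ball_normE/= /cball/= distrC; exact: ltW.
  exact: (cg _ (filterI (nbhs_chart_dom gc) (cc _ B))).
have N1 := near_in _ (nbhs_singleton H1) erefl.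
have N2 := near_in _ (nbhs_singleton H2) (esym E).
have [d /= d0 Hd] := iffLR (nbhs_ballP _ _) (filterI (filterI H1 H2) (filterI N1 N2)).
pose e' := Num.min e d.
have e'0 : 0 < e' by rewrite lt_min e0.
have e'L : e' * L <= 2^-1 by apply: le_trans eL; rewrite ler_wpM2r// ge_min lexx.
apply/nbhs_ballP; exists e' => //= s; rewrite -ball_normE/= distrC => st.
have {}Hd (u : R) : `|u| < e' -> [/\ icurve_at gamma1 (u + t), icurve_at gamma2 (u + t),
    chart_dom c (gamma1 (u + t)) /\ cball (c (gamma1 t)) r (c (gamma1 (u + t))) &
    chart_dom c (gamma2 (u + t)) /\ cball (c (gamma1 t)) r (c (gamma2 (u + t)))].
  move=> ue; have [|[h1 h2] [h3 h4]] := Hd (u + t); last by split.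
  rewrite -ball_normE/= opprD addrCA subrr addr0 normrN (lt_le_trans ue)//.
  by rewrite ge_min lexx orbT.
have := @integral_curves_dist R n (X c) (c (gamma1 t)) r L e' (fun u => c (gamma1 (u + t)))
  (fun u => c (gamma2 (u + t))) L0 e'L FL _ _ (s - t) st.
rewrite add0r -E subrr normr0 mulr0 subrK normr_le0 subr_eq0.
have [_ _ [d1 _] [d2 _]] := Hd _ st; rewrite subrK in d1 d2.
move=> /(_ _ _)/eqP H; rewrite -(chart_mapK d1) -(chart_mapK d2); congr (chart_inv c _).
symmetry; apply: H => u ue.
  have [i1 _ [dm cb] _] := Hd u ue; split=> //.
  by have [_ /(_ c Sc dm)] := icurve_at_shift i1.
have [_ i2 _ [dm cb]] := Hd u ue; split=> //.
by have [_ /(_ c Sc dm)] := icurve_at_shift i2.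
Qed.

(** Agreement of the two curves is locally constant in time: near a time of agreement by local
    uniqueness, near a time of disagreement by the Hausdorff property. *)
Lemma icurve_unique gamma1 gamma2 a b t0 : a < t0 < b ->
  (forall t, a < t < b -> icurve_at gamma1 t /\ icurve_at gamma2 t) ->
  gamma1 t0 = gamma2 t0 -> forall t, a < t < b -> gamma1 t = gamma2 t.
Proof.
move=> t0ab H E0.
pose P s t := gamma1 s = gamma2 s <-> gamma1 t = gamma2 t.
have loc (x : R) : a < x < b -> exists2 d, 0 < d &
    forall s t : R, `|s - x| < d -> `|t - x| < d -> P s t.
  move=> /andP[ax xb].
  have nH : \forall s \near x, icurve_at gamma1 s /\ icurve_at gamma2 s.
    apply: filterS (filterI (lt_nbhsr ax) (lt_nbhsl xb)) => s [as_ sb]; apply: H.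
    by apply/andP; split.
  have [E|nE] := pselect (gamma1 x = gamma2 x).
    have [] := @nbhs_ballP _ _ x [set s | gamma1 s = gamma2 s] => + _.
    case.
      apply: icurve_local_unique => //; first by apply: filterS nH => s [].
      by apply: filterS nH => s [].
    move=> d /= d0 Hd; exists d => // s t sx tx.
    have B (u : R) : `|u - x| < d -> gamma1 u = gamma2 u.
      by move=> ux; apply: Hd; rewrite -ball_normE/= distrC.
    by split=> _; exact: B.
  have [A B] := nbhs_singleton nH.
  have := manifold_hausdorff S; rewrite open_hausdorff => hM.
  have [[U1 U2] /= [U1x U2x] [oU1 oU2 /eqP U12]] := hM _ _ (introN eqP nE).
  rewrite !inE in U1x U2x.
  have N1 : nbhs x (gamma1 @^-1` U1) by case: A => + _; apply; apply: open_nbhs_nbhs; split.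
  have N2 : nbhs x (gamma2 @^-1` U2) by case: B => + _; apply; apply: open_nbhs_nbhs; split.
  have [d /= d0 Hd] := iffLR (nbhs_ballP _ _) (filterI N1 N2).
  exists d => // s t sx tx.
  have ne (u : R) : `|u - x| < d -> gamma1 u <> gamma2 u.
    move=> ux Eu; have [|/= u1 u2] := Hd u; first by rewrite -ball_normE/= distrC.
    suff : (U1 `&` U2) (gamma1 u) by rewrite U12.
    by split=> //; rewrite Eu.
  by split=> Es; [case: (ne s sx)|case: (ne t tx)].
have chain (s t : R) : a < s -> s <= t -> t < b -> P s t.
  move=> as_ st tb; apply: interval_chain => //.
    move=> x /andP[sx xt]; have [|d d0 Hd] := loc x; last by exists d => //; auto.
    by rewrite (lt_le_trans as_ sx) (le_lt_trans xt tb).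
  by move=> u v w _ _ _ _; rewrite /P => -> ->.
move=> t /andP[at_ tb]; case/andP: t0ab => at0 t0b.
have [tt0|t0t] := leP t t0; first by apply/(chain t t0).
by apply/(chain t0 t) => //; exact: ltW.
Qed.

End IntegralCurves.

(** * Cut-off functions *)

Section Cutoff.
Context {R : realType} {n : nat} {M : ptopologicalType} {S : smooth_structure R n M}.
Variables (c : chart R n M) (x0 : 'rV[R]_n) (r : R).
Hypotheses (Sc : atlas S c) (r0 : 0 < r) (rc : cball x0 r `<=` chart_img c).
Implicit Types (d e : chart R n M) (p : M) (x y : 'rV[R]_n).

Lemma chart_cball_closed : closed (chart_inv c @` cball x0 r).
Proof.
apply: compact_closed; first exact: manifold_hausdorff S.
apply: continuous_compact; last exact: cball_compact (ltW r0).
apply: continuous_in_subspaceT => y; rewrite inE => /rc yc.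
exact: chart_inv_cvg.
Qed.

(** The compact ball is closed in the Hausdorff space [M]. Outside the overlap with [c], a point has
    a neighbourhood in the complement of this ball, where [F] vanishes. *)
Lemma Ck_extend_zero k d (F : 'rV[R]_n -> R) : Ck k (overlap d c) F ->
  (forall y, chart_img d y -> F y != 0 ->
     chart_dom c (chart_inv d y) /\ cball x0 r (c (chart_inv d y))) ->
  Ck k (chart_img d) F.
Proof.
move=> CF Fs; apply: Ck_local => y yd.
have [yc|yc] := pselect (chart_dom c (chart_inv d y)); first by exists (overlap d c).
have oK : open (~` (chart_inv c @` cball x0 r)) by rewrite openC; exact: chart_cball_closed.
pose W := chart_img d `&` chart_inv d @^-1` (~` (chart_inv c @` cball x0 r)).
exists W.
  split=> //= -[z /rc zc zE]; apply: yc; rewrite -zE; exact: chart_inv_dom.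
have oW : open W.
  rewrite openE => z [zd zK]; apply: filterI; first exact: nbhs_chart_img.
  by apply: nbhs_chart_inv => //; apply: open_nbhs_nbhs; split.
apply: (Ck_eq oW _ (Ck_cst k W 0)) => z [zd zK]; apply/eqP/negPn/negP => Fz.
have [|zc zb] := Fs z zd; first by rewrite eq_sym.
by apply: zK; exists (c (chart_inv d z)) => //; rewrite chart_mapK.
Qed.

Definition cutoff p : R := if `[< chart_dom c p >] then bump x0 r (c p) else 0.

Lemma cutoff_support p : cutoff p != 0 -> chart_dom c p /\ `|c p - x0| < r.
Proof.
rewrite /cutoff; case: ifPn => [/asboolP pc|_]; last by rewrite eqxx.
by move=> /(bump_support r0).
Qed.

Lemma cutoff_overlap d y : overlap d c y -> cutoff (chart_inv d y) = bump x0 r (transition d c y).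
Proof. by move=> [yd yc]; rewrite /cutoff; case: asboolP. Qed.

Lemma cutoff_smooth : @smooth_function R n M S cutoff.
Proof.
move=> d Sd; apply/smooth_CkP => k; apply: Ck_extend_zero; last first.
  by move=> y yd /cutoff_support[yc yb]; split=> //; exact: ltW.
apply: (@Ck_eq _ _ _ _ (fun y => bump x0 r (transition d c y))).
- exact: overlap_open.
- by move=> y yo; rewrite /= cutoff_overlap.
apply: (@Ck_comp _ _ _ _ _ setT) => //; [exact: overlap_open|exact: openT| |exact: Ck_bump].
by move=> j; exact: smooth_rV_Ck (transition_smooth Sd Sc).
Qed.

(** The constant field [v] of the chart [c], cut off and carried to the other charts by the
    transformation law. It is a global field with prescribed direction at a point, as needed to test
    [closed_conformal]. *)
Definition bump_coord (v : 'rV[R]_n) (d : chart R n M) (y : 'rV[R]_n) : 'rV[R]_n :=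
  if `[< chart_dom c (chart_inv d y) >]
  then bump x0 r (transition d c y) *: (v *m 'J (transition c d) (transition d c y)) else 0.

Lemma bump_coord_smooth v d : atlas S d -> smooth_rV_on (chart_img d) (bump_coord v d).
Proof.
move=> Sd j; apply/smooth_CkP => k; apply: Ck_extend_zero; last first.
  move=> y yd; rewrite /bump_coord; case: ifPn => [/asboolP yc|_]; last by rewrite mxE eqxx.
  move=> H; split=> //; apply/ltW/(bump_support r0); apply: contra_neq H => b0.
  by rewrite /transition/= b0 scale0r mxE.
have oo : open (overlap d c) by exact: overlap_open.
apply: (@Ck_eq _ _ _ _ (fun y => bump x0 r (transition d c y) *
   \sum_l v 0 l * partial l (fun z => transition c d z 0 j) (transition d c y))) => //.
  move=> y yo; have [zo _] := transitionK yo; rewrite /bump_coord; case: asboolP; last by case: yo.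
  move=> _; rewrite !mxE; congr (_ * _); apply: eq_bigr => l _.
  by rewrite jacobianE//; exact: transition_diff Sc Sd zo.
apply: CkM => //.
  apply: (@Ck_comp _ _ _ _ _ setT) => //; [exact: openT| |exact: Ck_bump].
  by move=> l; exact: smooth_rV_Ck (transition_smooth Sd Sc).
apply: Ck_sum => // l _; apply: CkM => //; first exact: Ck_cst.
apply: (@Ck_comp _ _ _ _ _ (overlap c d) (partial l (fun z => transition c d z 0 j))) => //.
- exact: overlap_open.
- by move=> y yo; have [] := transitionK yo.
- by move=> m; exact: smooth_rV_Ck (transition_smooth Sd Sc).
- exact/Ck_partial/(smooth_rV_Ck _ _ (transition_smooth Sc Sd)).
Qed.

Lemma bump_coord_change v d e : atlas S d -> atlas S e -> forall y, overlap d e y ->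
  bump_coord v e (transition d e y) = bump_coord v d y *m 'J (transition d e) y.
Proof.
move=> Sd Se y yo; have [yd ye] := yo.
have E : chart_inv e (transition d e y) = chart_inv d y by rewrite /transition/= chart_mapK.
rewrite /bump_coord /transition/= chart_mapK//; case: asboolP => yc; last by rewrite mul0mx.
have ydc : overlap d c y by [].
have [zo zE] := transitionK ydc.
have zoe : overlap c e (transition d c y).
  by have [] := overlap_chart yc ye.
rewrite -scalemxAl -mulmxA; congr (_ *: (_ *m _)).
by rewrite (jacobian_transition Sc Sd Se zo zoe) zE.
Qed.

Definition bump_field v : vector_field S :=
  VectorField (fun d Sd => @bump_coord_smooth v d Sd) (@bump_coord_change v).

Lemma bump_fieldE v x : chart_img c x -> bump_field v c x = bump x0 r x *: v.
Proof.
move=> xc; rewrite /= /bump_coord; case: asboolP => [_|[]]; last exact: chart_inv_dom.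
by rewrite /transition/= chart_invK// jacobian_self// mulmx1.
Qed.

End Cutoff.

(** * Algebra of positive definite forms *)

Section MetricAlgebra.
Context {R : realType} {n : nat}.
Implicit Types (G : 'M[R]_n) (u v w : 'rV[R]_n).

Lemma bilinE G u v : bilin G u v = \sum_i \sum_j u 0 i * G i j * v 0 j.
Proof.
rewrite /bilin mxE exchange_big/=; apply: eq_bigr => j _.
by rewrite !mxE mulr_suml.
Qed.

Lemma bilinDl G u v w : bilin G (u + v) w = bilin G u w + bilin G v w.
Proof. by rewrite /bilin !mulmxDl mxE. Qed.

Lemma bilinDr G u v w : bilin G w (u + v) = bilin G w u + bilin G w v.
Proof. by rewrite /bilin raddfD/= mulmxDr mxE. Qed.

Lemma bilinZl G a u w : bilin G (a *: u) w = a * bilin G u w.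
Proof. by rewrite /bilin -!scalemxAl mxE. Qed.

Lemma bilinZr G a u w : bilin G w (a *: u) = a * bilin G w u.
Proof. by rewrite /bilin linearZ/= -scalemxAr mxE. Qed.

Lemma bilinC G u v : G^T = G -> bilin G u v = bilin G v u.
Proof.
move=> GT; rewrite !bilinE exchange_big/=; apply: eq_bigr => i _; apply: eq_bigr => j _.
by rewrite -[in LHS]GT mxE; ring.
Qed.

Variable G : 'M[R]_n.
Hypotheses (GT : G^T = G) (Gpos : forall v, v != 0 -> 0 < bilin G v v).

Lemma bilin_ge0 v : 0 <= bilin G v v.
Proof.
have [->|/Gpos/ltW//] := eqVneq v 0.
by rewrite /bilin !mul0mx mxE.
Qed.

Lemma posdef_unit : G \in unitmx.
Proof.
rewrite unitmxE unitfE; apply/det0P => -[v /Gpos + vG].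
by rewrite /bilin vG mul0mx mxE ltxx.
Qed.

Lemma bilin_cauchy_schwarz u v : bilin G u v ^+ 2 <= bilin G u u * bilin G v v.
Proof.
have [->|v0] := eqVneq v 0.
  by rewrite /bilin trmx0 !mulmx0 !mxE expr0n/= mulr0.
have b0 := Gpos v0.
have := bilin_ge0 (u + (- (bilin G u v / bilin G v v)) *: v).
rewrite !(bilinDl, bilinDr, bilinZl, bilinZr) (bilinC v u GT).
rewrite [X in 0 <= X](_ : _ = bilin G u u - bilin G u v ^+ 2 / bilin G v v); last first.
  by field; rewrite gt_eqF.
by rewrite subr_ge0 ler_pdivrMr.
Qed.

(** Cauchy-Schwarz against row [i] of the inverse matrix, the vector that represents the [i]-th
    coordinate for the form [G]. *)
Lemma coord_sqr_le v i : v 0 i ^+ 2 <= invmx G i i * bilin G v v.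
Proof.
pose w := row i (invmx G).
have wG : w *m G = 'e_i by rewrite /w -row_mul mulVmx ?posdef_unit// row1.
have E1 : bilin G w v = v 0 i by rewrite /bilin wG -rowE !mxE.
have E2 : bilin G w w = invmx G i i by rewrite /bilin wG -rowE !mxE.
by rewrite -E1 -E2 bilin_cauchy_schwarz.
Qed.

End MetricAlgebra.

Section SmoothMatrices.
Context {R : realType} {n m : nat}.

Lemma Ck_det k (U : set 'rV[R]_n) (A : 'rV[R]_n -> 'M[R]_m) : open U ->
  (forall i j, Ck k U (fun x => A x i j)) -> Ck k U (fun x => \det (A x)).
Proof.
move=> oU CA; apply: Ck_sum => // s _; apply: CkM => //; first exact: Ck_cst.
exact: Ck_prod.
Qed.

End SmoothMatrices.

Lemma Ck_invmx {R : realType} {n m : nat} k (U : set 'rV[R]_n) (A : 'rV[R]_n -> 'M[R]_m) i j :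
  open U -> (forall x, U x -> A x \in unitmx) ->
  (forall i j, Ck k U (fun x => A x i j)) -> Ck k U (fun x => invmx (A x) i j).
Proof.
move=> oU Au CA.
apply: (@Ck_eq _ _ _ _ (fun x => (\det (A x))^-1 * ((-1) ^+ (j + i) * \det (row' j (col' i (A x)))))) => //.
  by move=> x Ux; rewrite /invmx Au// !mxE /cofactor.
apply: CkM => //.
  apply: CkV => //; last exact: Ck_det.
  by move=> x Ux; rewrite -unitfE -unitmxE Au.
apply: CkM => //; first exact: Ck_cst.
apply: Ck_det => // a b.
by apply: (Ck_eq oU _ (CA (lift j a) (lift i b))) => x _; rewrite !mxE.
Qed.

Section CutoffBound.
Context {R : realType} {n : nat} {M : ptopologicalType} {S : smooth_structure R n M}.
Variables (g : riemannian_metric S) (c : chart R n M) (x0 : 'rV[R]_n) (r : R).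
Hypotheses (Sc : atlas S c) (r0 : 0 < r) (rc : cball x0 r `<=` chart_img c).
Implicit Types (d e : chart R n M) (p : M) (x y v : 'rV[R]_n).

(** On the compact ball the derivatives of the bump and the diagonal of the inverse metric are
    bounded; outside it the cut-off is locally zero. Hence one constant serves for all charts
    [d]. *)
Lemma cutoff_gradient_bound : exists2 C, 0 <= C & forall d y v, atlas S d -> chart_img d y ->
  `|'D_v (fun z => cutoff c x0 r (chart_inv d z)) y| <= C * Num.sqrt (bilin (g d y) v v).
Proof.
have oc : open (chart_img c) by exact: chart_img_open.
have Gu x : chart_img c x -> g c x \in unitmx.
  by move=> xc; apply: posdef_unit; exact: (metric_pos g Sc xc).
have CG k i j : Ck k (chart_img c) (fun x => g c x i j).
  by have /smooth_CkP := metric_smooth g Sc i j; exact.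
have H (i : 'I_n) : exists K : R, 0 <= K /\ forall x v, cball x0 r x ->
    `|partial i (bump x0 r) x * v 0 i| <= K * Num.sqrt (bilin (g c x) v v).
  have [x xr|K1 K10 HK1] := @cball_bounded _ _ (partial i (bump x0 r)) x0 r (ltW r0).
    exact: (Ck_cont (Ck_partial i (Ck_bump 1 x0 r))).
  have [x xr|K2 K20 HK2] := @cball_bounded _ _ (fun x => invmx (g c x) i i) x0 r (ltW r0).
    by apply: (Ck_cont (Ck_invmx i i oc Gu (CG 0%N))); exact: rc.
  exists (K1 * Num.sqrt K2); split; first by rewrite mulr_ge0// sqrtr_ge0.
  move=> x v xr; rewrite normrM -mulrA ler_pM//; first exact: HK1.
  rewrite -sqrtrM// -sqrtr_sqr; apply: ler_wsqrtr.
  have xc := rc xr.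
  have := coord_sqr_le (Defs.metric_sym g Sc xc) (metric_pos g Sc xc) v i; move/le_trans; apply.
  rewrite ler_wpM2r//; first exact: (bilin_ge0 (metric_pos g Sc xc)).
  by apply: le_trans (HK2 x xr); exact: ler_norm.
have [K HK] := choice H.
have K0 i : 0 <= K i by case: (HK i).
exists (\sum_i K i); first by rewrite sumr_ge0.
move=> d y v Sd yd.
have od : open (chart_img d) by exact: chart_img_open.
have CB : Ck 1 (chart_img d) (fun z => cutoff c x0 r (chart_inv d z)).
  by have /smooth_CkP := cutoff_smooth Sc r0 rc Sd; exact.
have dB := Ck_differentiable od CB yd.
have sq0 : 0 <= Num.sqrt (bilin (g d y) v v) by exact: sqrtr_ge0.
have [[yc yb]|ny] := pselect (chart_dom c (chart_inv d y) /\ cball x0 r (c (chart_inv d y))).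
  have yo : overlap d c y by [].
  have [zo zE] := transitionK yo.
  set z := transition d c y in zo zE.
  have zb : cball x0 r z by [].
  have dbump : differentiable (bump x0 r) z.
    by apply: (@Ck_differentiable _ _ 0 setT) => //; [exact: openT|exact: Ck_bump].
  have dt := transition_diff Sd Sc yo.
  have -> : 'D_v (fun z => cutoff c x0 r (chart_inv d z)) y = 'D_(v *m 'J (transition d c) y) (bump x0 r) z.
    apply: (derive_comp_jacobian _ dt dbump).
    by apply: filterS (near_overlap yo) => w wo; rewrite cutoff_overlap.
  rewrite derive_partial//; set w := v *m _.
  have -> : bilin (g d y) v v = bilin (g c z) w w.
    by rewrite (metric_change g Sd Sc yo) /bilin /w trmx_mul !mulmxA.
  apply: (le_trans (ler_norm_sum _ _ _)); rewrite mulr_suml; apply: ler_sum => i _.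
  by rewrite mulrC; case: (HK i) => _; exact.
suff -> : 'D_v (fun z => cutoff c x0 r (chart_inv d z)) y = 0.
  by rewrite normr0 mulr_ge0// sumr_ge0.
have nK : ~ (chart_inv c @` cball x0 r) (chart_inv d y).
  move=> [z zb zE]; apply: ny; rewrite -zE; split; first exact/chart_inv_dom/rc.
  by rewrite chart_invK//; exact: rc.
have oK : open (~` (chart_inv c @` cball x0 r)).
  by rewrite openC; exact: (chart_cball_closed (S := S) r0 rc).
rewrite (@near_eq_derive _ _ _ _ (cst 0)) ?derive_cst//.
have N : nbhs y (chart_inv d @^-1` (~` (chart_inv c @` cball x0 r))).
  by apply: nbhs_chart_inv => //; apply: open_nbhs_nbhs; split.
apply: filterS N => z /= zK; apply/eqP/negPn/negP => /(cutoff_support r0)[zc zb].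
by apply: zK; exists (c (chart_inv d z)); [exact: ltW|rewrite chart_mapK].
Qed.

Lemma speed_continuous d (gamma : R -> 'rV[R]_n) (t : R) : atlas S d -> chart_img d (gamma t) ->
  derivable gamma t 1 -> {for t, continuous (derive1 gamma)} ->
  {for t, continuous (fun s => Num.sqrt (bilin (g d (gamma s)) (derive1 gamma s) (derive1 gamma s)))}.
Proof.
move=> Sd gd dg cg'.
have cg : {for t, continuous gamma} by exact: derivable_continuous.
apply: (@continuous_comp _ _ _ (fun s => bilin (g d (gamma s)) (derive1 gamma s) (derive1 gamma s)) Num.sqrt); last exact: sqrt_continuous.
rewrite (_ : (fun s => _) = (fun s => \sum_i \sum_j derive1 gamma s 0 i * g d (gamma s) i j * derive1 gamma s 0 j)); last first.
  by apply/funext => s; rewrite bilinE.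
have cc i : {for t, continuous (fun s => derive1 gamma s 0 i)}.
  exact: (@cvg_row _ _ _ (nbhs t) _ (derive1 gamma)).
apply: continuous_sum => i _; apply: continuous_sum => j _.
apply: continuousM; last exact: cc.
apply: continuousM; first exact: cc.
apply: (@continuous_comp _ _ _ gamma (fun x => g d x i j)) => //.
by apply: (@Ck_cont _ _ 0 (chart_img d)) => //; have /smooth_CkP := metric_smooth g Sd i j; exact.
Qed.

(** This lets the length distance control the topology: a point joined to the centre by a short
    enough curve has positive cut-off, hence lies in the chart ball. *)
Lemma cutoff_path_bound : exists2 C, 0 <= C & forall p q l, curve_length g p q l ->
  `|cutoff c x0 r p - cutoff c x0 r q| <= C * l.
Proof.
have [C C0 HC] := cutoff_gradient_bound; exists C => // p q l.
elim=> [{}p|d gamma {}q {}l Sd dg cg' gd _ IH]; first by rewrite subrr normr0 mulr0.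
set I1 := (\int[_]_(t in _) _)%R.
rewrite mulrDr -(subrK (cutoff c x0 r (chart_inv d (gamma 1))) (cutoff c x0 r (chart_inv d (gamma 0)))).
rewrite -addrA; apply: (le_trans (ler_normD _ _)); apply: lerD => //.
pose u t := cutoff c x0 r (chart_inv d (gamma t)).
pose B z := cutoff c x0 r (chart_inv d z).
pose sp s := Num.sqrt (bilin (g d (gamma s)) (derive1 gamma s) (derive1 gamma s)).
have od : open (chart_img d) by exact: chart_img_open.
have CB k : Ck k (chart_img d) B.
  by have /smooth_CkP := cutoff_smooth Sc r0 rc Sd; exact.
have ud (t : R) : 0 <= t <= 1 -> is_derive t (1 : R) u ('D_(derive1 gamma t) B (gamma t)).
  move=> t01; apply: is_derive_comp_diff.
    by apply: (Ck_differentiable od (CB 1%N)); apply: gd; rewrite in_itv.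
  by rewrite derive1E; exact: derivableP.
have csp (t : R) : 0 <= t <= 1 -> {for t, continuous sp}.
  move=> t01; have gt : chart_img d (gamma t) by apply: gd; rewrite in_itv.
  exact: (speed_continuous Sd gt (dg t) (cg' t)).
have cdu (t : R) : 0 <= t <= 1 -> {for t, continuous (fun t => \sum_i derive1 gamma t 0 i * partial i B (gamma t))}.
  move=> t01; apply: continuous_sum => i _; apply: continuousM.
    by apply: (@cvg_row _ _ _ (nbhs t) _ (derive1 gamma)); exact: cg'.
  apply: (@continuous_comp _ _ _ gamma (partial i B)).
    exact: derivable_continuous.
  by apply: (Ck_cont (Ck_partial i (CB 1%N))); apply: gd; rewrite in_itv.
have duE (t : R) : 0 <= t <= 1 -> 'D_(derive1 gamma t) B (gamma t) = \sum_i derive1 gamma t 0 i * partial i B (gamma t).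
  move=> t01; apply: derive_partial.
  by apply: (Ck_differentiable od (CB 1%N)); apply: gd; rewrite in_itv.
pose du t := \sum_i derive1 gamma t 0 i * partial i B (gamma t).
have cin f : (forall t : R, 0 <= t <= 1 -> {for t, continuous f}) -> {within `[0%R, 1%R], continuous (f : R -> R)}.
  by move=> cf; apply: continuous_in_subspaceT => t; rewrite inE/= in_itv/=; exact: cf.
have FTC : (\int[lebesgue_measure]_(t in `[0%R, 1%R]) du t)%R = u 1 - u 0.
  rewrite /Rintegral (@continuous_FTC2 _ du u 0 1)//.
  - exact: cin.
  - have cu (t : R) : 0 <= t <= 1 -> {for t, continuous u}.
      by move=> /ud[/derivable_continuous + _].
    split.
    + by move=> t; rewrite in_itv/= => /andP[t0 t1]; have [|] := ud t; rewrite ?(ltW t0) ?(ltW t1).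
    + by apply: cvg_at_right_filter; apply: cu; rewrite lexx ler01.
    + by apply: cvg_at_left_filter; apply: cu; rewrite lexx ler01.
  - move=> t; rewrite in_itv/= => /andP[t0 t1].
    have t01 : 0 <= t <= 1 by rewrite !ltW.
    by rewrite derive1E; have [_ ->] := ud t t01; exact: duE.
have int f : (forall t : R, 0 <= t <= 1 -> {for t, continuous f}) ->
    lebesgue_measure.-integrable `[0%R, 1%R] (EFin \o (f : R -> R)).
  by move=> cf; apply: continuous_compact_integrable; [exact: segment_compact|exact: cin].
rewrite distrC -/(u 1) -/(u 0) -FTC.
have LN : `|(\int[lebesgue_measure]_(t in `[0%R, 1%R]) du t)%R| <= (\int[lebesgue_measure]_(t in `[0%R, 1%R]) `|du t|)%R.
  by apply: le_normr_Rintegral => //; exact: int _ cdu.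
apply: (le_trans LN).
rewrite /I1 -RintegralZl//; last exact: int.
apply: le_Rintegral => //.
- by apply: int => t t01; apply: (cvg_norm (cdu t t01)).
- by apply: int => t t01; apply: continuousM; [exact: cst_continuous|exact: csp].
move=> t; rewrite /= in_itv/= => t01; rewrite /du -duE//.
by apply: HC => //; apply: gd; rewrite in_itv.
Qed.

End CutoffBound.

(** * Completeness of fields of bounded speed *)

Section PathLengths.
Context {R : realType} {n : nat} {M : ptopologicalType} {S : smooth_structure R n M}.
Variable g : riemannian_metric S.

Lemma curve_length_trans p q s l1 l2 : curve_length g p q l1 -> curve_length g q s l2 ->
  curve_length g p s (l1 + l2).
Proof.
elim=> [{}p|c gamma {}q l Sc dg cg gc _ IH] qs; first by rewrite add0r.
by rewrite -addrA; apply: curve_length_cons => //; exact: IH.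
Qed.

Lemma Rintegral_le_const (f : R -> R) (K : R) :
  (forall t : R, 0 <= t <= 1 -> {for t, continuous f} /\ f t <= K) ->
  (\int[lebesgue_measure]_(t in `[0%R, 1%R]) f t)%R <= K.
Proof.
move=> H.
have int (h : R -> R) : (forall t : R, 0 <= t <= 1 -> {for t, continuous h}) ->
    lebesgue_measure.-integrable `[0%R, 1%R] (EFin \o h).
  move=> ch; apply: continuous_compact_integrable; first exact: segment_compact.
  by apply: continuous_in_subspaceT => t; rewrite inE/= in_itv/=; exact: ch.
apply: (@le_trans _ _ (\int[lebesgue_measure]_(t in `[0%R, 1%R]) (cst K t))%R).
  apply: le_Rintegral => //.
  - by apply: int => t /H[].
  - by apply: int => t _; exact: cst_continuous.
  - by move=> t /=; rewrite in_itv/= => /H[].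
by rewrite Rintegral_cst//= lebesgue_measure_itv/= lte_fin ltr01 oppr0 adde0 mulr1.
Qed.

(* A C^1 reparametrization of the whole line onto [-h, h] carrying 0 to 0 and 1 to h. *)
Definition theta (h s : R) : R := 2 * h * s / (1 + s ^+ 2).
Definition dtheta (h s : R) : R := 2 * h * (1 - s ^+ 2) / (1 + s ^+ 2) ^+ 2.

Let den_gt0 (s : R) : 0 < 1 + s ^+ 2.
Proof. by rewrite ltr_pwDl// sqr_ge0. Qed.

Lemma theta_le h s : `|theta h s| <= `|h|.
Proof.
rewrite /theta normrM normfV (gtr0_norm (den_gt0 s)) ler_pdivrMr// !normrM normr_nat.
rewrite mulrAC mulrC ler_wpM2l// -[s ^+ 2]real_normK ?num_real//.
by have := sqr_ge0 (1 - `|s|); nra.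
Qed.

Lemma dtheta_le h s : `|dtheta h s| <= 2 * `|h|.
Proof.
have d0 := den_gt0 s.
rewrite /dtheta normrM normfV (gtr0_norm (exprn_gt0 2 d0)) ler_pdivrMr ?exprn_gt0//.
rewrite !normrM normr_nat; apply: ler_wpM2l; first by rewrite mulr_ge0.
have s2 := sqr_ge0 s; rewrite ler_norml; move: (s ^+ 2) s2 d0 => y y0 d0.
by apply/andP; split; nra.
Qed.

Lemma is_derive_theta h s : is_derive s (1 : R) (theta h) (dtheta h s).
Proof.
have dn : 1 + s ^+ 2 != 0 by rewrite gt_eqF.
have D1 : is_derive s (1 : R) (fun s : R => 2 * h * s) (2 * h).
  have := is_deriveZ (2 * h) (is_derive_id s (1 : R)).
  by rewrite [_ *: 1]mulr1.
have D2 : is_derive s (1 : R) (fun s : R => 1 + s ^+ 2) (2 * s).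
  have D3 : is_derive s (1 : R) (fun s : R => s ^+ 2) (2 * s).
    by split; [exact: exprn_derivable|rewrite exp_derive [LHS]mulr1 expr1].
  by have := is_deriveD (is_derive_cst (1 : R) s (1 : R)) D3; rewrite add0r.
have D3 : is_derive s (1 : R) (fun s : R => (1 + s ^+ 2)^-1) (- (1 + s ^+ 2) ^- 2 * (2 * s)).
  have [e2 <-] := D2; split; first exact: derivableV.
  by rewrite deriveV.
have := is_deriveM D1 D3; rewrite (_ : _ *: _ + _ *: _ = dtheta h s)//.
by rewrite /dtheta /GRing.scale/=; field; exact: dn.
Qed.

Lemma dtheta_continuous h : continuous (dtheta h).
Proof.
move=> s.
have c2 : {for s, continuous (fun s : R => s ^+ 2)} by exact: exprn_continuous.
apply: (@continuousM _ _ (fun s : R => 2 * h * (1 - s ^+ 2)) (fun s : R => ((1 + s ^+ 2) ^+ 2)^-1)).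
  apply: (@continuousM _ _ (cst (2 * h)) (fun s : R => 1 - s ^+ 2)); first exact: cst_continuous.
  by apply: continuousB => //; exact: cst_continuous.
apply: (@continuousV _ _ (fun s : R => (1 + s ^+ 2) ^+ 2)); first by rewrite expf_neq0// gt_eqF.
apply: (@continuous_comp _ _ _ (fun s : R => 1 + s ^+ 2) (fun y => y ^+ 2)); last exact: exprn_continuous.
by apply: continuousD => //; exact: cst_continuous.
Qed.

End PathLengths.

Section CompleteFlow.
Context {R : realType} {n : nat} {M : ptopologicalType} {S : smooth_structure R n M}.
Variables (g : riemannian_metric S) (X : vector_field S).
Hypothesis Xbounded : forall c, atlas S c -> forall x, chart_img c x ->
  bilin (g c x) (X c x) (X c x) <= 1.
Implicit Types (c d : chart R n M) (p q : M) (gamma : R -> M).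

(** A piece of [curve_length] is C^1 on the whole line, but [gamma] is controlled only near [x].
    Composition with [theta] folds the line onto a short time interval, at the cost of the factor
    2. *)
Lemma icurve_local_length gamma (x : R) : (\forall s \near x, icurve_at X gamma s) ->
  exists2 d, 0 < d & forall s t : R, `|s - x| < d -> `|t - x| < d ->
    exists2 l, curve_length g (gamma s) (gamma t) l & l <= 2 * `|t - s|.
Proof.
move=> ic; have [cg _] := nbhs_singleton ic.
pose c := chart_at S (gamma x).
have Sc : atlas S c := chart_at_atlas S _.
have gc : chart_dom c (gamma x) := chart_at_dom S _.
have N : nbhs x (gamma @^-1` chart_dom c) by exact: (cg _ (nbhs_chart_dom gc)).
have [d /= d0 Hd] := iffLR (nbhs_ballP _ _) (filterI ic N).
(* The time [s + theta h r] is within [|s - x| + |t - s|] of [x], hence within [d]. *)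
exists (d / 3); first by rewrite divr_gt0.
move=> s t sx tx; pose h := t - s.
have inb r : icurve_at X gamma (s + theta h r) /\ chart_dom c (gamma (s + theta h r)).
  apply: Hd; rewrite -ball_normE/= distrC.
  rewrite (_ : s + _ - x = (s - x) + theta h r); last by ring.
  apply: (le_lt_trans (ler_normD _ _)).
  have h2 : `|h| <= `|t - x| + `|s - x|.
    by rewrite /h (_ : t - s = (t - x) - (s - x)); [exact: ler_normB|ring].
  by have := theta_le h r; lra.
pose gam r := c (gamma (s + theta h r)).
have gim r : chart_img c (gam r) by apply: chart_map_img; case: (inb r).
have dgam (r : R) : is_derive r (1 : R) gam (dtheta h r *: X c (gam r)).
  have [[_ /(_ c Sc) D] dm] := inb r.
  apply: (@is_derive_comp1 _ _ (fun u => c (gamma u)) (fun r => s + theta h r)); first exact: D.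
  by have := is_deriveD (is_derive_cst s r (1 : R)) (is_derive_theta h r); rewrite add0r.
have d1gam : derive1 gam = fun r => dtheta h r *: X c (gam r).
  by apply/funext => r; rewrite derive1E; have [_] := dgam r.
have derg (r : R) : derivable gam r 1 by case: (dgam r).
have contd : continuous (derive1 gam).
  move=> r; rewrite d1gam; apply: (@row_cvgP _ _ _ (nbhs r) _ (fun r => dtheta h r *: X c (gam r))) => j.
  rewrite mxE (_ : (fun t0 => _) = fun r => dtheta h r * X c (gam r) 0 j); last first.
    by apply/funext => u; rewrite mxE.
  apply: (@continuousM R _ (dtheta h) (fun r => X c (gam r) 0 j)); first exact: (@dtheta_continuous R h r).
  apply: (@continuous_comp _ _ _ gam (fun x => X c x 0 j)); first exact: derivable_continuous.
  exact: (Ck_cont (smooth_rV_Ck 0 j (vf_smooth X Sc)) (gim r)).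
have g0 : chart_inv c (gam 0) = gamma s.
  have [_ dm] := inb 0; rewrite /gam chart_mapK// /theta mulr0 mul0r addr0//.
have g1 : chart_inv c (gam 1) = gamma t.
  have [_ dm] := inb 1; rewrite /gam chart_mapK// /theta expr1n mulr1 -[1 + 1]/(2%:R).
  by rewrite mulrAC divff// mul1r /h addrC subrK.
clearbody gam.
exists (\int[lebesgue_measure]_(t in `[0%R, 1%R])
    Num.sqrt (bilin (g c (gam t)) (derive1 gam t) (derive1 gam t)) + 0)%R.
  move: (curve_length_cons (g := g) Sc derg contd (fun r _ => gim r) (curve_length_nil g (chart_inv c (gam 1)))).
  by rewrite g0 g1.
rewrite addr0.
pose sp (r : R) : R := Num.sqrt (bilin (g c (gam r)) (derive1 gam r) (derive1 gam r)).
apply: (@Rintegral_le_const _ sp) => r r01; split.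
  exact: (speed_continuous Sc (gim r) (derg r) (contd r)).
rewrite /sp d1gam bilinZl bilinZr mulrA -expr2 sqrtrM ?sqr_ge0// sqrtr_sqr.
rewrite -[leRHS]mulr1; apply: ler_pM => //.
  exact: dtheta_le.
by rewrite -sqrtr1; apply: ler_wsqrtr; exact: Xbounded.
Qed.

Lemma icurve_length gamma (a b s t : R) : (forall r, a < r < b -> icurve_at X gamma r) ->
  a < s < b -> a < t < b -> exists2 l, curve_length g (gamma s) (gamma t) l & l <= 2 * `|t - s|.
Proof.
move=> ic /andP[as_ sb] /andP[at_ tb].
(* Both directions are carried along, since the chain only relates times in increasing order. *)
pose P s t := (exists2 l, curve_length g (gamma s) (gamma t) l & l <= 2 * (t - s)) /\
  (exists2 l, curve_length g (gamma t) (gamma s) l & l <= 2 * (t - s)).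
have H s' t' : a < s' -> s' <= t' -> t' < b -> P s' t'.
  move=> as' st' tb'; apply: interval_chain => // [x /andP[sx xt]|u v w _ uv vw _].
    have [ax xb] := (lt_le_trans as' sx, le_lt_trans xt tb').
    have [|d d0 Hd] := @icurve_local_length gamma x.
      by apply: filterS (filterI (lt_nbhsr ax) (lt_nbhsl xb)) => r [ar rb]; apply: ic; rewrite ar rb.
    exists d => // u v _ uv _ ux vx; split.
      by have [l cl] := Hd u v ux vx; rewrite ger0_norm ?subr_ge0//; exists l.
    by have [l cl] := Hd v u vx ux; rewrite distrC ger0_norm ?subr_ge0//; exists l.
  move=> [[l1 c1 h1] [l2 c2 h2]] [[l3 c3 h3] [l4 c4 h4]]; split.
    by exists (l1 + l3); [exact: curve_length_trans c3|lra].
  by exists (l4 + l2); [exact: curve_length_trans c2|lra].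
have [st|ts] := leP s t.
  by have [[l cl hl] _] := H s t as_ st tb; exists l => //; rewrite ger0_norm ?subr_ge0.
have [_ [l cl hl]] := H t s at_ (ltW ts) sb; exists l => //.
by rewrite distrC ger0_norm ?subr_ge0// ltW.
Qed.

(** The time [e] is uniform over a neighbourhood of [p], so that a curve can be restarted from
    points converging to [p]. *)
Lemma icurve_local_exists p : exists e (W : set M), [/\ 0 < e, nbhs p W & forall q, W q ->
  exists gamma, gamma 0 = q /\ forall t : R, `|t| < e -> icurve_at X gamma t].
Proof.
pose c := chart_at S p.
have Sc : atlas S c := chart_at_atlas S _.
have pc : chart_dom c p := chart_at_dom S _.
have [e [d [C [phi [e0 d0 H _ _]]]]] :=
  local_flow_exists 0 (@chart_img_open _ _ _ c) (vf_smooth X Sc) (chart_map_img pc).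
exists e, (chart_dom c `&` c @^-1` ball (c p) d); split=> //.
  apply: filterI; first exact: nbhs_chart_dom.
  by apply: (chart_map_cvg pc); exact: nbhsx_ballx.
move=> q [qc qb]; exists (fun t => chart_inv c (phi t (c q))); split.
  have z0 : `|(0 : R)| < e by rewrite normr0.
  by have [-> _ _ _] := H (c q) 0 qb z0; rewrite chart_mapK.
move=> t te; have [_ h1 h2 _] := H (c q) t qb te.
exact: icurve_at_inv.
Qed.

Lemma icurve_glue gamma sigma (a b tau e : R) : a < tau < b -> 0 < e ->
  (forall t, a < t < b -> icurve_at X gamma t) ->
  sigma 0 = gamma tau -> (forall t, `|t| < e -> icurve_at X sigma t) ->
  exists gamma', (forall t, a < t < b -> gamma' t = gamma t) /\
    forall t, (a < t < b) \/ `|t - tau| < e -> icurve_at X gamma' t.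
Proof.
move=> /andP[atau taub] e0 ig s0 is_.
pose gamma' t := if a < t < b then gamma t else sigma (t - tau).
have E t : a < t < b -> gamma' t = gamma t by rewrite /gamma' => ->.
have agree t : a < t < b -> `|t - tau| < e -> gamma t = sigma (t - tau).
  move=> /andP[at_ tb] te.
  apply: (@icurve_unique _ _ _ _ X gamma (fun t => sigma (t - tau)) (Num.max a (tau - e)) (Num.min b (tau + e)) tau).
  - by rewrite gt_max lt_min atau taub; apply/andP; split; lra.
  - move=> u; rewrite gt_max lt_min => /andP[/andP[au tu] /andP[ub ut]].
    split; first by apply: ig; rewrite au ub.
    by apply: icurve_at_shift; apply: is_; rewrite ltr_norml; apply/andP; split; lra.
  - by rewrite subrr s0.
  - by move: te; rewrite ltr_norml gt_max lt_min at_ tb => /andP[h1 h2]; apply/andP; split; lra.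
have E' t : `|t - tau| < e -> gamma' t = sigma (t - tau).
  by move=> te; rewrite /gamma'; case: ifPn => // tab; exact: agree.
exists gamma'; split=> // t [tab|te].
  apply: icurve_at_eq (ig t tab); case/andP: tab => at_ tb.
  apply: filterS (filterI (lt_nbhsr at_) (lt_nbhsl tb)) => u [au ub].
  by rewrite E// au ub.
apply: (@icurve_at_eq _ _ _ _ X (fun t => sigma (t - tau))); last exact/icurve_at_shift/is_.
have : nbhs t [set u | `|u - tau| < e].
  have c : {for t, continuous (fun u : R => `|u - tau|)}.
    by apply: cvg_norm; apply: continuousB; [exact: cvg_id|exact: cst_continuous].
  by have := c _ (lt_nbhsl te).
by apply: filterS => u /= /E'.
Qed.

Hypothesis gcomplete : complete_metric g.

(** Bounded speed turns a Cauchy sequence of times into a Cauchy sequence of points. Completeness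
    gives a limit for the distance, and a cut-off supported inside [W] makes it a limit for the
    topology. *)
Lemma icurve_limit gamma (a b : R) (t : nat -> R) :
  (forall r, a < r < b -> icurve_at X gamma r) -> (forall i, a < t i < b) ->
  (forall e : R, 0 < e -> exists N, forall i j, (N <= i)%N -> (N <= j)%N -> `|t j - t i| < e) ->
  exists p, forall W, nbhs p W -> exists N, forall i, (N <= i)%N -> W (gamma (t i)).
Proof.
move=> ic tab tC.
have [|p Hp] := @gcomplete (fun i => gamma (t i)).
  move=> e e0; have [|N HN] := tC (e / 2); first by rewrite divr_gt0.
  exists N => i j Ni Nj; have [l cl hl] := icurve_length ic (tab i) (tab j).
  apply: (@le_lt_trans _ _ l%:E).
    by apply: ereal_inf_lbound; exists l.
  by rewrite lte_fin; have := HN i j Ni Nj; lra.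
exists p => W pW.
pose c := chart_at S p.
have Sc : atlas S c := chart_at_atlas S _.
have pc : chart_dom c p := chart_at_dom S _.
have xc := chart_map_img pc.
have N1 : nbhs (c p) (chart_img c `&` chart_inv c @^-1` W).
  apply: filterI; first exact: nbhs_chart_img.
  by apply: nbhs_chart_inv => //; rewrite chart_mapK.
have [d /= d0 Hd] := iffLR (nbhs_ballP _ _) N1.
have r0 : 0 < d / 2 by rewrite divr_gt0.
have rd y : `|y - c p| <= d / 2 -> ball (c p) d y.
  by move=> yp; rewrite -ball_normE/= distrC (le_lt_trans yp)//; lra.
have rc : cball (c p) (d / 2) `<=` chart_img c by move=> y /rd/Hd[].
have [C C0 HC] := cutoff_path_bound g Sc r0 rc.
have Bp : 0 < cutoff c (c p) (d / 2) p.
  by rewrite /cutoff; case: asboolP => // _; exact: bump_center.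
(* Below this distance the cut-off cannot have dropped to 0; [C + 1] avoids dividing by 0. *)
have [|N HN] := Hp (cutoff c (c p) (d / 2) p / (C + 1)).
  by rewrite divr_gt0// ltr_wpDl.
exists N => i Ni.
have [_ [l cl <-]] := ereal_inf_lt (HN i Ni).
rewrite lte_fin ltr_pdivlMr ?ltr_wpDl// => hl.
have l0 : C * l < cutoff c (c p) (d / 2) p.
  have [l0|l0] := leP 0 l; first by apply: le_lt_trans hl; rewrite mulrDr mulr1 mulrC lerDl.
  by apply: le_lt_trans Bp; rewrite mulr_ge0_le0// ltW.
have nz : cutoff c (c p) (d / 2) (gamma (t i)) != 0.
  apply: contraTneq l0 => z; rewrite -leNgt; have := HC _ _ _ cl.
  by rewrite z sub0r normrN; apply: le_trans; exact: ler_norm.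
have [dm nm] := cutoff_support r0 nz.
have [_] := Hd _ (rd _ (ltW nm)).
by rewrite /= chart_mapK.
Qed.

(** Along times running from the midpoint to the endpoint [e], the curve converges. Uniform
    existence near the limit gives [sigma], which lives for a time [eps] from a point less than
    [eps / 2] before the end. *)
Lemma icurve_near_endpoint gamma (a b e : R) : a < b -> e = a \/ e = b ->
  (forall r, a < r < b -> icurve_at X gamma r) ->
  exists eps tau sigma, [/\ 0 < eps, a < tau < b, `|tau - e| < eps / 2, sigma 0 = gamma tau &
    forall t, `|t| < eps -> icurve_at X sigma t].
Proof.
move=> ab eab ic.
pose m := (a + b) / 2; pose t (i : nat) := e + (m - e) / i.+1%:R.
have inv01 (i : nat) : 0 < (i.+1%:R^-1 : R) <= 1.
  by rewrite invr_gt0 ltr0n/= invf_le1 ?ltr0n// ler1n.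
have tab i : a < t i < b.
  rewrite /t /m; have := inv01 i; move: (i.+1%:R^-1) => y /andP[y0 y1].
  by case: eab => ->; apply/andP; split; nra.
have t0 : t @ \oo --> e.
  rewrite -[X in _ --> X]addr0; apply: cvgD; first exact: cvg_cst.
  rewrite -[X in _ --> X](mulr0 (m - e)); apply: cvgM; first exact: cvg_cst.
  exact: cvg_harmonic.
have [|p Hp] := icurve_limit ic tab.
  move=> eta eta0; move/cvgrPdist_lt : t0 => /(_ (eta / 2)); rewrite divr_gt0// => /(_ isT)[N _ HN].
  exists N => i j Ni Nj; have := HN i Ni; have := HN j Nj => /= h1 h2.
  rewrite (_ : t j - t i = (e - t i) - (e - t j)); last by ring.
  by apply: (le_lt_trans (ler_normB _ _)); lra.
have [eps [W [eps0 pW HW]]] := icurve_local_exists p.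
have [N1 HN1] := Hp W pW.
move/cvgrPdist_lt : t0 => /(_ (eps / 2)); rewrite divr_gt0// => /(_ isT)[N2 _ HN2].
pose N := maxn N1 N2.
have [sigma [s0 Hs]] := HW _ (HN1 N (leq_maxl _ _)).
exists eps, (t N), sigma; split=> //.
by have := HN2 N (leq_maxr _ _); rewrite distrC.
Qed.

(** Curves through [q] on symmetric intervals agree by uniqueness, so each time determines one value
    and the pieces assemble. *)
Lemma icurve_union q (I : set R) :
  (forall t, I t -> exists b gamma, [/\ `|t| < b, gamma 0 = q &
      forall s, `|s| < b -> icurve_at X gamma s]) ->
  exists gamma, (I 0 -> gamma 0 = q) /\ forall t, I t -> icurve_at X gamma t.
Proof.
move=> HI.
have uniq b gamma b' gamma' t : gamma 0 = q -> gamma' 0 = q ->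
    (forall s, `|s| < b -> icurve_at X gamma s) -> (forall s, `|s| < b' -> icurve_at X gamma' s) ->
    `|t| < b -> `|t| < b' -> gamma t = gamma' t.
  move=> g0 g0' ig ig' tb tb'.
  apply: (@icurve_unique _ _ _ _ X gamma gamma' (- Num.min b b') (Num.min b b') 0).
  - by rewrite oppr_lt0 lt_min (le_lt_trans _ tb)// (le_lt_trans _ tb').
  - move=> s; rewrite -ltr_norml lt_min => /andP[sb sb'].
    by split; [exact: ig|exact: ig'].
  - by rewrite g0 g0'.
  - by rewrite -ltr_norml lt_min tb tb'.
have ex t : exists p, forall b gamma, gamma 0 = q ->
    (forall s, `|s| < b -> icurve_at X gamma s) -> `|t| < b -> gamma t = p.
  have [[b [gamma [tb g0 ig]]]|nex] := pselect (exists b gamma, [/\ `|t| < b, gamma 0 = q &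
      forall s, `|s| < b -> icurve_at X gamma s]).
    by exists (gamma t) => b' gamma' g0' ig' tb'; exact: (uniq b' _ b).
  (* A default value at times that no curve reaches. *)
  exists point => b gamma g0 ig tb; case: nex; exists b, gamma; split => //.
have [G HG] := choice ex.
exists G; split=> [I0|t It].
  have [b [gamma [tb g0 ig]]] := HI 0 I0.
  by rewrite -(HG 0 b gamma).
have [b [gamma [tb g0 ig]]] := HI t It.
apply: icurve_at_eq (ig t tb).
have : nbhs t [set s | `|s| < b].
  have c : {for t, continuous (fun u : R => `|u|)} by apply: cvg_norm; exact: cvg_id.
  by have := c _ (lt_nbhsl tb).
by apply: filterS => s sb; exact: (HG s b gamma).
Qed.

(** If the symmetric existence times were bounded, the curve on the largest interval would extend
    past both ends, against the supremum. *)
Lemma complete_icurve q : exists gamma, gamma 0 = q /\ forall t : R, icurve_at X gamma t.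
Proof.
pose B := [set b : R | exists gamma, gamma 0 = q /\ forall t, `|t| < b -> icurve_at X gamma t].
have [hB|nB] := pselect (has_ubound B); last first.
  have [|gamma [g0 ig]] := @icurve_union q setT.
    move=> t _; apply: contrapT => nex; apply: nB; exists `|t| => b [gamma [g0 ig]].
    rewrite leNgt; apply/negP => tb; apply: nex; exists b, gamma; split=> //.
  by exists gamma; split; [exact: g0|move=> t; exact: ig].
have [e [W [e0 qW HW]]] := icurve_local_exists q.
have Be : B e by exact: (HW q (nbhs_singleton qW)).
have hsB : has_sup B by split; [exists e|].
set b := sup B.
have b0 : 0 < b by apply: (lt_le_trans e0); exact: (ub_le_sup hB).
have [|gamma [g0 ig]] := @icurve_union q [set t | `|t| < b].
  move=> t /= tb; have [b' [gamma [g0 ig]] tb'] := @sup_adherent _ B (b - `|t|) ltac:(by rewrite subr_gt0) hsB.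
  by exists b', gamma; split=> //; move: tb'; rewrite -/b; lra.
have {}g0 : gamma 0 = q by apply: g0; rewrite /= normr0.
have bb : - b < b by lra.
have ig1 r : - b < r < b -> icurve_at X gamma r by rewrite -ltr_norml; exact: ig.
(* The extension goes past the right end first, and then, for the longer curve, past the left end;
   [b'] keeps the smaller gain. *)
have [e1 [t1 [s1 [e10 t1b t1e s10 is1]]]] := icurve_near_endpoint bb (or_intror erefl) ig1.
have [gamma1 [E1 ig2]] := icurve_glue t1b e10 ig1 s10 is1.
have ig2' r : - b < r < b + e1 / 2 -> icurve_at X gamma1 r.
  move=> /andP[br rb]; apply: ig2.
  have [rb'|br'] := ltP r b; first by left; rewrite br.
  right; rewrite ger0_norm; first by move: t1e; rewrite ltr_norml => /andP[]; lra.
  by case/andP: t1b => _ h; rewrite subr_ge0 ltW// (lt_le_trans h).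
have bb1 : - b < b + e1 / 2 by lra.
have [e2 [t2 [s2 [e20 t2b t2e s20 is2]]]] := icurve_near_endpoint bb1 (or_introl erefl) ig2'.
have [gamma2 [E2 ig3]] := icurve_glue t2b e20 ig2' s20 is2.
pose b' := b + Num.min (e1 / 2) (e2 / 2).
have m0 : 0 < Num.min (e1 / 2) (e2 / 2) by rewrite lt_min !divr_gt0.
have Bb' : B b'.
  exists gamma2; split.
    rewrite E2; last by apply/andP; split; lra.
    by rewrite E1 ?g0//; apply/andP; split; lra.
  move=> t; rewrite ltr_norml /b' => /andP[tb1 tb2]; apply: ig3.
  have m1 : Num.min (e1 / 2) (e2 / 2) <= e1 / 2 by rewrite ge_min lexx.
  have m2 : Num.min (e1 / 2) (e2 / 2) <= e2 / 2 by rewrite ge_min lexx orbT.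
  have [bt|tb] := ltP (- b) t; first by left; apply/andP; split; lra.
  right; rewrite ler0_norm; first by move: t2e; rewrite ltr_norml => /andP[]; lra.
  by case/andP: t2b => h _; rewrite subr_le0 ltW// (le_lt_trans tb).
have := ub_le_sup hB Bb'; rewrite -/b /b'; lra.
Qed.

Lemma complete_flow : exists phi : R -> M -> M,
  [/\ forall q, phi 0 q = q, forall s t q, phi (s + t) q = phi s (phi t q) &
      forall t q, icurve_at X (phi^~ q) t].
Proof.
have [G HG] := choice complete_icurve.
exists (fun t q => G q t); split=> [q|s t q|t q]; try by case: (HG q).
apply: (@icurve_unique _ _ _ _ X (fun s => G q (s + t)) (G (G q t)) (- (`|s| + 1)) (`|s| + 1) 0).
- by apply/andP; split; have := normr_ge0 s; lra.
- by move=> u _; split; [apply: (@icurve_at_shift _ _ _ _ X (G q)); case: (HG q)|case: (HG (G q t))].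
- by rewrite add0r; have [->] := HG (G q t).
- by rewrite -ltr_norml ltrDl.
Qed.

End CompleteFlow.

(** * Smoothness of the flow *)

Lemma open_preimage_C0 {R : realType} {n m : nat} (W : set 'rV[R]_n) (V : set 'rV[R]_m)
    (G : 'rV[R]_n -> 'rV[R]_m) : open W -> open V ->
  (forall j, Ck 0 W (fun x => G x 0 j)) -> open (W `&` G @^-1` V).
Proof.
move=> oW oV CG; rewrite openE => x [Wx Vx].
have cG : {for x, continuous G}.
  by apply: (@row_cvgP _ _ _ (nbhs x) _ G) => j; exact: (Ck_cont (CG j)).
apply: filterI; first by apply: open_nbhs_nbhs; split.
by apply: cG; apply: open_nbhs_nbhs; split.
Qed.

Lemma sum_delta {R : pzRingType} {n} (i : 'I_n) (f : 'I_n -> R) : \sum_k (i == k)%:R * f k = f i.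
Proof.
rewrite (bigD1 i)//= eqxx mul1r big1 ?addr0// => k ki.
by rewrite eq_sym (negPf ki) mul0r.
Qed.

Section FlowSmoothness.
Context {R : realType} {n : nat} {M : ptopologicalType} {S : smooth_structure R n M}.
Variables (X : vector_field S) (phi : R -> M -> M).
Hypotheses (phi0 : forall q, phi 0 q = q)
  (phiD : forall s t q, phi (s + t) q = phi s (phi t q))
  (phi_icurve : forall t q, icurve_at X (phi^~ q) t).
Implicit Types (c : chart R n M) (p q : M) (x y : 'rV[R]_n).

Lemma phiNK t q : phi (- t) (phi t q) = q.
Proof. by rewrite -phiD addNr phi0. Qed.

Lemma phiKN t q : phi t (phi (- t) q) = q.
Proof. by rewrite -phiD addrN phi0. Qed.

Lemma phi_local c x k (e d C : R) psi : atlas S c ->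
  local_flow (chart_img c) (X c) x k e d C psi ->
  forall (s : R) y, ball x d y -> chart_img c y -> `|s| < e ->
    phi s (chart_inv c y) = chart_inv c (psi s y) /\ chart_img c (psi s y).
Proof.
move=> Sc [e0 d0 H _ _] s y yb yc se.
have [_ psy _ _] := H y s yb se; split=> //.
apply: (@icurve_unique _ _ _ _ X (phi^~ (chart_inv c y)) (fun s => chart_inv c (psi s y)) (- e) e 0).
- by rewrite oppr_lt0 e0.
- move=> r; rewrite -ltr_norml => re; have [_ h1 h2 _] := H y r yb re.
  by split; [exact: phi_icurve|exact: icurve_at_inv].
- have z0 : `|(0 : R)| < e by rewrite normr0.
  by have [-> _ _ _] := H y 0 yb z0.
- by rewrite -ltr_norml.
Qed.

(** The order [k] is fixed because the existence time of [local_flow] depends on it. *)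
Definition smooth_flow_at k (t : R) p : Prop := forall c d, atlas S c -> atlas S d ->
  chart_dom c p -> chart_dom d (phi t p) ->
  exists W : set 'rV[R]_n, [/\ open W, W (c p), W `<=` chart_img c,
    forall y, W y -> chart_dom d (phi t (chart_inv c y)) &
    forall j, Ck k W (fun y => d (phi t (chart_inv c y)) 0 j)].

Lemma smooth_flow_local k p : exists (e : R) (N : set M), [/\ 0 < e, nbhs p N &
  forall (t : R) q, `|t| < e -> N q -> smooth_flow_at k t q].
Proof.
pose c0 := chart_at S p.
have Sc0 : atlas S c0 := chart_at_atlas S _.
have pc0 : chart_dom c0 p := chart_at_dom S _.
have [e [dl [C [psi HF]]]] :=
  local_flow_exists k (@chart_img_open _ _ _ c0) (vf_smooth X Sc0) (chart_map_img pc0).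
have [e0 dl0 _ Cpsi _] := HF.
exists e, (chart_dom c0 `&` c0 @^-1` ball (c0 p) dl); split=> //.
  apply: filterI; first exact: nbhs_chart_dom.
  by apply: (chart_map_cvg pc0); exact: nbhsx_ballx.
move=> t q te [qc0 qb] c d Sc Sd qc qd.
have ob : open (ball (c0 p) dl) by exact: ball_open.
pose W2 := overlap c c0 `&` transition c c0 @^-1` ball (c0 p) dl.
have C1 l j : Ck l (overlap c c0) (fun y => transition c c0 y 0 j).
  exact: smooth_rV_Ck (transition_smooth Sc Sc0).
have oW2 : open W2 by apply: open_preimage_C0 => //; exact: overlap_open.
have C2 j : Ck k W2 (fun y => psi t (transition c c0 y) 0 j).
  apply: (@Ck_comp _ _ _ _ _ (ball (c0 p) dl) (fun z => psi t z 0 j)) => //.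
  - by move=> y [].
  - by move=> l; apply: (Ck_sub _ (C1 k l)) => y [].
  - exact: Cpsi.
pose W3 := W2 `&` (fun y => psi t (transition c c0 y)) @^-1` overlap c0 d.
have oW3 : open W3.
  apply: open_preimage_C0 => //; first exact: overlap_open.
  by move=> j; apply: (Ck_le _ (C2 j)).
have E y : W2 y -> phi t (chart_inv c y) = chart_inv c0 (psi t (transition c c0 y)) /\
    chart_img c0 (psi t (transition c c0 y)).
  move=> [[yc yc0] yb].
  have yi : chart_img c0 (transition c c0 y) by exact: chart_map_img.
  by have := phi_local Sc0 HF yb yi te; rewrite /transition/= chart_mapK.
have [qo qE] := overlap_chart qc qc0.
have W2q : W2 (c q) by split=> //=; rewrite qE.
exists W3; split=> //.
- split=> //; have [E1 E2] := E _ W2q; split=> //=.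
  by rewrite -E1 chart_mapK.
- by move=> y [[[]]].
- by move=> y [W2y [_ yd]]; have [-> _] := E _ W2y.
- move=> j; apply: (@Ck_eq _ _ _ _ (fun y => transition c0 d (psi t (transition c c0 y)) 0 j)) => //.
    by move=> y [W2y _]; rewrite /transition/=; have [-> _] := E _ W2y.
  apply: (@Ck_comp _ _ _ _ _ (overlap c0 d) (fun z => transition c0 d z 0 j)
     (fun y => psi t (transition c c0 y))) => //.
  + exact: overlap_open.
  + by move=> y [].
  + by move=> l; apply: (Ck_sub _ (C2 l)) => y [].
  + exact: smooth_rV_Ck (transition_smooth Sc0 Sd).
Qed.

Lemma smooth_flow_comp k s t p : smooth_flow_at k s p -> smooth_flow_at k t (phi s p) ->
  smooth_flow_at k (t + s) p.
Proof.
move=> Hs Ht c d Sc Sd pc pd.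
pose e := chart_at S (phi s p).
have Se : atlas S e := chart_at_atlas S _.
have pe : chart_dom e (phi s p) := chart_at_dom S _.
have [W1 [oW1 W1p W1c W1e CW1]] := Hs c e Sc Se pc pe.
rewrite phiD in pd.
have [W2 [oW2 W2p W2e W2d CW2]] := Ht e d Se Sd pe pd.
pose G y := e (phi s (chart_inv c y)).
have oW : open (W1 `&` G @^-1` W2).
  by apply: open_preimage_C0 => // j; apply: (Ck_le _ (CW1 j)).
exists (W1 `&` G @^-1` W2); split=> //.
- by split=> //=; rewrite /G chart_mapK.
- by move=> y [/W1c].
- move=> y [W1y W2y]; rewrite phiD; have := W2d _ W2y.
  by rewrite /G chart_mapK//; exact: W1e.
- move=> j; apply: (@Ck_eq _ _ _ _ (fun y => d (phi t (chart_inv e (G y))) 0 j)) => //.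
    by move=> y [W1y _]; rewrite phiD /G chart_mapK//; exact: W1e.
  apply: (@Ck_comp _ _ _ _ _ W2 (fun z => d (phi t (chart_inv e z)) 0 j) G) => //.
  + by move=> y [].
  + by move=> l; apply: (Ck_sub _ (CW1 l)) => y [].
Qed.

(** The orbit of [p] is cut into times so short that local flows of order [k] cover them, and the
    pieces are composed. *)
Lemma smooth_flow k t p : smooth_flow_at k t p.
Proof.
(* Flows in both time directions are carried along, since the chain runs upwards while [t] may be
   negative. *)
pose P s u := smooth_flow_at k (u - s) (phi s p) /\ smooth_flow_at k (s - u) (phi u p).
have H (a b : R) : a <= b -> P a b.
  move=> ab; apply: interval_chain => // [x _|s u v _ _ _ _].
    have [e [N [e0 pN HN]]] := smooth_flow_local k (phi x p).
    have [cp _] := phi_icurve x p.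
    have [d /= d0 Hd] := iffLR (nbhs_ballP _ _) (cp _ pN).
    have m0 : 0 < Num.min d (e / 2) by rewrite lt_min d0 divr_gt0.
    exists (Num.min d (e / 2)) => // s u _ _ _; rewrite !lt_min => /andP[sd se] /andP[ud ue].
    have su : `|u - s| < e.
      rewrite (_ : u - s = (u - x) - (s - x)); last by ring.
      by apply: (le_lt_trans (ler_normB _ _)); lra.
    have sN : N (phi s p) by apply: Hd; rewrite -ball_normE/= distrC.
    have uN : N (phi u p) by apply: Hd; rewrite -ball_normE/= distrC.
    by split; apply: HN => //; rewrite distrC.
  move=> [h1 h2] [h3 h4]; split.
    rewrite (_ : v - s = (v - u) + (u - s)); last by ring.
    by apply: smooth_flow_comp => //; rewrite -phiD subrK.
  rewrite (_ : s - v = (s - u) + (u - v)); last by ring.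
  by apply: smooth_flow_comp => //; rewrite -phiD subrK.
have [t0|t0] := leP 0 t.
  by have [+ _] := H 0 t t0; rewrite subr0 phi0.
by have [_] := H t 0 (ltW t0); rewrite subr0 phi0.
Qed.

Lemma flow_continuous t : continuous (phi t).
Proof.
move=> p.
pose c := chart_at S p; pose d := chart_at S (phi t p).
have Sc : atlas S c := chart_at_atlas S _.
have pc : chart_dom c p := chart_at_dom S _.
have Sd : atlas S d := chart_at_atlas S _.
have pd : chart_dom d (phi t p) := chart_at_dom S _.
have [W [oW Wp Wc Wd CW]] := @smooth_flow 0 t p _ _ Sc Sd pc pd.
pose G y := d (phi t (chart_inv c y)).
have cG : {for c p, continuous G}.
  by apply: (@row_cvgP _ _ _ (nbhs (c p)) _ G) => j; exact: (Ck_cont (CW j)).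
have Gp : chart_inv d (G (c p)) = phi t p by rewrite /G chart_mapK// chart_mapK.
have cH : {for p, continuous (chart_inv d \o (G \o c))}.
  apply: continuous_comp.
    by apply: continuous_comp => //; exact: chart_map_cvg.
  by apply: chart_inv_cvg; apply: chart_map_img; exact: Wd.
move=> A; rewrite -Gp => /cH /=.
have N : nbhs p (chart_dom c `&` c @^-1` W).
  apply: filterI; first exact: nbhs_chart_dom.
  by apply: (chart_map_cvg pc); apply: open_nbhs_nbhs; split.
apply: filterS2 N => q [qc Wq] /=.
have := Wd _ Wq; rewrite chart_mapK// => qd.
by rewrite /G chart_mapK// chart_mapK.
Qed.

Section FlowChart.
Variables (c : chart R n M) (t : R).

Let fdom := phi (- t) @^-1` chart_dom c.

Fact flow_chart_dom_open : open fdom.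
Proof.
by apply: open_comp; [move=> q _; exact: flow_continuous|exact: chart_dom_open].
Qed.

Fact flow_chart_map_img p : fdom p -> chart_img c (c (phi (- t) p)).
Proof. exact: chart_map_img. Qed.

Fact flow_chart_inv_dom x : chart_img c x -> fdom (phi t (chart_inv c x)).
Proof. by move=> xc; rewrite /fdom /= phiNK; exact: chart_inv_dom. Qed.

Fact flow_chart_mapK p : fdom p -> phi t (chart_inv c (c (phi (- t) p))) = p.
Proof. by move=> pc; rewrite chart_mapK// phiKN. Qed.

Fact flow_chart_invK x : chart_img c x -> c (phi (- t) (phi t (chart_inv c x))) = x.
Proof. by move=> xc; rewrite phiNK chart_invK. Qed.

Fact flow_chart_map_continuous : {in fdom, continuous (fun p => c (phi (- t) p))}.
Proof.
move=> p; rewrite inE => pc.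
apply: (@continuous_comp _ _ _ (phi (- t)) c); first exact: flow_continuous.
exact: chart_map_cvg.
Qed.

Fact flow_chart_inv_continuous : {in chart_img c, continuous (fun x => phi t (chart_inv c x))}.
Proof.
move=> x; rewrite inE => xc.
apply: (@continuous_comp _ _ _ (chart_inv c) (phi t)); first exact: chart_inv_cvg.
exact: flow_continuous.
Qed.

(* The chart c transported by the flow: its coordinates at phi_t q are those of c at q. *)
Definition flow_chart : chart R n M :=
  Chart flow_chart_dom_open (@chart_img_open _ _ _ c) flow_chart_map_img flow_chart_inv_dom
    flow_chart_mapK flow_chart_invK flow_chart_map_continuous flow_chart_inv_continuous.

(** By maximality of the atlas it suffices that the transitions to and from every chart are smooth;
    these are the coordinate expressions of [phi (- t)] and [phi t]. *)
Lemma flow_chart_atlas : atlas S c -> atlas S flow_chart.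
Proof.
move=> Sc; apply: atlas_maximal => d Sd; split=> j; apply/smooth_CkP => k; apply: Ck_local.
  move=> y [/= yc yd].
  have [|W [oW Wy Wc Wd CW]] := @smooth_flow k t _ _ _ Sc Sd (chart_inv_dom yc) _; first exact: yd.
  by exists W; [rewrite chart_invK in Wy|exact: CW].
move=> y [/= yd yc].
have [|W [oW Wy Wc Wd CW]] := @smooth_flow k (- t) _ _ _ Sd Sc (chart_inv_dom yd) _; first exact: yc.
by exists W; [rewrite chart_invK in Wy|exact: CW].
Qed.

(** A field is invariant under its own flow: both sides are the velocity at time 0 of the same
    coordinate curve, the one of [c (phi s q)]. *)
Lemma vf_flow_chart x : atlas S c -> chart_img c x -> X flow_chart x = X c x.
Proof.
move=> Sc xc; set q := chart_inv c x.
have qc : chart_dom c q := chart_inv_dom xc.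
have [_ H1] := phi_icurve 0 q.
have [_ H2] := phi_icurve 0 (phi t q).
have := H1 c Sc; rewrite phi0 => /(_ qc); rewrite [c q]chart_invK// => -[_ <-].
have := H2 flow_chart (flow_chart_atlas Sc); rewrite phi0.
have qf : fdom (phi t q) by rewrite /fdom /= phiNK.
move=> /(_ qf) /=; rewrite phiNK [c q]chart_invK// => -[_ <-].
set f1 := (fun s : R => _); set f2 := (fun s : R => _).
suff -> : f1 = f2 by [].
by apply/funext => s; rewrite /f1 /f2 -!phiD addrAC addNr add0r.
Qed.

End FlowChart.

(** The Lie derivative of the metric along [F], in coordinates. *)
Definition lie_metric (G : 'rV[R]_n -> 'M[R]_n) (F : 'rV[R]_n -> 'rV[R]_n) x : 'M[R]_n :=
  \matrix_(i, j) (\sum_k partial i (fun y => F y 0 k) x * G x k j +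
    \sum_m F x 0 m * partial m (fun y => G y i j) x +
    \sum_l G x i l * partial j (fun y => F y 0 l) x).

(** The transition from the chart at time [t + s] to the one at time [t] is the local flow at time
    [s]. The metric in the former is thus a pullback, and its derivative at [s = 0] follows from the
    variational equation. *)
Lemma is_derive_metric_flow_chart (g : riemannian_metric S) c t x i j :
  atlas S c -> chart_img c x ->
  is_derive (0 : R) (1 : R) (fun s => g (flow_chart c (t + s)) x i j)
    (lie_metric (g (flow_chart c t)) (X c) x i j).
Proof.
move=> Sc xc.
have [e [dl [C [psi HF]]]] := local_flow_exists 1 (@chart_img_open _ _ _ c) (vf_smooth X Sc) xc.
have [e0 dl0 H Cpsi D] := HF.
have xb : ball x dl x by exact: ballxx.
have z0 : `|(0 : R)| < e by rewrite normr0.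
set ct := flow_chart c t; have Sct : atlas S ct := flow_chart_atlas t Sc.
pose a i k (s : R) := partial i (fun y => psi s y 0 k) x.
have ob : open (ball x dl) by exact: ball_open.
have oc : open (chart_img c) by exact: chart_img_open.
(* The Jacobian of the flow at time 0 is the identity. *)
have a0 i' k : a i' k 0 = (i' == k)%:R.
  rewrite /a /partial (@near_eq_derive _ _ _ _ (fun y : 'rV_n => y 0 k)).
    by have [_] := is_derive_coord i' k x.
  have : nbhs x (ball x dl) by apply: open_nbhs_nbhs; split.
  by apply: filterS => y yb; have [-> _ _ _] := H y 0 yb z0.
have E s : `|s| < e -> g (flow_chart c (t + s)) x i j =
    \sum_l (\sum_k a i k s * g ct (psi s x) k l) * a j l s.
  move=> se.
  have Scts : atlas S (flow_chart c (t + s)) by exact: flow_chart_atlas.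
  have tE y : ball x dl y -> chart_img c y ->
      overlap (flow_chart c (t + s)) ct y /\ transition (flow_chart c (t + s)) ct y = psi s y.
    move=> yb yc; have [E1 E2] := phi_local Sc HF yb yc se.
    rewrite /overlap /transition /= -phiD addrA addNr add0r E1.
    rewrite chart_invK//; split=> //; split=> //=.
    exact: chart_inv_dom.
  have [xo tx] := tE x xb xc.
  rewrite (metric_change g Scts Sct xo) tx [LHS]mxE; apply: eq_bigr => l _; rewrite [X in _ * X]mxE [X in X * _]mxE.
  have dt := transition_diff Scts Sct xo.
  have nE k : \forall y \near x, transition (flow_chart c (t + s)) ct y 0 k = psi s y 0 k.
    have : nbhs x (ball x dl `&` chart_img c) by apply: open_nbhs_nbhs; split => //; exact: openI.
    by apply: filterS => y [yb yc]; have [_ ->] := tE y yb yc.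
  congr (_ * _); last by rewrite jacobianE// /a /partial (near_eq_derive _ (nE l)).
  by apply: eq_bigr => k _; rewrite jacobianE// /a /partial (near_eq_derive _ (nE k)).
have CG k l : Ck 1 (chart_img c) (fun y => g ct y k l).
  by have /smooth_CkP := metric_smooth g Sct k l; exact.
have da i' k : is_derive (0 : R) (1 : R) (a i' k) (partial i' (fun y => X c y 0 k) x).
  by apply: D.
have [psi0 _ dpsi _] := H x 0 xb z0.
have dG k l : is_derive (0 : R) (1 : R) (fun s => g ct (psi s x) k l)
    (\sum_m X c x 0 m * partial m (fun y => g ct y k l) x).
  have Dg : differentiable (fun y => g ct y k l) (psi 0 x).
    by rewrite psi0; exact: Ck_differentiable oc (CG k l) xc.
  by have := is_derive_comp_partial Dg dpsi; rewrite psi0.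
have := is_derive_bigsum (index_enum 'I_n) (fun l => is_deriveM
  (is_derive_bigsum (index_enum 'I_n) (fun k => is_deriveM (da i k) (dG k l))) (da j l)).
move=> DD.
have -> : lie_metric (g ct) (X c) x i j = \sum_l ((\sum_k a i k 0 * g ct (psi 0 x) k l) *:
    partial j (fun y => X c y 0 l) x + a j l 0 *: \sum_k (a i k 0 *: \sum_m X c x 0 m *
      partial m (fun y => g ct y k l) x + g ct (psi 0 x) k l *: partial i (fun y => X c y 0 k) x)).
  rewrite mxE psi0.
  under [RHS]eq_bigr => l _ do rewrite a0 (eq_bigr _ (fun k _ => congr1 (fun r => r * _) (a0 i k))) sum_delta.
  rewrite big_split/= sum_delta addrC; congr (_ + _).
  rewrite big_split/= (eq_bigr _ (fun k _ => congr1 (fun r => r *: _) (a0 i k))) sum_delta addrC.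
  by congr (_ + _); apply: eq_bigr => k _; rewrite mulrC.
apply: (near_eq_is_derive _ DD).
have : nbhs (0 : R) (fun s => `|s| < e).
  by apply/nbhs_ballP; exists e => // s; rewrite -ball_normE/= sub0r normrN.
apply: filterS => s se; rewrite E//; apply: eq_bigr => l _; congr (_ * _).
Qed.

End FlowSmoothness.

(** * Closed conformal fields in coordinates *)

Lemma row_sub_rearrange {R : realType} {n} (v P Q : 'rV[R]_n) k p q s t :
  p - s - (v - P) 0 k = q - t - (v - Q) 0 k -> s - t + Q 0 k - P 0 k = p - q.
Proof. by rewrite !mxE => E; lra. Qed.

Lemma is_derive_inv {R : realType} {V : normedModType R} (f : V -> R) x v d : f x != 0 ->
  is_derive x v f d -> is_derive x v (fun y => (f y)^-1) (- (f x) ^- 2 * d).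
Proof.
move=> f0 [fD <-]; split; first exact: derivableV.
exact: deriveV.
Qed.

Section BilinMul.
Context {R : realType} {n : nat}.
Implicit Types (A G : 'M[R]_n) (v w : 'rV[R]_n).

Lemma bilinDm A G v w : bilin (A + G) v w = bilin A v w + bilin G v w.
Proof. by rewrite /bilin mulmxDr mulmxDl mxE. Qed.

Lemma bilin_mull A G v w : bilin G (v *m A) w = bilin (A *m G) v w.
Proof. by rewrite /bilin mulmxA. Qed.

Lemma bilin_mulr A G v w : bilin G v (w *m A) = bilin (G *m A^T) v w.
Proof. by rewrite /bilin trmx_mul !mulmxA. Qed.

Lemma bilin_delta G v m : bilin G v ('e_m) = (v *m G) 0 m.
Proof. by rewrite /bilin trmx_delta -colE mxE. Qed.

End BilinMul.

Section CovariantDerivative.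
Context {R : realType} {n : nat}.
Implicit Types (G : 'rV[R]_n -> 'M[R]_n) (X Y : 'rV[R]_n -> 'rV[R]_n) (x : 'rV[R]_n).

Definition christoffel_mx G i x : 'M[R]_n := \matrix_(j, k) christoffel G k i j x.

(** Row [i] is the covariant derivative of [Y] along [e_i], so that [nabla] becomes a matrix
    product. *)
Definition covariant_mx G Y x : 'M[R]_n := \matrix_(i, k)
  (partial i (fun y => Y y 0 k) x + \sum_j christoffel G k i j x * Y x 0 j).

Lemma nabla_covariant_mx G X Y x : nabla G X Y x = X x *m covariant_mx G Y x.
Proof.
apply/rowP => k; rewrite !mxE -big_split/=; apply: eq_bigr => i _.
rewrite mxE mulrDr; congr (_ + _); rewrite mulr_sumr; apply: eq_bigr => j _.
by rewrite mulrAC mulrA [_ * X x 0 i]mulrC mulrA mulrAC.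
Qed.

Lemma partial_cst i (a : R) x : partial i (fun _ : 'rV[R]_n => a) x = 0.
Proof. exact: derive_cst. Qed.

Lemma lie_bracket_cst (v w : 'rV[R]_n) x : lie_bracket (cst v) (cst w) x = 0.
Proof.
by apply/rowP => k; rewrite !mxE big1// => i _; rewrite !partial_cst !mulr0 subrr.
Qed.

Lemma nabla0 G X Y x : X x = 0 -> nabla G X Y x = 0.
Proof. by move=> X0; rewrite nabla_covariant_mx X0 mul0mx. Qed.

Lemma nabla_delta_field G (i : 'I_n) Y x k :
  nabla G (cst ('e_i)) Y x 0 k =
  partial i (fun y => Y y 0 k) x + \sum_j christoffel G k i j x * Y x 0 j.
Proof. by rewrite nabla_covariant_mx -rowE !mxE. Qed.

Lemma nabla_delta G (i j k : 'I_n) x :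
  nabla G (cst ('e_i)) (cst ('e_j)) x 0 k = christoffel G k i j x.
Proof.
rewrite nabla_delta_field partial_cst add0r -[RHS](sum_delta j (fun l => christoffel G k i l x)).
by apply: eq_bigr => l _; rewrite mxE eqxx eq_sym mulrC.
Qed.

Lemma ricciE G x (j k : 'I_n) : ricci G x j k =
  \sum_i (partial i (fun y => christoffel G i j k y) x - partial j (fun y => christoffel G i i k y) x
   + (christoffel_mx G j x *m christoffel_mx G i x) k i
   - (christoffel_mx G i x *m christoffel_mx G j x) k i).
Proof.
rewrite mxE; apply: eq_bigr => i _; rewrite /curvature.
have H a b : nabla G (cst ('e_a)) (nabla G (cst ('e_b)) (cst ('e_k))) x 0 i =
    partial a (fun y => christoffel G i b k y) x + (christoffel_mx G b x *m christoffel_mx G a x) k i.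
  rewrite nabla_delta_field mxE; congr (_ + _).
    by congr (partial _ _ _); apply/funext => y; rewrite nabla_delta.
  by apply: eq_bigr => l _; rewrite nabla_delta !mxE mulrC.
rewrite (_ : ((_ - _ - _) : 'rV[R]_n) 0 i =
  nabla G (cst ('e_i)) (nabla G (cst ('e_j)) (cst ('e_k))) x 0 i -
  nabla G (cst ('e_j)) (nabla G (cst ('e_i)) (cst ('e_k))) x 0 i -
  nabla G (lie_bracket (cst ('e_i)) (cst ('e_j))) (cst ('e_k)) x 0 i); last first.
  by rewrite [LHS]mxE [X in X + _]mxE [X in _ + X + _]mxE [X in _ + X]mxE.
rewrite !H nabla0 ?lie_bracket_cst// [X in _ - X]mxE subr0.
move: (partial i _ x) (partial j _ x) ((_ *m christoffel_mx G i x) k i) => a b e.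
by move: ((_ *m _) k i) => d; ring.
Qed.

Lemma christoffel_Ck G (U : set 'rV[R]_n) k l i j : open U ->
  (forall x, U x -> G x \in unitmx) -> (forall i j, Ck k.+1 U (fun x => G x i j)) ->
  Ck k U (christoffel G l i j).
Proof.
move=> oU Gu CG; apply: (@Ck_eq _ _ _ _ (fun x => \sum_(m < n) 2^-1 * (invmx (G x) l m *
    (partial i (fun y => G y j m) x + partial j (fun y => G y i m) x
     - partial m (fun y => G y i j) x)))) => //.
  by move=> x _; rewrite /christoffel mulr_sumr.
apply: Ck_sum => // m _; apply: CkM => //; first exact: Ck_cst.
apply: CkM => //; first by apply: Ck_invmx => // a b; exact: CkS.
by apply: CkB => //; first apply: CkD => //; exact: Ck_partial.
Qed.

End CovariantDerivative.

Section ConformalCoordinates.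
Context {R : realType} {n : nat}.
Variables (U : set 'rV[R]_n) (G : 'rV[R]_n -> 'M[R]_n) (u : 'rV[R]_n -> 'rV[R]_n) (f : 'rV[R]_n -> R).
Hypotheses (oU : open U) (CG : forall k i j, Ck k U (fun x => G x i j))
  (GT : forall x, U x -> (G x)^T = G x) (Gu : forall x, U x -> G x \in unitmx).
Hypotheses (Cu : forall k j, Ck k U (fun x => u x 0 j)) (Cf : forall k, Ck k U f).
Implicit Types x : 'rV[R]_n.

Let nearU x : U x -> nbhs x U. Proof. by move=> Ux; apply: open_nbhs_nbhs; split. Qed.

Lemma near_GT x : U x -> \forall y \near x, (G y)^T = G y.
Proof. by move=> Ux; apply: filterS (nearU Ux) => y; exact: GT. Qed.

Lemma is_derive_partial k (h : 'rV[R]_n -> R) i x : Ck k.+1 U h -> U x ->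
  is_derive x ('e_i) h (partial i h x).
Proof. by move=> Ch Ux; apply: derivableP; exact: Ck_derivable Ch Ux. Qed.

Lemma partial_metric_mx x m : U x -> \matrix_(i, j) partial m (fun y => G y i j) x =
  christoffel_mx G m x *m G x + G x *m (christoffel_mx G m x)^T.
Proof.
move=> Ux; apply/matrixP => i j; rewrite mxE (christoffel_metric _ _ _ (near_GT Ux) (Gu Ux)).
rewrite big_split !mxE/=; congr (_ + _); apply: eq_bigr => l _; rewrite !mxE//.
by rewrite mulrC.
Qed.

Lemma christoffel_mxC x i j : U x ->
  ('e_j : 'rV[R]_n) *m christoffel_mx G i x = ('e_i : 'rV[R]_n) *m christoffel_mx G j x.
Proof.
move=> Ux; rewrite -!rowE; apply/rowP => k; rewrite !mxE.
exact: christoffel_torsion_free (near_GT Ux).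
Qed.

(* The derivatives of g are absorbed because the connection is metric and torsion-free. *)
Lemma lie_metric_covariant F x : U x ->
  lie_metric G F x = covariant_mx G F x *m G x + G x *m (covariant_mx G F x)^T.
Proof.
move=> Ux; apply/matrixP => i j.
have E m : partial m (fun y => G y i j) x =
   (christoffel_mx G m x *m G x + G x *m (christoffel_mx G m x)^T) i j.
  by rewrite -partial_metric_mx// mxE.
rewrite !mxE; under [X in _ + X + _]eq_bigr => m _ do rewrite E.
have -> : \sum_m F x 0 m * (christoffel_mx G m x *m G x + G x *m (christoffel_mx G m x)^T) i j =
   \sum_k (\sum_m christoffel G k i m x * F x 0 m) * G x k j +
   \sum_k G x i k * (\sum_m christoffel G k j m x * F x 0 m).
  transitivity (\sum_m ((\sum_k christoffel G k i m x * F x 0 m * G x k j) +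
       (\sum_k G x i k * (christoffel G k j m x * F x 0 m)))).
    apply: eq_bigr => m _; rewrite !mxE mulrDr !mulr_sumr; congr (_ + _); apply: eq_bigr => k _;
    by rewrite !mxE (christoffel_torsion_free _ _ m (near_GT Ux)); ring.
  rewrite big_split/= exchange_big/= [X in _ + X = _]exchange_big/=.
  by congr (_ + _); apply: eq_bigr => k _; rewrite ?mulr_suml ?mulr_sumr.
rewrite addrA -[LHS]addrA; congr (_ + _); rewrite -big_split/=; apply: eq_bigr => k _.
  by rewrite mxE mulrDl.
by rewrite !mxE -mulrDr addrC.
Qed.

Lemma is_derive_bilin x m : U x -> is_derive x ('e_m : 'rV[R]_n)
  (fun y => bilin (G y) (u y) (u y))
  (bilin (G x) (\row_k partial m (fun y => u y 0 k) x) (u x) +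
   bilin (\matrix_(i, j) partial m (fun y => G y i j) x) (u x) (u x) +
   bilin (G x) (u x) (\row_k partial m (fun y => u y 0 k) x)).
Proof.
move=> Ux.
have Du i : is_derive x ('e_m : 'rV[R]_n) (fun y => u y 0 i) (partial m (fun y => u y 0 i) x).
  exact: is_derive_partial (Cu 1 i) Ux.
have DG i j : is_derive x ('e_m : 'rV[R]_n) (fun y => G y i j) (partial m (fun y => G y i j) x).
  exact: is_derive_partial (CG 1 i j) Ux.
have := is_derive_bigsum (index_enum 'I_n) (fun i => is_derive_bigsum (index_enum 'I_n) (fun j =>
  is_deriveM (is_deriveM (Du i) (DG i j)) (Du j))).
rewrite (_ : (fun y => \sum_(i <- _) _) = (fun y => bilin (G y) (u y) (u y))); last first.
  by apply/funext => y; rewrite bilinE.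
set d1 := (X in is_derive _ _ _ X -> _); set d2 := (X in _ -> is_derive _ _ _ X).
suff -> : d1 = d2 by [].
rewrite /d1 /d2 !bilinE -!big_split/=; apply: eq_bigr => i _; rewrite -!big_split/=.
by apply: eq_bigr => j _; rewrite !mxE mulrfctE /GRing.scale/=; ring.
Qed.

Hypothesis conformal : forall x, U x -> covariant_mx G u x = (f x)%:M.

Lemma conformal_partial x i k : U x -> partial i (fun y => u y 0 k) x =
  f x * (i == k)%:R - \sum_j christoffel G k i j x * u x 0 j.
Proof.
move=> /conformal /matrixP/(_ i k); rewrite !mxE => E.
by rewrite mulr_natr -E addrK.
Qed.

Lemma conformal_partial_row x i : U x ->
  \row_k partial i (fun y => u y 0 k) x = f x *: 'e_i - u x *m christoffel_mx G i x.
Proof.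
move=> Ux; apply/rowP => k; rewrite !mxE conformal_partial//= eq_sym; congr (_ - _).
by apply: eq_bigr => j _; rewrite !mxE mulrC.
Qed.

(** The derivatives of [G] cancel the Christoffel terms of [u], since the connection is metric. In
    other words the gradient of the squared norm is [2 * f] times [u]. *)
Lemma conformal_partial_sqnorm x m : U x -> is_derive x ('e_m : 'rV[R]_n)
  (fun y => bilin (G y) (u y) (u y)) (2 * f x * (u x *m G x) 0 m).
Proof.
move=> Ux; have := is_derive_bilin m Ux; set d1 := (X in is_derive _ _ _ X -> _).
suff -> : d1 = 2 * f x * (u x *m G x) 0 m by [].
rewrite /d1 partial_metric_mx// conformal_partial_row//.
rewrite (bilinC _ _ (GT Ux)) bilinDm -!bilin_mulr -bilin_mull (bilinC (_ *m _) _ (GT Ux)).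
by rewrite -scaleN1r bilinDr !bilinZr bilin_delta; ring.
Qed.

(** This is R(e_i, e_j) u = (e_i f) e_j - (e_j f) e_i. The conformal equation gives the first
    partials of [u]; differentiating again and exchanging the order leaves it, because the term in
    [f] and the Christoffel symbols is symmetric in [i] and [j]. *)
Lemma conformal_curvature x i j : U x -> forall k,
  \sum_l u x 0 l * (partial i (fun y => christoffel G k j l y) x - partial j (fun y => christoffel G k i l y) x
   + (christoffel_mx G j x *m christoffel_mx G i x) l k
   - (christoffel_mx G i x *m christoffel_mx G j x) l k) =
  partial i f x * (j == k)%:R - partial j f x * (i == k)%:R.
Proof.
move=> Ux k.
have CC l a b : Ck l U (christoffel G k a b) by apply: christoffel_Ck => // *; exact: CG.
have H a b : partial b (partial a (fun y => u y 0 k)) x =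
    partial b f x * (a == k)%:R - \sum_l (partial b (christoffel G k a l) x * u x 0 l) -
    (f x *: ('e_b *m christoffel_mx G a x) - u x *m (christoffel_mx G b x *m christoffel_mx G a x)) 0 k.
  have E : \near x, f x * (a == k)%:R - \sum_j christoffel G k a j x * u x 0 j = partial a (fun y => u y 0 k) x.
    by apply: filterS (nearU Ux) => y Uy; rewrite conformal_partial.
  have Df : is_derive x ('e_b : 'rV[R]_n) f (partial b f x) := is_derive_partial b (Cf 1) Ux.
  have Du l : is_derive x ('e_b : 'rV[R]_n) (fun y => u y 0 l) (partial b (fun y => u y 0 l) x).
    exact: is_derive_partial (Cu 1 l) Ux.
  have DG l : is_derive x ('e_b : 'rV[R]_n) (christoffel G k a l) (partial b (christoffel G k a l) x).
    exact: is_derive_partial (CC 1 a l) Ux.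
  have D1 := is_deriveM Df (is_derive_cst ((a == k)%:R : R) x ('e_b)).
  have D2 := is_derive_bigsum (index_enum 'I_n) (fun l => is_deriveM (DG l) (Du l)).
  have [_ E2] := near_eq_is_derive E (is_deriveB D1 D2).
  apply: etrans E2 _.
  have Eu l : partial b (fun y => u y 0 l) x = (f x *: 'e_b - u x *m christoffel_mx G b x) 0 l.
    by rewrite -conformal_partial_row// mxE.
  have -> : f x *: ('e_b *m christoffel_mx G a x) - u x *m (christoffel_mx G b x *m christoffel_mx G a x)
    = (f x *: 'e_b - u x *m christoffel_mx G b x) *m christoffel_mx G a x.
    by rewrite mulmxBl -scalemxAl mulmxA.
  rewrite scaler0 add0r -[cst _ x]/((a == k)%:R) [(_ *m _) 0 k]mxE -addrA -opprD -big_split/=.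
  rewrite /GRing.scale/= mulrC; congr (_ - _); apply: eq_bigr => l _.
  by rewrite Eu [christoffel_mx G a x l k]mxE; ring.
have H0 := H i j; rewrite (partialC _ _ oU (Cu 2 k) Ux) H in H0.
rewrite (@christoffel_mxC x j i Ux) in H0; move: H0.
set w := _ *: (_ *m _); set A := christoffel_mx G i x; set B := christoffel_mx G j x => H0.
transitivity ((\sum_l partial i (christoffel G k j l) x * u x 0 l) -
   (\sum_l partial j (christoffel G k i l) x * u x 0 l) + (u x *m (B *m A)) 0 k - (u x *m (A *m B)) 0 k).
  rewrite ![(u x *m _) 0 k]mxE -!sumrB -big_split/= -sumrB; apply: eq_bigr => l _.
  move: (partial i _ x) (partial j _ x) ((B *m A) l k) ((A *m B) l k) => a1 b1 a2 b2.
  by ring.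
exact: row_sub_rearrange H0.
Qed.

(** In the trace of [conformal_curvature] one Kronecker symbol sums to 1 and the other to [n]. *)
Lemma conformal_ricci x : U x -> bilin (ricci G x) (u x) (u x) =
  - (n%:R - 1) * \sum_j u x 0 j * partial j f x.
Proof.
move=> Ux; rewrite bilinE mulr_sumr; apply: eq_bigr => j _.
transitivity (u x 0 j * \sum_i \sum_k u x 0 k *
   (partial i (fun y => christoffel G i j k y) x - partial j (fun y => christoffel G i i k y) x
   + (christoffel_mx G j x *m christoffel_mx G i x) k i
   - (christoffel_mx G i x *m christoffel_mx G j x) k i)).
  rewrite exchange_big/= mulr_sumr; apply: eq_bigr => k _; rewrite ricciE -mulrA -mulr_sumr.
  by rewrite [X in _ * X]mulrC.
under eq_bigr => i _ do rewrite conformal_curvature//.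
rewrite sumrB (bigD1 j)//= [X in _ + X - _]big1 => [|i ij]; last by rewrite eq_sym (negPf ij) mulr0.
under [X in _ - X]eq_bigr => i _ do rewrite eqxx mulr1.
by rewrite sumr_const card_ord eqxx mulr1 addr0 -mulr_natr; ring.
Qed.

Section Slowed.
Hypothesis Gpos : forall x v, U x -> v != 0 -> 0 < bilin (G x) v v.
Let h y := bilin (G y) (u y) (u y).
Let F y := (1 + h y)^-1 *: u y.

(** The rank-one term is the derivative of the factor [(1 + h)^-1], by
    [conformal_partial_sqnorm]. *)
Lemma slowed_covariant x : U x -> covariant_mx G F x =
  ((1 + h x)^-1 * f x)%:M - (2 * f x * (1 + h x) ^- 2) *: ((u x *m G x)^T *m u x).
Proof.
move=> Ux; have h0 : 0 <= h x by apply: bilin_ge0 => v; exact: Gpos.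
have h1 : 1 + h x != 0 by rewrite gt_eqF// ltr_pwDl.
apply/matrixP => i k; rewrite [LHS]mxE.
have Da : is_derive x ('e_i : 'rV[R]_n) (fun y => (1 + h y)^-1)
    (- (1 + h x) ^- 2 * (2 * f x * (u x *m G x) 0 i)).
  have D1 := is_deriveD (is_derive_cst (1 : R) x ('e_i)) (conformal_partial_sqnorm i Ux).
  rewrite add0r in D1.
  exact: (@is_derive_inv _ _ (fun y => 1 + h y) x _ _ h1 D1).
have Du : is_derive x ('e_i : 'rV[R]_n) (fun y => u y 0 k) (partial i (fun y => u y 0 k) x).
  exact: is_derive_partial (Cu 1 k) Ux.
have -> : partial i (fun y => F y 0 k) x = (1 + h x)^-1 * partial i (fun y => u y 0 k) x +
    u x 0 k * (- (1 + h x) ^- 2 * (2 * f x * (u x *m G x) 0 i)).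
  rewrite /partial (_ : (fun y => F y 0 k) = (fun y => (1 + h y)^-1 * u y 0 k)).
    by have [_ ->] := is_deriveM Da Du.
  by apply/funext => y; rewrite /F mxE.
rewrite conformal_partial//.
have -> : \sum_j christoffel G k i j x * F x 0 j = (1 + h x)^-1 * \sum_j christoffel G k i j x * u x 0 j.
  by rewrite mulr_sumr; apply: eq_bigr => j _; rewrite /F mxE; ring.
have -> : (((1 + h x)^-1 * f x)%:M - (2 * f x * (1 + h x) ^- 2) *: ((u x *m G x)^T *m u x)) i k =
    (1 + h x)^-1 * f x * (i == k)%:R - (2 * f x * (1 + h x) ^- 2) * ((u x *m G x) 0 i * u x 0 k).
  move: (u x *m G x) => w.
  by rewrite !mxE big_ord1 !mxE mulr_natr.
rewrite -exprVn; move: (\sum_j _) ((u x *m G x) 0 i) => s w.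
ring.
Qed.

(** This trace is twice the divergence; the rank-one term of [slowed_covariant] contributes through
    its trace, a multiple of [h]. *)
Lemma slowed_lie_metric x : U x -> \tr (invmx (G x) *m lie_metric G F x) =
  2 * f x * (1 + h x)^-1 * (n%:R - 2 * h x * (1 + h x)^-1).
Proof.
move=> Ux; rewrite lie_metric_covariant// mulmxDr mxtraceD mulmxA.
rewrite [X in X + _]mxtrace_mulC mulmxA mulmxV ?Gu// mul1mx mulmxA mulVmx ?Gu// mul1mx mxtrace_tr.
rewrite slowed_covariant// raddfB/= mxtrace_scalar linearZ/= mxtrace_mulC trmx_mul GT// mulmxA.
rewrite [\tr (_ *m _)](_ : _ = h x); last by rewrite /mxtrace big_ord1.
by rewrite -mulr_natr /GRing.scale/= -exprVn; ring.
Qed.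

End Slowed.
End ConformalCoordinates.

(** * Monotonicity along the flow *)

(** Every matrix on the segment from the identity to [G] is positive definite, so the determinant
    has no zero on it and keeps the sign of 1. *)
Lemma posdef_det_gt0 {R : realType} {n} (G : 'M[R]_n) : G^T = G ->
  (forall v : 'rV[R]_n, v != 0 -> 0 < bilin G v v) -> 0 < \det G.
Proof.
move=> GT Gpos.
pose N (s : R) : 'M[R]_n := (1 - s) *: 1%:M + s *: G.
have b1 (v : 'rV[R]_n) : v != 0 -> 0 < bilin 1%:M v v.
  move=> v0; rewrite /bilin mulmx1 mxE.
  have [j vj] : exists j, v 0 j != 0.
    by apply/existsP; apply: contraR v0 => /existsPn H; apply/eqP/rowP => j; rewrite mxE; apply/eqP/negbNE/H.
  rewrite (bigD1 j)//= mxE ltr_wpDr ?lt0r ?mulf_neq0//=.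
    by apply: sumr_ge0 => i _; rewrite mxE -expr2 sqr_ge0.
  by rewrite -expr2 sqr_ge0.
have Nu (s : R) : 0 <= s <= 1 -> \det (N s) != 0.
  move=> /andP[s0 s1]; rewrite -unitfE -unitmxE; apply: posdef_unit => v v0.
  have -> : bilin (N s) v v = (1 - s) * bilin 1%:M v v + s * bilin G v v.
    by rewrite /N bilinDm /bilin -!scalemxAr -!scalemxAl !mxE.
  have := b1 v v0; have := Gpos v v0.
  by have [->|sn0] := eqVneq s 0; [lra|have : 0 < s by rewrite lt0r sn0]; nra.
have cN : continuous (fun s => \det (N s)).
  move=> s; apply: continuous_sum => p _; apply: cvgM; first exact: cvg_cst.
  apply: continuous_prod => i _.
  rewrite (_ : (fun s => N s i (p i)) = (fun s => (1 - s) * (1%:M : 'M[R]_n) i (p i) + s * G i (p i))).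
    apply: cvgD; apply: cvgM; try exact: cvg_cst.
      by apply: cvgB; [exact: cvg_cst|exact: cvg_id].
    exact: cvg_id.
  by apply/funext => r; rewrite !mxE.
have N0 : \det (N 0) = 1 by rewrite /N subr0 scale1r scale0r addr0 det1.
have N1 : \det (N 1) = \det G by rewrite /N subrr scale1r scale0r add0r.
rewrite ltNge; apply/negP => G0.
have I : Num.min (\det (N 0)) (\det (N 1)) <= 0 <= Num.max (\det (N 0)) (\det (N 1)).
  by rewrite N0 N1 ge_min G0 orbT le_max ler01.
have [s] := @IVT R (fun s => \det (N s)) 0 1 0 ler01 (continuous_subspaceT cN) I.
by rewrite in_itv/= => /Nu/eqP.
Qed.

Lemma derive_ge_linear {R : realType} (f df : R -> R) (a b k : R) : a <= b ->
  (forall t, a <= t <= b -> is_derive t (1 : R) f (df t) /\ k <= df t) ->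
  f a + k * (b - a) <= f b.
Proof.
move=> ab H.
have [||t t01 E] := @MVT_segment R f df a b ab.
- by move=> t; rewrite in_itv/= => /andP[/ltW a0 /ltW b0]; have [] := H t _; first by rewrite a0.
- apply: derivable_within_continuous => t; rewrite in_itv/= => t01.
  by have [[]] := H t t01.
rewrite in_itv/= in t01; have [_ kt] := H t t01.
rewrite -lerBrDl E; apply: ler_wpM2r => //; lra.
Qed.

Lemma derive_ge0_le {R : realType} (f df : R -> R) (a b : R) : a <= b ->
  (forall t, is_derive t (1 : R) f (df t)) -> (forall t, a <= t <= b -> 0 <= df t) -> f a <= f b.
Proof.
move=> ab D df0; have := @derive_ge_linear R f df a b 0 ab (fun t tab => conj (D t) (df0 t tab)).
by rewrite mul0r addr0.
Qed.

Section ManifoldConformal.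
Context {R : realType} {n : nat} {M : ptopologicalType} {S : smooth_structure R n M}.
Local Notation smooth_fun := (@smooth_function R n M S).
Variable g : riemannian_metric S.
Implicit Types (X : vector_field S) (c d : chart R n M) (p q : M).

Lemma metric_unit c x : atlas S c -> chart_img c x -> g c x \in unitmx.
Proof. by move=> Sc xc; apply: posdef_unit; exact: metric_pos. Qed.

Lemma metric_Ck c k i j : atlas S c -> Ck k (chart_img c) (fun x => g c x i j).
Proof. by move=> Sc; have /smooth_CkP := metric_smooth g Sc i j; exact. Qed.

Lemma vf_Ck X c k j : atlas S c -> Ck k (chart_img c) (fun x => X c x 0 j).
Proof. by move=> Sc; have /smooth_CkP := vf_smooth X Sc j; exact. Qed.

Definition sqnorm X p : R :=
  let c := chart_at S p in bilin (g c (c p)) (X c (c p)) (X c (c p)).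

Lemma sqnorm_chart X c x : atlas S c -> chart_img c x ->
  sqnorm X (chart_inv c x) = bilin (g c x) (X c x) (X c x).
Proof.
move=> Sc xc; rewrite /sqnorm; set p := chart_inv c x; set d := chart_at S p.
have Sd : atlas S d := chart_at_atlas S _.
have pc : chart_dom c p := chart_inv_dom xc.
have [ov E] := overlap_chart pc (chart_at_dom S p : chart_dom d p).
rewrite chart_invK// in ov E.
rewrite -E (vf_change X Sc Sd ov) (metric_change g Sc Sd ov) bilin_mull bilin_mulr.
by rewrite /bilin.
Qed.

Lemma sqnorm_ge0 X p : 0 <= sqnorm X p.
Proof.
set c := chart_at S p; have Sc : atlas S c := chart_at_atlas S _.
apply: bilin_ge0 => v; apply: metric_pos => //.
by apply: chart_map_img; exact: chart_at_dom.
Qed.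

Lemma bilin_Ck (U : set 'rV[R]_n) k (G : 'rV[R]_n -> 'M[R]_n) (u : 'rV[R]_n -> 'rV[R]_n) : open U ->
  (forall i j, Ck k U (fun x => G x i j)) -> (forall j, Ck k U (fun x => u x 0 j)) ->
  Ck k U (fun x => bilin (G x) (u x) (u x)).
Proof.
move=> oU CG Cu; apply: (@Ck_eq _ _ _ _ (fun x => \sum_i \sum_j u x 0 i * G x i j * u x 0 j)) => //.
  by move=> x _; rewrite bilinE.
apply: Ck_sum => // i _; apply: Ck_sum => // j _.
by do 2 apply: CkM => //.
Qed.

Lemma sqnorm_smooth X : smooth_fun (sqnorm X).
Proof.
move=> c Sc; apply/smooth_CkP => k.
apply: (@Ck_eq _ _ _ _ (fun x => bilin (g c x) (X c x) (X c x))).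
- exact: chart_img_open.
- by move=> x xc; rewrite /= sqnorm_chart.
apply: bilin_Ck; first exact: chart_img_open.
  by move=> i j; exact: metric_Ck.
by move=> j; exact: vf_Ck.
Qed.

Section Scaled.
Variables (X : vector_field S) (a : M -> R).
Hypothesis a_smooth : smooth_fun a.

Fact scaled_smooth c : atlas S c -> smooth_rV_on (chart_img c) (scale_field a X c).
Proof.
move=> Sc j; apply/smooth_CkP => k.
have oc : open (chart_img c) by exact: chart_img_open.
apply: (@Ck_eq _ _ _ _ (fun x => (a \o chart_inv c) x * X c x 0 j)) => //.
  by move=> x xc; rewrite /scale_field mxE.
by apply: CkM => //; [have /smooth_CkP := a_smooth Sc; exact|exact: vf_Ck].
Qed.

Fact scaled_change c d : atlas S c -> atlas S d -> forall x, overlap c d x ->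
  scale_field a X d (transition c d x) = scale_field a X c x *m 'J (transition c d) x.
Proof.
move=> Sc Sd x xo; rewrite /scale_field vf_change// scalemxAl.
by case: xo => xc xd; rewrite /transition/= chart_mapK.
Qed.

Definition scaled_field : vector_field S := VectorField scaled_smooth scaled_change.

End Scaled.

Lemma icurve_derive X (gamma : R -> M) (t : R) (h : M -> R) c : smooth_fun h ->
  icurve_at X gamma t -> atlas S c -> chart_dom c (gamma t) ->
  is_derive t (1 : R) (fun s => h (gamma s))
    (\sum_i X c (c (gamma t)) 0 i * partial i (h \o chart_inv c) (c (gamma t))).
Proof.
move=> sh [cg H] Sc tc.
have oc : open (chart_img c) by exact: chart_img_open.
have Dh : differentiable (h \o chart_inv c) (c (gamma t)).
  by have /smooth_CkP/(_ 1) Ch := sh c Sc; exact: Ck_differentiable oc Ch (chart_map_img tc).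
have D := is_derive_comp_partial Dh (H c Sc tc).
apply: near_eq_is_derive D.
have N : nbhs t (gamma @^-1` chart_dom c) by apply: cg; exact: nbhs_chart_dom.
by apply: filterS N => s sc /=; rewrite chart_mapK.
Qed.

Variables (xi : vector_field S) (psi : M -> R).
Hypothesis xi_conformal : closed_conformal g xi psi.

(** The conformal equation quantifies over global fields, so it is tested on bump fields in the
    direction [e_i] at [x]; the positive value of the bump is then divided out. *)
Lemma conformal_covariant c x : atlas S c -> chart_img c x ->
  covariant_mx (g c) (xi c) x = (psi (chart_inv c x))%:M.
Proof.
move=> Sc xc.
have [r /= r0 rc] := iffLR (nbhs_ballP _ _) (nbhs_chart_img xc).
have r20 : 0 < r / 2 by rewrite divr_gt0.
have cr : cball x (r / 2) `<=` chart_img c.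
  move=> y yr; apply: rc; rewrite -ball_normE/= distrC; apply: (le_lt_trans yr); lra.
apply/row_matrixP => i; rewrite !rowE.
have [_ H] := xi_conformal; have := H (bump_field Sc r20 cr ('e_i)) c Sc x xc.
rewrite nabla_covariant_mx /scale_field bump_fieldE// -scalemxAl scalerA.
rewrite [X in X *: 'e_i]mulrC -scalerA mul_mx_scalar.
by apply: scalerI; rewrite gt_eqF// bump_center.
Qed.

Hypothesis gricci : nonpositive_ricci g.

Lemma psi_Ck c k : atlas S c -> Ck k (chart_img c) (psi \o chart_inv c).
Proof. by move=> Sc; have [sp _] := xi_conformal; have /smooth_CkP := sp c Sc; exact. Qed.

Lemma ricci_conformal c x : atlas S c -> chart_img c x ->
  bilin (ricci (g c) x) (xi c x) (xi c x) =
  - (n%:R - 1) * \sum_j xi c x 0 j * partial j (psi \o chart_inv c) x.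
Proof.
move=> Sc xc; apply: (@conformal_ricci _ _ (chart_img c)) => //.
- exact: chart_img_open.
- by move=> k i j; exact: metric_Ck.
- by move=> y yc; exact: Defs.metric_sym.
- by move=> y yc; exact: metric_unit.
- by move=> k j; exact: vf_Ck.
- by move=> k; exact: psi_Ck.
- by move=> y yc; exact: conformal_covariant.
Qed.

Hypothesis n2 : (2 <= n)%N.

Lemma xi_psi_ge0 c x : atlas S c -> chart_img c x ->
  0 <= \sum_j xi c x 0 j * partial j (psi \o chart_inv c) x.
Proof.
move=> Sc xc; have := gricci Sc xc (xi c x); rewrite ricci_conformal//.
rewrite mulNr oppr_le0 pmulr_rge0// subr_gt0.
by rewrite (_ : 1 = 1%:R)// ltr_nat.
Qed.

Lemma partial_sqnorm c x m : atlas S c -> chart_img c x ->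
  partial m (sqnorm xi \o chart_inv c) x = 2 * psi (chart_inv c x) * (xi c x *m g c x) 0 m.
Proof.
move=> Sc xc.
have E : \near x, bilin (g c x) (xi c x) (xi c x) = (sqnorm xi \o chart_inv c) x.
  by apply: filterS (nbhs_chart_img xc) => y yc; rewrite /= sqnorm_chart.
have := @conformal_partial_sqnorm _ _ (chart_img c) (g c) (xi c) (psi \o chart_inv c).
move=> /(_ _ _ _ _ _ _ x m) D.
have [_ <-] : is_derive x ('e_m : 'rV[R]_n) (sqnorm xi \o chart_inv c)
    (2 * psi (chart_inv c x) * (xi c x *m g c x) 0 m); last by [].
apply: near_eq_is_derive E _; apply: D => //.
- exact: chart_img_open.
- by move=> k i j; exact: metric_Ck.
- by move=> y yc; exact: Defs.metric_sym.
- by move=> y yc; exact: metric_unit.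
- by move=> k j; exact: vf_Ck.
- by move=> y yc; exact: conformal_covariant.
Qed.

Definition slowness p : R := (1 + sqnorm xi p)^-1.

Lemma slowness_den p : 0 < 1 + sqnorm xi p.
Proof. by rewrite ltr_pwDl// sqnorm_ge0. Qed.

Lemma slowness_smooth : smooth_fun slowness.
Proof.
move=> c Sc; apply/smooth_CkP => k.
have oc : open (chart_img c) by exact: chart_img_open.
apply: (@CkV _ _ _ _ (fun x => 1 + (sqnorm xi \o chart_inv c) x)) => //.
  by move=> x _; rewrite gt_eqF// slowness_den.
apply: CkD => //; first exact: Ck_cst.
by have /smooth_CkP := sqnorm_smooth xi Sc; exact.
Qed.

Definition slowed_field : vector_field S := scaled_field xi slowness_smooth.

Lemma slowed_bounded c x : atlas S c -> chart_img c x ->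
  bilin (g c x) (slowed_field c x) (slowed_field c x) <= 1.
Proof.
move=> Sc xc; rewrite /= /scale_field bilinZl bilinZr /slowness sqnorm_chart// -sqnorm_chart//.
have h0 := sqnorm_ge0 xi (chart_inv c x); set h := sqnorm _ _ in h0 *.
have h1 : 0 < 1 + h by rewrite ltr_pwDl.
by rewrite mulrA -invfM mulrC ler_pdivrMr ?mulr_gt0// mul1r; nra.
Qed.

Section Flow.
Variable phi : R -> M -> M.
Hypotheses (phi0 : forall q, phi 0 q = q)
  (phiD : forall s t q, phi (s + t) q = phi s (phi t q))
  (phi_icurve : forall t q, icurve_at slowed_field (phi^~ q) t).

Lemma is_derive_flow (h : M -> R) (t : R) q c : smooth_fun h -> atlas S c -> chart_dom c (phi t q) ->
  is_derive t (1 : R) (fun s => h (phi s q))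
    (slowness (phi t q) * \sum_i xi c (c (phi t q)) 0 i * partial i (h \o chart_inv c) (c (phi t q))).
Proof.
move=> sh Sc pc; have := icurve_derive sh (phi_icurve t q) Sc pc.
rewrite mulr_sumr; set x := c _.
rewrite (eq_bigr (fun i => slowness (phi t q) * (xi c x 0 i * partial i (h \o chart_inv c) x)))//.
by move=> i _; rewrite /= /scale_field mxE chart_mapK// mulrA.
Qed.

Lemma psi_flow_nondecreasing (s t : R) q : s <= t -> psi (phi s q) <= psi (phi t q).
Proof.
move=> st; have [sp _] := xi_conformal.
apply: (derive_ge0_le st (fun r => is_derive_flow sp (chart_at_atlas S (phi r q)) (chart_at_dom S _))) => r _.
apply: mulr_ge0; first by rewrite invr_ge0 ltW// slowness_den.
by apply: xi_psi_ge0; [exact: chart_at_atlas|apply: chart_map_img; exact: chart_at_dom].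
Qed.

Lemma is_derive_sqnorm_flow (t : R) q : is_derive t (1 : R) (fun s => sqnorm xi (phi s q))
  (2 * psi (phi t q) * (slowness (phi t q) * sqnorm xi (phi t q))).
Proof.
set c := chart_at S (phi t q); set x := c (phi t q).
have Sc : atlas S c := chart_at_atlas S _.
have pc : chart_dom c (phi t q) := chart_at_dom S _.
have xc : chart_img c x := chart_map_img pc.
have := is_derive_flow (sqnorm_smooth xi) Sc pc.
have -> : \sum_i xi c x 0 i * partial i (sqnorm xi \o chart_inv c) x =
   2 * psi (phi t q) * sqnorm xi (phi t q).
  transitivity (2 * psi (phi t q) * \sum_i (xi c x *m g c x) 0 i * xi c x 0 i).
    rewrite mulr_sumr; apply: eq_bigr => i _; rewrite partial_sqnorm// chart_mapK//.
    by rewrite mulrC -!mulrA.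
  congr (_ * _); rewrite -[in RHS](chart_mapK pc) sqnorm_chart// /bilin mxE.
  by apply: eq_bigr => i _; rewrite -/x [_^T _ _]mxE.
by rewrite mulrCA mulrA.
Qed.

(** Along the flow [psi] stays above [K] and the squared norm above [B], and s / (1 + s) is
    increasing in s, so the derivative of the squared norm is at least the stated rate. *)
Lemma sqnorm_flow_growth q (K B t : R) : 0 <= t -> 0 <= K -> 0 <= B ->
  K <= psi q -> B <= sqnorm xi q ->
  sqnorm xi q + 2 * K * (B / (1 + B)) * t <= sqnorm xi (phi t q).
Proof.
move=> t0 K0 B0 Kq Bq.
have psi_ge s : 0 <= s -> K <= psi (phi s q).
  by move=> s0; apply: (le_trans Kq); rewrite -[in leLHS](phi0 q); exact: psi_flow_nondecreasing.
have r0 p : 0 <= slowness p * sqnorm xi p.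
  by apply: mulr_ge0; [rewrite invr_ge0 ltW// slowness_den|exact: sqnorm_ge0].
have mono s : 0 <= s -> B <= sqnorm xi (phi s q).
  move=> s0; apply: (le_trans Bq).
  rewrite -[in leLHS](phi0 q).
  apply: (derive_ge0_le s0 (fun r => is_derive_sqnorm_flow r q)) => r /andP[rr _].
  by apply: mulr_ge0 => //; apply: mulr_ge0 => //; apply: le_trans K0 (psi_ge r rr).
have H r : 0 <= r <= t -> is_derive r (1 : R) (fun s => sqnorm xi (phi s q))
     (2 * psi (phi r q) * (slowness (phi r q) * sqnorm xi (phi r q))) /\
     2 * K * (B / (1 + B)) <= 2 * psi (phi r q) * (slowness (phi r q) * sqnorm xi (phi r q)).
  move=> /andP[rr _]; split; first exact: is_derive_sqnorm_flow.
  have b0 : 0 <= B / (1 + B) by apply: divr_ge0 => //; lra.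
  apply: ler_pM => //; first by apply: mulr_ge0.
    by apply: ler_wpM2l => //; exact: psi_ge.
  have := mono r rr; rewrite /slowness; set h := sqnorm _ _ => Bh.
  have B1 : 0 < 1 + B by lra.
  have h1 : 0 < 1 + h by lra.
  by rewrite ler_pdivrMr// [_^-1 * h]mulrC mulrAC ler_pdivlMr//; nra.
by have := derive_ge_linear t0 H; rewrite phi0 subr0.
Qed.

Lemma lie_metric_near (G : 'rV[R]_n -> 'M[R]_n) (F F' : 'rV[R]_n -> 'rV[R]_n) x :
  (\near x, F x = F' x) -> lie_metric G F x = lie_metric G F' x.
Proof.
move=> E; have Ex := nbhs_singleton E.
have P i k : partial i (fun y => F y 0 k) x = partial i (fun y => F' y 0 k) x.
  by apply: near_eq_derive; apply: filterS E => y ->.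
apply/matrixP => i j; rewrite !mxE; congr (_ + _ + _); apply: eq_bigr => k _; by rewrite ?P ?Ex.
Qed.

Let fchart c t := flow_chart phi0 phiD phi_icurve c t.

Lemma trace_lie_slowed c x t : atlas S c -> chart_img c x -> 0 <= psi (phi t (chart_inv c x)) ->
  0 <= \tr (invmx (g (fchart c t) x) *m lie_metric (g (fchart c t)) (slowed_field c) x).
Proof.
move=> Sc xc p0; set ct := fchart c t.
have Sct : atlas S ct by exact: flow_chart_atlas.
have xct : chart_img ct x by [].
have oct : open (chart_img ct) by exact: chart_img_open.
(* The slowed field has the same components in [c] and in the transported chart, where the conformal
   equation can be used. *)
rewrite (@lie_metric_near _ _ (fun y => (1 + bilin (g ct y) (xi ct y) (xi ct y))^-1 *: xi ct y)); last first.
  apply: filterS (nbhs_chart_img xc) => y yc.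
  have <- := vf_flow_chart phi0 phiD phi_icurve t Sc yc.
  by rewrite -/(fchart c t) -/ct /= /scale_field /slowness sqnorm_chart.
rewrite (@slowed_lie_metric _ _ (chart_img ct) _ _ (psi \o chart_inv ct)) //; first last.
- by move=> y v yc; exact: metric_pos.
- by move=> y yc; exact: conformal_covariant.
- by move=> k j; exact: vf_Ck.
- by move=> y yc; exact: metric_unit.
- by move=> y yc; exact: Defs.metric_sym.
- by move=> k i j; exact: metric_Ck.
rewrite -sqnorm_chart//; have h0 := sqnorm_ge0 xi (chart_inv ct x); set h := sqnorm _ _ in h0 *.
have h1 : 0 < 1 + h by lra.
apply: mulr_ge0; first by apply: mulr_ge0; [apply: mulr_ge0|rewrite invr_ge0 ltW].
rewrite subr_ge0 ler_pdivrMr//.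
have : 2 <= n%:R :> R by rewrite (ler_nat _ 2).
nra.
Qed.

(** At a fixed coordinate point Jacobi's formula gives the derivative in time as the determinant
    times the trace of the Lie derivative, both nonnegative as [psi] stays nonnegative along the
    flow. *)
Lemma det_flow_nondecreasing c x t : atlas S c -> chart_img c x -> 0 <= psi (chart_inv c x) ->
  0 <= t -> \det (g (fchart c 0) x) <= \det (g (fchart c t) x).
Proof.
move=> Sc xc p0 t0.
have D (r : R) : is_derive r (1 : R) (fun s => \det (g (fchart c s) x))
    (\det (g (fchart c r) x) * \tr (invmx (g (fchart c r) x) *m lie_metric (g (fchart c r)) (slowed_field c) x)).
  have Scr : atlas S (fchart c r) by exact: flow_chart_atlas.
  have H := @is_derive_det R R n (fun s => g (fchart c (r + s)) x) (lie_metric (g (fchart c r)) (slowed_field c) x)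
     0 1 (fun i j => is_derive_metric_flow_chart phi0 phiD phi_icurve g r i j Sc xc).
  rewrite addr0 in H; have {}H := H (metric_unit Scr xc).
  have -> : (fun s => \det (g (fchart c s) x)) = (fun s => \det (g (fchart c (r + (s - r))) x)).
    by apply/funext => s; rewrite addrC subrK.
  apply: (@is_derive_translate _ _ _ (fun y => \det (g (fchart c (r + y)) x))).
  by rewrite subrr.
apply: (derive_ge0_le t0 D) => r /andP[r0 _].
apply: mulr_ge0.
  have Scr : atlas S (fchart c r) by exact: flow_chart_atlas.
  by apply/ltW/posdef_det_gt0; [exact: Defs.metric_sym|move=> v; exact: metric_pos].
apply: trace_lie_slowed => //.
by apply: (le_trans p0); rewrite -[leLHS](congr1 psi (phi0 _)); exact: psi_flow_nondecreasing.
Qed.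

End Flow.
End ManifoldConformal.

(** * Volume of the flowed-out sets *)

Section UnmeasuredIntegral.
Local Open Scope ereal_scope.

(* The integral of a nonnegative function is a supremum over simple functions,
   so monotonicity needs no measurability. *)
Lemma ge0_le_integralT {d : measure_display} {T : measurableType d} {R : realType}
    (mu : {measure set T -> \bar R}) (f h : T -> \bar R) :
  (forall x, 0 <= f x) -> (forall x, f x <= h x) -> \int[mu]_x f x <= \int[mu]_x h x.
Proof.
move=> f0 fh; rewrite !ge0_integralE//; last by move=> x _; exact: le_trans (f0 x) (fh x).
apply: le_ereal_sup => _ [s sf <-]; exists s => // x.
by apply: (le_trans (sf x)); rewrite !patch_setT; exact: fh.
Qed.

Lemma integral_ge_cst {d : measure_display} {T : measurableType d} {R : realType}
    (mu : {measure set T -> \bar R}) (A : set T) (f : T -> \bar R) (k : R) :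
  measurable A -> (0 <= k)%R -> (forall x, 0 <= f x) -> (forall x, A x -> k%:E <= f x) ->
  k%:E * mu A <= \int[mu]_x f x.
Proof.
move=> mA k0 f0 Af; rewrite -(integral_cst mu mA) integral_mkcond.
apply: ge0_le_integralT => x; rewrite /patch; case: ifPn => //=; rewrite inE.
exact: Af.
Qed.

Lemma integral_disjoint_unbounded {d : measure_display} {T : measurableType d} {R : realType}
    (mu : {measure set T -> \bar R}) (A : nat -> set T) (f : T -> \bar R) (k m : R) :
  (forall i, measurable (A i)) -> trivIset setT A -> (0 < k)%R -> (0 < m)%R ->
  (forall x, 0 <= f x) -> (forall i x, A i x -> k%:E <= f x) -> (forall i, m%:E <= mu (A i)) ->
  \int[mu]_x f x = +oo.
Proof.
move=> mA tA k0 m0 f0 Af Am; apply/eqyP => r r0.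
have [N rN] : exists N : nat, (r <= k * (N%:R * m))%R.
  exists (Num.truncn (r / (k * m))).+1.
  rewrite mulrCA -ler_pdivrMr ?mulr_gt0//; apply/ltW/truncnS_gt.
apply: (@le_trans _ _ (k%:E * mu (\big[setU/set0]_(i < N) A i))); last first.
  apply: integral_ge_cst => //; [exact: bigsetU_measurable|exact: ltW|].
  by move=> x; rewrite -bigcup_mkord => -[i _ /Af].
apply: (@le_trans _ _ (k%:E * (N%:R * m)%:E)); first by rewrite -EFinM lee_fin.
rewrite lee_wpmul2l ?lee_fin ?(ltW k0)// measure_bigsetU//.
have -> : (N%:R * m)%:E = \sum_(i < N) m%:E by rewrite sumEFin sumr_const card_ord mulr_natl.
by apply: lee_sum => i _; exact: Am.
Qed.

Lemma integral_rV_ge0 {R : realType} n (f : 'rV[R]_n -> \bar R) :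
  (forall x, 0 <= f x) -> 0 <= integral_rV f.
Proof.
elim: n f => [|n IH] f f0 /=; first exact: f0.
by apply: integral_ge0 => t _; exact: IH.
Qed.

(** The maximum-norm ball is a cube, so the iterated integral gains a factor [r *+ 2] per
    coordinate. *)
Lemma integral_rV_ge_cube {R : realType} n (f : 'rV[R]_n -> \bar R) (x : 'rV[R]_n) (r m : R) :
  (0 < r)%R -> (0 <= m)%R -> (forall y, 0 <= f y) ->
  (forall y : 'rV[R]_n, (forall i, `|y 0 i - x 0 i| < r)%R -> m%:E <= f y) ->
  (m * (r *+ 2) ^+ n)%:E <= integral_rV f.
Proof.
move=> r0; elim: n f x m => [|n IH] f x m m0 f0 fm /=.
  by rewrite expr0 mulr1; apply: fm => -[].
have r2 : (0 <= r *+ 2)%R by rewrite mulrn_wge0// ltW.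
rewrite exprS mulrCA mulrC EFinM -(lebesgue_measure_ball (x ord0 ord0) (ltW r0)).
apply: integral_ge_cst.
- by rewrite ball_itv; exact: measurable_itv.
- by apply: mulr_ge0 => //; exact: exprn_ge0.
- by move=> t; apply: integral_rV_ge0.
move=> t; rewrite -ball_normE/= => xt.
apply: (IH (fun v => f (row_mx (t%:M : 'rV[R]_1) v)) (\row_j x ord0 (lift ord0 j))%R m) => // y yx.
apply: fm => i.
rewrite mxE; case: splitP => j ij.
  have -> : i = ord0 by apply: val_inj; rewrite /= ij (ord1 j).
  by rewrite (ord1 j) mxE eqxx mulr1n distrC.
have := yx j; rewrite mxE (_ : lift ord0 j = i)//.
by apply: val_inj; rewrite /= ij.
Qed.

End UnmeasuredIntegral.

Section NegativeField.
Context {R : realType} {n : nat} {M : ptopologicalType} {S : smooth_structure R n M}.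
Local Notation smooth_fun := (@smooth_function R n M S).

Lemma cst_smooth (a : R) : smooth_fun (fun=> a).
Proof.
move=> c Sc; apply/smooth_CkP => k.
exact: Ck_cst.
Qed.

Definition opp_field (X : vector_field S) : vector_field S := scaled_field X (cst_smooth (-1)).

Lemma opp_fieldE X c x : opp_field X c x = - X c x.
Proof. by rewrite /= /scale_field scaleN1r. Qed.

Lemma closed_conformal_opp (g : riemannian_metric S) (xi : vector_field S) psi :
  closed_conformal g xi psi -> closed_conformal g (opp_field xi) (fun p => - psi p).
Proof.
move=> [sp H]; split.
  move=> c Sc; apply/smooth_CkP => k.
  have oc : open (chart_img c) by exact: chart_img_open.
  by apply: (@CkN _ _ _ _ (psi \o chart_inv c)) => //; have /smooth_CkP := sp c Sc; exact.
move=> X c Sc x xc; have := H X c Sc x xc; rewrite !nabla_covariant_mx /scale_field.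
have -> : covariant_mx (g c) (opp_field xi c) x = - covariant_mx (g c) (xi c) x.
  apply/matrixP => i k; rewrite !mxE opprD -sumrN.
  have Ck1 := vf_Ck xi 1 k Sc.
  have D : is_derive x ('e_i : 'rV[R]_n) (fun y => xi c y 0 k) (partial i (fun y => xi c y 0 k) x).
    exact: is_derive_partial Ck1 xc.
  congr (_ + _).
    rewrite /partial (_ : (fun y => opp_field xi c y 0 k) = - (fun y => xi c y 0 k)).
      by have [_ ->] := is_deriveN D.
    by apply/funext => y; rewrite opp_fieldE mxE.
  by apply: eq_bigr => j _; rewrite opp_fieldE mxE mulrN.
by rewrite mulmxN => ->; rewrite scaleNr.
Qed.

Lemma field_norm_scale (g : riemannian_metric S) (X : vector_field S) (a : M -> R) p :
  field_norm g (scale_field a X) p = `|a p| * Num.sqrt (sqnorm g X p).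
Proof.
have pc : chart_dom (chart_at S p) p := chart_at_dom S p.
rewrite /field_norm /scale_field /sqnorm chart_mapK// bilinZl bilinZr mulrA -expr2.
by rewrite sqrtrM ?sqr_ge0// sqrtr_sqr.
Qed.

Lemma sqnorm_opp (g : riemannian_metric S) (X : vector_field S) p :
  sqnorm g (opp_field X) p = sqnorm g X p.
Proof.
rewrite /sqnorm; set c := chart_at S p; rewrite !opp_fieldE.
by rewrite -scaleN1r bilinZl bilinZr mulN1r mulN1r opprK.
Qed.

End NegativeField.

Lemma near_bounds {R : realType} {n} (U : set 'rV[R]_n) (f1 f2 f3 : 'rV[R]_n -> R) (x : 'rV[R]_n)
    (a1 a2 b2 a3 : R) : nbhs x U ->
  {for x, continuous f1} -> {for x, continuous f2} -> {for x, continuous f3} ->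
  a1 < f1 x -> a2 < f2 x < b2 -> a3 < f3 x ->
  exists2 r : R, 0 < r & forall y, ball x r y -> [/\ U y, a1 < f1 y, a2 < f2 y < b2 & a3 < f3 y].
Proof.
move=> xU c1 c2 c3 x1 /andP[x2 x2'] x3.
have n1 : nbhs x (f1 @^-1` [set z | a1 < z]) by apply: c1; exact: lt_nbhsr.
have n2 : nbhs x (f2 @^-1` [set z | a2 < z]) by apply: c2; exact: lt_nbhsr.
have n2' : nbhs x (f2 @^-1` [set z | z < b2]) by apply: c2; exact: lt_nbhsl.
have n3 : nbhs x (f3 @^-1` [set z | a3 < z]) by apply: c3; exact: lt_nbhsr.
have [r /= r0 H] := iffLR (nbhs_ballP _ _) (filterI xU (filterI n1 (filterI n2 (filterI n2' n3)))).
by exists r => // y /H[yU [/= y1 [y2 [y2' y3]]]]; split=> //; apply/andP.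
Qed.

(** * Divergence of the integral when the conformal factor is nonzero *)

Section PositiveFactor.
Context {R : realType} {n : nat} {M : ptopologicalType} {S : smooth_structure R n M}.
Variables (n2 : (2 <= n)%N) (g : riemannian_metric S) (gcomplete : complete_metric g)
  (gricci : nonpositive_ricci g) (dM : {measure set (g_sigma_algebraType (@open M)) -> \bar R})
  (dMvol : is_volume g dM) (xi : vector_field S) (psi : M -> R).
Hypothesis xi_conformal : closed_conformal g xi psi.

Lemma smooth_fun_cvg (h : M -> R) c x : @smooth_function R n M S h -> atlas S c -> chart_img c x ->
  {for x, continuous (h \o chart_inv c)}.
Proof. by move=> sh Sc xc; have /smooth_CkP/(_ 0) Ch := sh c Sc; exact: Ck_cont Ch xc. Qed.

Lemma positive_factor_integral p : 0 < psi p -> 0 < sqnorm g xi p ->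
  (\int[dM]_(q in [set: g_sigma_algebraType (@open M)])
     (field_norm g (scale_field psi xi) q)%:E = +oo)%E.
Proof.
move=> psi_p xi_p.
have [phi [phi0 phiD phic]] :=
  complete_flow (fun d Sd y => @slowed_bounded _ _ _ _ g xi d y Sd) gcomplete.
pose c := chart_at S p.
have Sc : atlas S c := chart_at_atlas S p.
have pc : chart_dom c p := chart_at_dom S p.
pose fc k := flow_chart phi0 phiD phic c k.
have Sfc k : atlas S (fc k) by exact: flow_chart_atlas.
pose x0 := c p; have x0c : chart_img c x0 := chart_map_img pc.
pose h := sqnorm g xi p; pose D := \det (g (fc 0) x0).
have D0 : 0 < D.
  by apply: posdef_det_gt0; [exact: Defs.metric_sym|move=> v; exact: metric_pos].
have [r r0 Hr] : exists2 r : R, 0 < r & forall y, ball x0 r y -> [/\ chart_img c y,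
    psi p / 2 < psi (chart_inv c y), h / 2 < sqnorm g xi (chart_inv c y) < 2 * h &
    D / 2 < \det (g (fc 0) y)].
  have [sp _] := xi_conformal.
  have c1 := smooth_fun_cvg sp Sc x0c.
  have c2 := smooth_fun_cvg (sqnorm_smooth g xi) Sc x0c.
  have c3 : {for x0, continuous (fun y => \det (g (fc 0) y))}.
    have CG i j : Ck 0 (chart_img c) (fun y => g (fc 0) y i j) by exact: (metric_Ck g 0 i j (Sfc 0)).
    by have := Ck_det (@chart_img_open _ _ _ c) CG => /Ck_cont; apply.
  have h0 : 0 < h := xi_p.
  apply: (near_bounds (nbhs_chart_img x0c) c1 c2 c3); rewrite /= ?chart_mapK// -/D -/h; lra.
(* The rate of [sqnorm_flow_growth] for the lower bounds [psi p / 2] and [h / 2] valid on the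
   ball. *)
pose kappa := 2 * (psi p / 2) * (h / 2 / (1 + h / 2)).
have h0 : 0 < h := xi_p.
have kappa0 : 0 < kappa.
  by rewrite !mulr_gt0// ?invr_gt0; lra.
(* In time [T] the squared norm grows by at least [2 * h], beyond all its values on the initial
   ball. *)
pose T := 2 * h / kappa.
have T0 : 0 < T by rewrite divr_gt0// mulr_gt0.
have growth y t : ball x0 r y -> 0 <= t -> sqnorm g xi (chart_inv c y) + kappa * t <=
    sqnorm g xi (phi t (chart_inv c y)).
  move=> /Hr[yc y1 /andP[y2 y3] y4] t0.
  by apply: (sqnorm_flow_growth xi_conformal gricci n2 phi0 phic) => //; lra.
(* The image of the initial ball under the flow at time [T *+ k], written as the same coordinate
   ball in the transported chart. *)
pose A k : set (g_sigma_algebraType (@open M)) :=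
  chart_dom (fc (T *+ k)) `&` fc (T *+ k) @^-1` ball x0 r.
have AE k q : A k q -> exists2 y, ball x0 r y & q = phi (T *+ k) (chart_inv c y).
  move=> [qd qb]; exists (fc (T *+ k) q) => //.
  by rewrite -[LHS](chart_mapK qd).
have Tk k : 0 <= T *+ k by rewrite mulrn_wge0// ltW.
have Am k : measurable (A k).
  apply: sub_sigma_algebra; rewrite openE => q [qd qb].
  apply: filterI; first exact: nbhs_chart_dom.
  by apply: (chart_map_cvg qd); apply: open_nbhs_nbhs; split => //; exact: ball_open.
(* The integrand is bounded below through [psi p / 2] and [h / 2]. Each volume is at least that of
   the coordinate cube, [(r *+ 2) ^+ n], times the density bound at time 0, which persists by
   monotonicity of the determinant. *)
apply: (@integral_disjoint_unbounded _ _ _ dM A _ (psi p / 2 * Num.sqrt (h / 2))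
   (Num.sqrt (D / 2) * (r *+ 2) ^+ n)) => //.
- have lt_disj j k q : (j < k)%N -> A j q -> A k q -> False.
    move=> jk /AE[y yb ->] /AE[z zb E].
    (* Flowing a common point back by time [T *+ j] leaves a coincidence between the initial ball
       and its image after at least one period. *)
    have E2 : chart_inv c y = phi (T *+ (k - j)) (chart_inv c z).
      rewrite -[LHS]phi0 -(addNr (T *+ j)) phiD E -phiD; congr (phi _ _).
      by rewrite mulrnBr ?(ltnW jk)// addrC.
    have := growth z (T *+ (k - j)) zb (Tk _); rewrite -E2.
    have [_ _ /andP[_ y3] _] := Hr _ yb; have [_ _ /andP[z2 _] _] := Hr _ zb.
    have : T <= T *+ (k - j).
      by rewrite -[leLHS]mulr1n ler_wpMn2l ?subn_gt0// ltW.
    have : kappa * T = 2 * h by rewrite /T mulrC divfK// gt_eqF.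
    nra.
  apply/trivIsetP => j k _ _ jk; apply/seteqP; split=> // q [qj qk].
  have [jk'|kj|E] := ltngtP j k; [exact: lt_disj jk' qj qk|exact: lt_disj kj qk qj|].
  by rewrite E eqxx in jk.
- by rewrite mulr_gt0// ?sqrtr_gt0; lra.
- by rewrite mulr_gt0 ?sqrtr_gt0 ?exprn_gt0 ?mulrn_wgt0//; lra.
- move=> q; rewrite lee_fin field_norm_scale.
  by apply: mulr_ge0; [exact: normr_ge0|exact: sqrtr_ge0].
- move=> k q /AE[y yb ->]; rewrite lee_fin field_norm_scale.
  have [yc y1 /andP[y2 y3] y4] := Hr _ yb.
  have p1 : psi p / 2 <= psi (phi (T *+ k) (chart_inv c y)).
    apply: (le_trans (ltW y1)); rewrite -[X in psi X <= _]phi0.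
    exact: (psi_flow_nondecreasing xi_conformal gricci n2 phic).
  have h1 : h / 2 <= sqnorm g xi (phi (T *+ k) (chart_inv c y)).
    apply: le_trans (growth y (T *+ k) yb (Tk k)).
    by have : 0 <= kappa * (T *+ k); [apply: mulr_ge0 => //; exact: ltW|lra].
  apply: ler_pM; [lra|exact: sqrtr_ge0| |exact: ler_wsqrtr].
  by apply: (le_trans p1); exact: ler_norm.
- move=> k; rewrite (dMvol (Sfc (T *+ k)) (Am k)); last by move=> q [].
  apply: (@integral_rV_ge_cube _ _ _ x0) => //.
  move=> y yx; have yb : ball x0 r y.
    rewrite -ball_normE/=; apply: norm_lt_coord => // i j.
    by rewrite ord1 !mxE distrC.
  have [yc y1 /andP[y2 y3] y4] := Hr _ yb.
  rewrite lee_fin indicE mem_set ?mul1r; last first.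
    exists (chart_inv (fc (T *+ k)) y); last by rewrite chart_invK.
    by split; [exact: chart_inv_dom|rewrite /= phiNK// chart_invK].
  apply: ler_wsqrtr; apply: (le_trans (ltW y4)).
  apply: (det_flow_nondecreasing xi_conformal gricci n2) => //.
  by apply: ltW; apply: lt_trans y1; rewrite divr_gt0.
Qed.

(* If xi vanished near p, so would its covariant derivative psi id. *)
Lemma nonzero_nearby p : psi p != 0 -> exists2 q, 0 < psi q * psi p & 0 < sqnorm g xi q.
Proof.
move=> psi_p; pose c := chart_at S p.
have Sc : atlas S c := chart_at_atlas S p.
have pc : chart_dom c p := chart_at_dom S p.
have x0c : chart_img c (c p) := chart_map_img pc.
have [sp _] := xi_conformal.
have c1 := smooth_fun_cvg sp Sc x0c.
have n1 : \forall y \near c p, 0 < (psi \o chart_inv c) y * psi p.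
  apply: (c1 [set z : R | 0 < z * psi p]); rewrite [in nbhs _]/= chart_mapK//.
  apply/nbhs_ballP; exists `|psi p|; first by rewrite /= normr_gt0.
  move=> z; rewrite -ball_normE/= -ltr_sqr ?nnegrE// !real_normK ?num_real//.
  have := sqr_ge0 z; nra.
apply: contrapT => Hn.
have n3 : \forall y \near c p, xi c y = 0.
  apply: filterS (filterI (nbhs_chart_img x0c) n1) => y [yc y1].
  apply: contrapT => /eqP xi0; apply: Hn; exists (chart_inv c y) => //.
  by rewrite sqnorm_chart//; exact: metric_pos.
have n0 : (0 < n)%N by exact: leq_trans n2.
pose i := Ordinal n0.
have := conformal_covariant xi_conformal Sc x0c => /matrixP/(_ i i).
rewrite chart_mapK// !mxE eqxx mulr1n.
have -> : partial i (fun y => xi c y 0 i) (c p) = 0.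
  rewrite /partial (@near_eq_derive _ _ _ _ (fun=> 0)); last by apply: filterS n3 => y ->; rewrite mxE.
  exact: derive_cst.
rewrite add0r big1 => [E|j _]; first by rewrite -E eqxx in psi_p.
by rewrite (nbhs_singleton n3) mxE mulr0.
Qed.

End PositiveFactor.

Theorem proposition2p3 (R : realType) (n : nat) (hn : (2 <= n)%N)
    (M : ptopologicalType) (S : smooth_structure R n M)
    (Mconnected : connected [set: M])
    (O : orientation S)
    (g : riemannian_metric S)
    (gcomplete : complete_metric g)
    (gricci : nonpositive_ricci g)
    (dM : {measure set (g_sigma_algebraType (@open M)) -> \bar R})
    (dMvol : is_volume g dM)
    (xi : vector_field S) (psi : M -> R)
    (xi_conformal : closed_conformal g xi psi)
    (xi_integrable :
       (\int[dM]_(p in [set: g_sigma_algebraType (@open M)])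
          (field_norm g (scale_field psi xi) p)%:E < +oo)%E) :
  parallel g xi psi /\ ricci_vanishes_along g xi.
Proof.
have psi0 p : psi p = 0.
  apply: contrapT => /eqP psi_p.
  have [q + xi_q] := nonzero_nearby hn xi_conformal psi_p.
  (* Passing to the opposite field changes the sign of both factors of the integrand and so
     preserves its norm. *)
  have [q0|q0|->] := ltgtP (psi q) 0; last by rewrite mul0r ltxx.
    move=> _; have := positive_factor_integral hn gcomplete gricci dMvol (closed_conformal_opp xi_conformal)
      (p := q); rewrite sqnorm_opp oppr_gt0 => /(_ q0 xi_q).
    rewrite (_ : (fun p => _) = fun p => (field_norm g (scale_field psi xi) p)%:E).
      by move=> E; rewrite E ltxx in xi_integrable.
    apply/funext => s; rewrite !field_norm_scale normrN sqnorm_opp.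
    by [].
  move=> _; have := positive_factor_integral hn gcomplete gricci dMvol xi_conformal q0 xi_q.
  by move=> E; rewrite E ltxx in xi_integrable.
split; first by split.
move=> c Sc x xc; rewrite (ricci_conformal xi_conformal Sc xc) big1 ?mulr0// => j _.
rewrite /partial (_ : psi \o chart_inv c = cst 0) ?derive_cst ?mulr0//.
by apply/funext => y /=.
Qed.
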